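(* Let $\boldsymbol{\lambda}\in\mathcal{P}_+$ be sufficiently deep in the dominant cone. Then the quadratic norm of the monic Bernstein-Szegő polynomial $p_{\boldsymbol{\lambda}}$ is given by $$\langle p_{\boldsymbol{\lambda}},p_{\boldsymbol{\lambda}}\rangle_{\Delta}=\mathcal{N}_{\boldsymbol{\lambda}}^{-1},$$ where $$\mathcal{N}_{\boldsymbol{\lambda}}=\prod_{\boldsymbol{\alpha}\in\mathbf{R}_+^{(s)},\ \langle\tilde{\boldsymbol{\lambda}},\boldsymbol{\alpha}^\vee\rangle=0}\frac{1-\mathbf{t}_s^{1+\mathrm{ht}_s(\boldsymbol{\alpha})}\mathbf{t}_l^{\mathrm{ht}_l(\boldsymbol{\alpha})}}{1-\mathbf{t}_s^{\mathrm{ht}_s(\boldsymbol{\alpha})}\mathbf{t}_l^{\mathrm{ht}_l(\boldsymbol{\alpha})}}\ \prod_{\boldsymbol{\alpha}\in\mathbf{R}_+^{(l)},\ \langle\tilde{\boldsymbol{\lambda}},\boldsymbol{\alpha}^\vee\rangle=0}\frac{1-\mathbf{t}_s^{\mathrm{ht}_s(\boldsymbol{\alpha})}\mathbf{t}_l^{1+\mathrm{ht}_l(\boldsymbol{\alpha})}}{1-\mathbf{t}_s^{\mathrm{ht}_s(\boldsymbol{\alpha})}\mathbf{t}_l^{\mathrm{ht}_l(\boldsymbol{\alpha})}},$$ with $\tilde{\boldsymbol{\lambda}}:=\boldsymbol{\lambda}+\boldsymbol{\rho}-M^{(s)}\boldsymbol{\rho}^{(s)}-M^{(l)}\boldsymbol{\rho}^{(l)}$,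 $\mathbf{t}_s:=-t_1^{(s)}\cdots t_{M^{(s)}}^{(s)}$, $\mathbf{t}_l:=-t_1^{(l)}\cdots t_{M^{(l)}}^{(l)}$, $\mathrm{ht}_s(\boldsymbol{\alpha}):=\sum_{\boldsymbol{\beta}\in\mathbf{R}_+^{(s)}}\langle\boldsymbol{\alpha},\boldsymbol{\beta}^\vee\rangle/2$ and $\mathrm{ht}_l(\boldsymbol{\alpha}):=\sum_{\boldsymbol{\beta}\in\mathbf{R}_+^{(l)}}\langle\boldsymbol{\alpha},\boldsymbol{\beta}^\vee\rangle/2$ (empty products are equal to one).
   Context: Root system. $\mathbf{E}$ is a real finite-dimensional Euclidean vector space with scalar product $\langle\cdot,\cdot\rangle$, and $\mathbf{R}$ is an irreducible, reduced, crystallographic root system spanning $\mathbf{E}$, with a fixed choice of positive roots $\mathbf{R}_+$. Write $\boldsymbol{\alpha}^\vee:=2\boldsymbol{\alpha}/\langle\boldsymbol{\alpha},\boldsymbol{\alpha}\rangle$, $\mathbf{R}^\vee=\{\boldsymbol{\alpha}^\vee\mid\boldsymbol{\alpha}\in\mathbf{R}\}$, $\mathcal{Q}^\vee=\mathrm{Span}_{\mathbb{Z}}(\mathbf{R}^\vee)$, $\mathcal{Q}_+=\mathrm{Span}_{\mathbb{N}}(\mathbf{R}_+)$ (with $0\in\mathbb{N}$), $\mathcal{P}=\{\boldsymbol{\lambda}\in\mathbf{E}\mid\langle\boldsymbol{\lambda},\boldsymbol{\alpha}^\vee\rangle\in\mathbb{Z}\ \forall\boldsymbol{\alpha}\in\mathbf{R}\}$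 (weight lattice), $\mathcal{P}_+=\{\boldsymbol{\lambda}\in\mathcal{P}\mid\langle\boldsymbol{\lambda},\boldsymbol{\alpha}^\vee\rangle\in\mathbb{N}\ \forall\boldsymbol{\alpha}\in\mathbf{R}_+\}$ (dominant weights). $W$ is the Weyl group generated by the orthogonal reflections in the hyperplanes perpendicular to the roots, and $\mathbf{x}_w:=w(\mathbf{x})$. $\mathbf{R}^{(s)}$ and $\mathbf{R}^{(l)}$ are the short and long roots (if $\mathbf{R}$ is simply-laced all roots are short and $\mathbf{R}^{(l)}=\emptyset$), $\mathbf{R}_+^{(s)}=\mathbf{R}^{(s)}\cap\mathbf{R}_+$, $\mathbf{R}_+^{(l)}=\mathbf{R}^{(l)}\cap\mathbf{R}_+$. Put $\boldsymbol{\rho}=\frac12\sum_{\boldsymbol{\alpha}\in\mathbf{R}_+}\boldsymbol{\alpha}$, $\boldsymbol{\rho}^{(s)}=\frac12\sum_{\boldsymbol{\alpha}\in\mathbf{R}_+^{(s)}}\boldsymbol{\alpha}$, $\boldsymbol{\rho}^{(l)}=\frac12\sum_{\boldsymbol{\alpha}\in\mathbf{R}_+^{(l)}}\boldsymbol{\alpha}$. Dominance order: $\boldsymbol{\mu}\preceq\boldsymbol{\lambda}$ iff $\boldsymbol{\lambda}-\boldsymbol{\mu}\in\mathcal{Q}_+$ (and $\prec$ means $\preceq$ and $\neq$). Weight function. $M^{(s)},M^{(l)}$ are nonnegative integers, the parameters $t_m^{(s)}$ ($1\le m\le M^{(s)}$) and $t_m^{(l)}$ ($1\le m\le M^{(l)}$)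 lie in $(-1,1)\setminus\{0\}$, $c^{(s)}(z)=\prod_{m=1}^{M^{(s)}}(1+t_m^{(s)}z)$, $c^{(l)}(z)=\prod_{m=1}^{M^{(l)}}(1+t_m^{(l)}z)$, and $$\delta(\mathbf{x})=\prod_{\boldsymbol{\alpha}\in\mathbf{R}_+}\bigl(e^{i\langle\boldsymbol{\alpha},\mathbf{x}\rangle/2}-e^{-i\langle\boldsymbol{\alpha},\mathbf{x}\rangle/2}\bigr),\quad C(\mathbf{x})=\prod_{\boldsymbol{\alpha}\in\mathbf{R}_+^{(s)}}c^{(s)}(e^{-i\langle\boldsymbol{\alpha},\mathbf{x}\rangle})\prod_{\boldsymbol{\alpha}\in\mathbf{R}_+^{(l)}}c^{(l)}(e^{-i\langle\boldsymbol{\alpha},\mathbf{x}\rangle}),\quad \Delta(\mathbf{x})=\frac{|\delta(\mathbf{x})|^2}{C(\mathbf{x})C(-\mathbf{x})}.$$ Polynomials. For $\boldsymbol{\lambda}\in\mathcal{P}_+$, $m_{\boldsymbol{\lambda}}(\mathbf{x})=\frac{1}{|W_{\boldsymbol{\lambda}}|}\sum_{w\in W}e^{i\langle\boldsymbol{\lambda},\mathbf{x}_w\rangle}$, where $W_{\boldsymbol{\lambda}}=\{w\in W\mid w(\boldsymbol{\lambda})=\boldsymbol{\lambda}\}$; these form a basis of the algebra $\boldsymbol{A}_{\mathbf{R}}$ of $W$-invariant trigonometric polynomials on the torus $\mathbb{T}_{\mathbf{R}}=\mathbf{E}/(2\pi\mathcal{Q}^\vee)$. Inner product on $\boldsymbol{A}_{\mathbf{R}}$: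 $\langle f,g\rangle_\Delta=\frac{1}{|W|\,\mathrm{Vol}(\mathbb{T}_{\mathbf{R}})}\int_{\mathbb{T}_{\mathbf{R}}}f(\mathbf{x})\overline{g(\mathbf{x})}\Delta(\mathbf{x})\,d\mathbf{x}$, with $\mathrm{Vol}(\mathbb{T}_{\mathbf{R}})=\int_{\mathbb{T}_{\mathbf{R}}}d\mathbf{x}$. The monic Bernstein-Szegő polynomial $p_{\boldsymbol{\lambda}}$, $\boldsymbol{\lambda}\in\mathcal{P}_+$, is the unique polynomial of the form $p_{\boldsymbol{\lambda}}=\sum_{\boldsymbol{\mu}\in\mathcal{P}_+,\,\boldsymbol{\mu}\preceq\boldsymbol{\lambda}}a_{\boldsymbol{\lambda}\boldsymbol{\mu}}m_{\boldsymbol{\mu}}$ with $a_{\boldsymbol{\lambda}\boldsymbol{\mu}}\in\mathbb{C}$, $a_{\boldsymbol{\lambda}\boldsymbol{\lambda}}=1$, and $\langle p_{\boldsymbol{\lambda}},m_{\boldsymbol{\mu}}\rangle_\Delta=0$ for all $\boldsymbol{\mu}\in\mathcal{P}_+$ with $\boldsymbol{\mu}\prec\boldsymbol{\lambda}$. Depth. $m^{(s)}(\boldsymbol{\lambda})=\min_{\boldsymbol{\alpha}\in\mathbf{R}_+^{(s)}}\langle\boldsymbol{\lambda},\boldsymbol{\alpha}^\vee\rangle$, $m^{(l)}(\boldsymbol{\lambda})=\min_{\boldsymbol{\alpha}\in\mathbf{R}_+^{(l)}}\langle\boldsymbol{\lambda},\boldsymbol{\alpha}^\vee\rangle$. A weight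 $\boldsymbol{\lambda}\in\mathcal{P}_+$ is sufficiently deep in the dominant cone iff $m^{(s)}(\boldsymbol{\lambda})\ge M^{(s)}-1$ and $m^{(l)}(\boldsymbol{\lambda})\ge M^{(l)}-1$ (if $\mathbf{R}$ is simply-laced, the second condition is vacuous). *)

(* Defs.v *)
From HB Require Import structures.
From mathcomp Require Import all_boot all_order all_algebra.
From mathcomp Require Import sesquilinear complex finmap.
From mathcomp Require Import all_classical all_reals all_analysis.

Set Implicit Arguments.
Unset Strict Implicit.
Unset Printing Implicit Defensive.

Import Order.TTheory GRing.Theory Num.Theory.

Local Open Scope classical_set_scope.
Local Open Scope ring_scope.
Local Open Scope complex_scope.

Section UnitCube.
Context (R : realType).

Definition tcons n (p : measurableTypeR R * n.-tuple (measurableTypeR R)) :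
  n.+1.-tuple (measurableTypeR R) := [tuple of p.1 :: p.2].

Lemma measurable_tcons n : measurable_fun [set: _] (@tcons n).
Proof. exact: (@measurable_cons _ _ _ _ fst n snd). Qed.

HB.instance Definition _ n :=
  @isMeasurableFun.Build _ _ _ _ (@tcons n) (@measurable_tcons n).

(* n-dimensional Lebesgue measure on [0, 1]^n, obtained as the n-fold product
   of the uniform probability measure on [0, 1] (a Dirac mass for n = 0). *)
Fixpoint cube n : probability (n.-tuple (measurableTypeR R)) R :=
  match n return probability (n.-tuple (measurableTypeR R)) R with
  | 0 => \d_ [tuple]
  | m.+1 => distribution ((uniform_prob (@ltr01 R)) \x (cube m))%E (@tcons m)
  end.

Definition cube_integral n (f : n.-tuple (measurableTypeR R) -> R[i]) : R[i] :=
  (\int[cube n]_u complex.Re (f u)) +i* (\int[cube n]_u complex.Im (f u)).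

Definition expi (x : R) : R[i] := cos x +i* sin x.

End UnitCube.

Section RootSystem.
Context (R : realType) (E : vectType R) (ip : {dot E for idfun}).

Definition coroot (a : E) : E := (2 / ip a a) *: a.

Definition reflection (a x : E) : E := x - ip x (coroot a) *: a.

Lemma reflection_is_linear a : linear (reflection a).
Proof.
move=> k x y; rewrite /reflection linearPl /= scalerDl opprD addrACA.
by rewrite -scalerA -scalerBr.
Qed.

HB.instance Definition _ a :=
  GRing.isLinear.Build R E E *:%R (reflection a) (reflection_is_linear a).

Record root_system (roots : seq E) : Prop := RootSystem {
  roots_uniq : uniq roots;
  roots_neq0 : 0 \notin roots;
  roots_span : (<<roots>>)%VS = fullv;
  roots_reflection :
    forall a b, a \in roots -> b \in roots -> reflection a b \in roots;
  roots_crystallographic :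
    forall a b, a \in roots -> b \in roots -> ip b (coroot a) \is a Num.int;
  roots_reduced :
    forall (a : E) (c : R), a \in roots -> c *: a \in roots ->
      c = 1 \/ c = - 1 }.

Definition irreducible (roots : seq E) : Prop :=
  roots <> [::] /\
  forall A : pred E,
    (forall a b, a \in roots -> b \in roots -> A a -> ~~ A b -> ip a b = 0) ->
    (forall a, a \in roots -> A a) \/ (forall a, a \in roots -> ~~ A a).

(* The positive roots are those on one side of a hyperplane v^perp that
   contains no root. *)
Definition positive_system (roots pos : seq E) : Prop :=
  uniq pos /\
  exists2 v : E, forall a, a \in roots -> ip v a != 0
               & forall a, (a \in pos) = (a \in roots) && (0 < ip v a).

Context (roots pos : seq E).

(* In an irreducible root system at most two lengths occur, so long means
   longer than some root; in the simply-laced case all roots are short. *)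
Definition long_root (a : E) : bool := has (fun b => ip b b < ip a a) roots.

Definition pos_s : seq E := [seq a <- pos | ~~ long_root a].
Definition pos_l : seq E := [seq a <- pos | long_root a].

Definition half_sum (s : seq E) : E := 2^-1 *: \sum_(a <- s) a.

Definition coroot_lattice : set E :=
  [set x | exists k : E -> int, x = \sum_(a <- roots) coroot a *~ k a].

Definition weight_lattice : set E :=
  [set x | forall a, a \in roots -> ip x (coroot a) \is a Num.int].

Definition dominant : set E :=
  [set x | weight_lattice x /\
           forall a, a \in pos -> ip x (coroot a) \is a Num.nat].

Definition dominance_le (mu lambda : E) : Prop :=
  exists k : E -> nat, lambda - mu = \sum_(a <- pos) a *+ k a.

Definition dominance_lt (mu lambda : E) : Prop :=
  dominance_le mu lambda /\ mu <> lambda.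

(* Closure under inverses is automatic, as reflections are involutions. *)
Inductive weyl_group : 'End(E) -> Prop :=
| weyl_id : weyl_group \1%VF
| weyl_reflection a w : a \in roots -> weyl_group w ->
    weyl_group (linfun (reflection a) \o w)%VF.

Definition weyl_stab (lambda : E) : set 'End(E) :=
  [set w | weyl_group w /\ w lambda = lambda].

Definition weyl_order : nat := #|` fset_set (weyl_group : set 'End(E))|.

(* [\sum_(w \in A)] sums over a classical set A; W is finite. *)
Definition monomial_sym (lambda x : E) : R[i] :=
  (#|` fset_set (weyl_stab lambda)|%:R)^-1 *
  \sum_(w \in (weyl_group : set 'End(E))) expi (ip lambda (w x)).

Section Torus.
Context (n : nat) (b : n.-tuple E).

Definition coroot_lattice_basis : Prop :=
  basis_of fullv b /\
  forall x, coroot_lattice x <->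
    exists k : 'I_n -> int, x = \sum_(i < n) tnth b i *~ k i.

Definition torus_param (u : n.-tuple (measurableTypeR R)) : E :=
  \sum_(i < n) (2 * pi * tnth u i) *: tnth b i.

(* Euclidean volume of the parallelepiped spanned by the 2 pi b_i, i.e. the
   Jacobian of [torus_param]. *)
Definition torus_jacobian : R :=
  Num.sqrt (\det (\matrix_(i < n, j < n)
    ip ((2 * pi) *: tnth b i) ((2 * pi) *: tnth b j))).

(* Integral over E / 2 pi Q^vee of a (2 pi Q^vee)-periodic function on E,
   computed on the fundamental domain [torus_param @` [0, 1]^n]. *)
Definition torus_integral (f : E -> R[i]) : R[i] :=
  torus_jacobian%:C * cube_integral (f \o torus_param).

Definition torus_vol : R[i] := torus_integral (fun=> 1).

Context (Ms Ml : nat) (ts : 'I_Ms -> R) (tl : 'I_Ml -> R).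

Definition delta (x : E) : R[i] :=
  \prod_(a <- pos) (expi (ip a x / 2) - expi (- (ip a x / 2))).

Definition cfun M (t : 'I_M -> R) (z : R[i]) : R[i] :=
  \prod_(m < M) (1 + (t m)%:C * z).

Definition Cfun (x : E) : R[i] :=
  (\prod_(a <- pos_s) cfun ts (expi (- ip a x))) *
  (\prod_(a <- pos_l) cfun tl (expi (- ip a x))).

Definition weight (x : E) : R[i] := `|delta x| ^+ 2 / (Cfun x * Cfun (- x)).

Definition inner (f g : E -> R[i]) : R[i] :=
  (weyl_order%:R * torus_vol)^-1 *
  torus_integral (fun x => f x * (g x)^* * weight x).

Definition bernstein_szego (lambda : E) (p : E -> R[i]) : Prop :=
  (exists a : E -> R[i],
     a lambda = 1 /\
     forall x, p x = \sum_(mu \in [set mu | dominant mu /\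
                                           dominance_le mu lambda])
                       a mu * monomial_sym mu x) /\
  forall mu, dominant mu -> dominance_lt mu lambda ->
    inner p (monomial_sym mu) = 0.

(* Minimum over s of the pairings with coroots; +oo if s is empty, so that the
   condition on the long roots is vacuous in the simply-laced case. *)
Definition depth (s : seq E) (lambda : E) : \bar R :=
  \big[Order.min/+oo%E]_(a <- s) (ip lambda (coroot a))%:E.

Definition sufficiently_deep (lambda : E) : Prop :=
  ((Ms%:R - 1)%:E <= depth pos_s lambda)%E /\
  ((Ml%:R - 1)%:E <= depth pos_l lambda)%E.

Definition lambda_tilde (lambda : E) : E :=
  lambda + half_sum pos - half_sum pos_s *+ Ms - half_sum pos_l *+ Ml.

Definition tt_s : R := - \prod_(m < Ms) ts m.
Definition tt_l : R := - \prod_(m < Ml) tl m.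

Definition ht (s : seq E) (a : E) : R := \sum_(c <- s) ip a (coroot c) / 2.

(* For a positive root a, ht pos_s a (resp. ht pos_l a) is the number of short
   (resp. long) simple roots in a, so that truncation to nat loses nothing. *)
Definition ht_s (a : E) : nat := Num.truncn (ht pos_s a).
Definition ht_l (a : E) : nat := Num.truncn (ht pos_l a).

Definition norm_const (lambda : E) : R :=
  (\prod_(a <- pos_s | ip (lambda_tilde lambda) (coroot a) == 0)
     ((1 - tt_s ^+ (1 + ht_s a) * tt_l ^+ ht_l a) /
      (1 - tt_s ^+ ht_s a * tt_l ^+ ht_l a))) *
  (\prod_(a <- pos_l | ip (lambda_tilde lambda) (coroot a) == 0)
     ((1 - tt_s ^+ ht_s a * tt_l ^+ (1 + ht_l a)) /
      (1 - tt_s ^+ ht_s a * tt_l ^+ ht_l a))).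

End Torus.
End RootSystem.

(* Main.v *)
Require Import Defs.
From mathcomp Require Import all_boot all_order all_algebra.
From mathcomp Require Import sesquilinear complex finmap.
From mathcomp Require Import all_classical all_reals all_analysis.
From mathcomp Require Import measurable_realfun.
From mathcomp Require Import ring lra.

Set Implicit Arguments.
Unset Strict Implicit.
Unset Printing Implicit Defensive.

Import Order.TTheory GRing.Theory Num.Theory.

Local Open Scope ring_scope.
Local Open Scope complex_scope.

(* Put L = lambda + rho and let A be the alternating sum over W of C e^L.
   Expanding the product C and grouping the terms by Weyl chamber writes A as
   N J_L plus alternating orbit sums J_mu with mu < L, where N is the sum over
   the stabilizer of the weight lambda~ of the products of the t_alpha over the
   positive roots alpha that w makes negative; here depth is used, to make
   lambda~ dominant.  Orthogonality kills the lower terms in <p, A / delta>, so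
   this pairing is conj(N) <p, m_lambda> = conj(N) <p, p>.  By antisymmetry it
   is also the constant term of p times conj(C e^L) delta / (C conj(C)), that
   is, of p e^{-lambda} prod (1 - e^{-alpha}) / C: as 1 / C is a convergent
   series in the e^{-alpha}, only the leading term e^lambda of p contributes,
   and the constant term is 1.  Hence <p, p> = 1 / N.  Macdonald's product
   formula turns N into the stated product: expand the alternating sum of
   e^rho prod (1 - t_alpha e^{-alpha}) over the stabilizer in the same way and
   specialize e^{-alpha} to t_alpha at the simple roots, where all terms but
   that of the identity vanish. *)

(** The three expansions into alternating sums are instances of one lemma, [expansion]: for C e^L
    each positive root is repeated once per parameter, for m_mu delta every parameter is -1, and for
    the product formula the roots are those orthogonal to lambda~. This is why it is stated for a
    finite family of roots and for the stabilizer of a dominant vector, which is all of W when that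
    vector is 0. The obstacle on the analytic side is that 1 / C has infinitely many frequencies. A
    function is therefore controlled by a set of frequencies from which trigonometric polynomials
    approximate it uniformly; the constant term is continuous for this approximation, so it vanishes
    as soon as the set avoids 0. The specialization in the product formula takes place at a
    character of E that need not be unitary: there |e^{-alpha}| = |t_alpha| < 1 at the simple roots
    orthogonal to lambda~, and this keeps the denominators 1 - e^{-alpha} away from 0. *)

Lemma count_lt (T : eqType) (p q : pred T) (s : seq T) x :
  x \in s -> q x -> ~~ p x -> (forall y, p y -> q y) ->
  (count p s < count q s)%N.
Proof.
move=> xs qx px pq; elim: s xs => //= y s IH; rewrite inE.
have le z : (p z <= q z)%N by case: (p z) (pq z) => // ->.
case/predU1P => [<-|/IH h]; last by rewrite -addnS leq_add.
by rewrite qx (negbTE px) add0n add1n ltnS; apply: sub_count.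
Qed.

Lemma perm_map_in (T : eqType) (s : seq T) (f : T -> T) :
  uniq s -> {in s &, injective f} -> (forall x, x \in s -> f x \in s) ->
  perm_eq [seq f x | x <- s] s.
Proof.
move=> us fi fs; have um : uniq [seq f x | x <- s] by rewrite map_inj_in_uniq.
have sub : {subset [seq f x | x <- s] <= s}.
  by move=> _ /mapP[x xs ->]; apply: fs.
have [|_ ms] := uniq_min_size um sub; first by rewrite size_map.
exact: uniq_perm.
Qed.

Lemma seq_argmax (R : realDomainType) (T : eqType) (s : seq T) (f : T -> R) x :
  x \in s -> exists2 y, y \in s & forall z, z \in s -> f z <= f y.
Proof.
elim: s x => // y s IH x _; case: s IH => [_|z s IH].
  by exists y => [|z]; rewrite inE // => /eqP ->.
have [w ws hw] := IH z (mem_head _ _).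
have [h|h] := leP (f w) (f y).
  exists y => [|u]; rewrite ?mem_head // inE => /orP[/eqP->//|/hw h'].
  exact: le_trans h.
exists w => [|u]; first by rewrite inE ws orbT.
by rewrite inE => /orP[/eqP->|/hw//]; apply: ltW.
Qed.

Lemma int_gt0_ge1 (R : realType) (z : R) : z \is a Num.int -> 0 < z -> 1 <= z.
Proof. by move=> /intrP[m ->]; rewrite ltr0z ler1z gtz0_ge1. Qed.

(** * Reflections *)

Section InnerProduct.
Context (R : realType) (E : vectType R) (ip : {dot E for idfun}).
Implicit Types x y a b : E.

Lemma ipC x y : ip x y = ip y x.
Proof. by rewrite hermC mul1r. Qed.

Lemma ipDr x y z : ip x (y + z) = ip x y + ip x z. Proof. exact: linearDr. Qed.
Lemma ipNr x y : ip x (- y) = - ip x y. Proof. exact: linearNr. Qed.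
Lemma ipBr x y z : ip x (y - z) = ip x y - ip x z. Proof. exact: linearBr. Qed.
Lemma ip0r x : ip x 0 = 0. Proof. exact: linear0r. Qed.
Lemma ipZr x c y : ip x (c *: y) = c * ip x y.
Proof. exact: (linearZr_LR ip x c y). Qed.
Lemma ipMnr x y n : ip x (y *+ n) = ip x y *+ n.
Proof. exact: linearMnr. Qed.
Lemma ip_sumr I (r : seq I) (P : pred I) (F : I -> E) x :
  ip x (\sum_(i <- r | P i) F i) = \sum_(i <- r | P i) ip x (F i).
Proof. exact: linear_sumr. Qed.

Lemma ipDl x y z : ip (x + y) z = ip x z + ip y z.
Proof. by rewrite ipC ipDr !(ipC z). Qed.
Lemma ipNl x y : ip (- x) y = - ip x y.
Proof. by rewrite ipC ipNr ipC. Qed.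
Lemma ipBl x y z : ip (x - y) z = ip x z - ip y z.
Proof. by rewrite ipDl ipNl. Qed.
Lemma ip0l x : ip 0 x = 0. Proof. by rewrite ipC ip0r. Qed.
Lemma ipZl c x y : ip (c *: x) y = c * ip x y.
Proof. by rewrite ipC ipZr ipC. Qed.
Lemma ipMnl x y n : ip (x *+ n) y = ip x y *+ n.
Proof. by rewrite ipC ipMnr ipC. Qed.
Lemma ip_suml I (r : seq I) (P : pred I) (F : I -> E) x :
  ip (\sum_(i <- r | P i) F i) x = \sum_(i <- r | P i) ip (F i) x.
Proof. by rewrite ipC ip_sumr; apply: eq_bigr => i _; rewrite ipC. Qed.

Lemma ip_gt0 x : x != 0 -> 0 < ip x x.
Proof. exact: neq0_dnorm_gt0. Qed.

Lemma ip_ge0 x : 0 <= ip x x.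
Proof. by have [->|/ip_gt0/ltW//] := eqVneq x 0; rewrite ip0r. Qed.

Lemma ip_eq0 x : (ip x x == 0) = (x == 0).
Proof.
by have [->|/ip_gt0/gt_eqF//] := eqVneq x 0; rewrite ip0r eqxx.
Qed.

Lemma ip_nondeg x : (forall y, ip x y = 0) -> x = 0.
Proof. by move=> h; apply/eqP; rewrite -ip_eq0 h. Qed.

Lemma ip_corootE x a : ip x (coroot ip a) = 2 * ip x a / ip a a.
Proof. by rewrite /coroot ipZr mulrAC. Qed.

Lemma coroot_sign a x : a != 0 ->
  (0 < ip x (coroot ip a)) = (0 < ip x a) /\
  (0 <= ip x (coroot ip a)) = (0 <= ip x a) /\
  (ip x (coroot ip a) == 0) = (ip x a == 0).
Proof.
move=> /ip_gt0 a0; rewrite ip_corootE.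
have h : 0 < (ip a a)^-1 by rewrite invr_gt0.
rewrite pmulr_lgt0 // pmulr_lge0 // mulf_eq0 (gt_eqF h) orbF.
by rewrite pmulr_rgt0 // pmulr_rge0 // mulf_eq0 pnatr_eq0 orFb.
Qed.

Lemma coroot_gt0 a x : a != 0 -> (0 < ip x (coroot ip a)) = (0 < ip x a).
Proof. by move=> /(coroot_sign x)[]. Qed.
Lemma coroot_ge0 a x : a != 0 -> (0 <= ip x (coroot ip a)) = (0 <= ip x a).
Proof. by move=> /(coroot_sign x)[_ []]. Qed.
Lemma coroot_eq0 a x : a != 0 -> (ip x (coroot ip a) == 0) = (ip x a == 0).
Proof. by move=> /(coroot_sign x)[_ []]. Qed.

Lemma ip_coroot_id a : a != 0 -> ip a (coroot ip a) = 2.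
Proof. by move=> a0; rewrite ip_corootE mulfK // ip_eq0. Qed.

Lemma reflection_id a : a != 0 -> reflection ip a a = - a.
Proof.
move=> a0; rewrite /reflection ip_coroot_id // scaler_nat mulr2n opprD addrA.
by rewrite subrr sub0r.
Qed.

Lemma reflection_ipl a x y :
  ip (reflection ip a x) y = ip x (reflection ip a y).
Proof.
rewrite /reflection ipBl ipBr !ip_corootE ipZl ipZr (ipC y a).
by rewrite (ipC x a); set h := (ip a a)^-1; ring.
Qed.

Lemma reflectionK a : a != 0 -> involutive (reflection ip a).
Proof.
move=> a0 x; rewrite {1}/reflection.
have -> : ip (reflection ip a x) (coroot ip a) = - ip x (coroot ip a).
  by rewrite !ip_corootE reflection_ipl reflection_id // ipNr mulrN mulNr.
by rewrite scaleNr opprK subrK.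
Qed.

Lemma reflection_isom a x y : a != 0 ->
  ip (reflection ip a x) (reflection ip a y) = ip x y.
Proof. by move=> a0; rewrite reflection_ipl reflectionK. Qed.

Lemma reflection_fix a x : a != 0 -> ip x a = 0 -> reflection ip a x = x.
Proof.
by move=> a0 h; rewrite /reflection ip_corootE h mulr0 mul0r scale0r subr0.
Qed.

End InnerProduct.

(** * Real cones spanned by finitely many vectors *)

Section Cone.
Context (R : realType) (E : vectType R).
Implicit Types (D : seq E) (x : E).

Definition cone D x : Prop :=
  exists c : E -> R, (forall a, 0 <= c a) /\ x = \sum_(a <- D) c a *: a.

Lemma cone_add D x y : cone D x -> cone D y -> cone D (x + y).
Proof.
move=> [c [c0 ->]] [d [d0 ->]]; exists (fun a => c a + d a); split.
  by move=> a; rewrite addr_ge0.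
by rewrite -big_split /=; apply: eq_bigr => a _; rewrite scalerDl.
Qed.

Lemma cone_scale D k x : 0 <= k -> cone D x -> cone D (k *: x).
Proof.
move=> k0 [c [c0 ->]]; exists (fun a => k * c a); split.
  by move=> a; rewrite mulr_ge0.
by rewrite scaler_sumr; apply: eq_bigr => a _; rewrite scalerA.
Qed.

Lemma cone0 D : cone D 0.
Proof.
by exists (fun=> 0); split=> //; rewrite big1 // => a _; rewrite scale0r.
Qed.

Lemma cone_sum D (I : eqType) (r : seq I) (F : I -> E) :
  (forall i, i \in r -> cone D (F i)) -> cone D (\sum_(i <- r) F i).
Proof.
move=> h; rewrite big_seq; elim/big_ind: _ => //; first exact: cone0.
exact: cone_add.
Qed.

Lemma cone_mem D x : uniq D -> x \in D -> cone D x.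
Proof.
move=> uD xD; exists (fun a => (a == x)%:R); split=> //.
rewrite (bigD1_seq x) //= eqxx scale1r big1 ?addr0 // => a /negbTE ->.
by rewrite scale0r.
Qed.

End Cone.

Lemma depth_le (R : realType) (E : vectType R) (ip : {dot E for idfun})
  s (x : R) (y : E) : (x%:E <= depth ip s y)%E ->
  forall a, a \in s -> x <= ip y (coroot ip a).
Proof.
rewrite /depth; elim: s => // c s IH; rewrite big_cons le_min lee_fin.
move=> /andP[h1 h2] a; rewrite inE => /orP[/eqP->//|]; exact: IH.
Qed.

(** One factor gives the strict inequality and the others have modulus at most 1. For [M = 0] the
    product is 1, hence the condition on [M]. *)
Lemma norm_prod_lt1 (R : realType) M (t : 'I_M -> R) : (0 < M)%N ->
  (forall m, -1 < t m < 1) -> `|\prod_m t m| < 1.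
Proof.
case: M t => // M t _ ht; rewrite normr_prod big_ord_recl.
apply: le_lt_trans (_ : `|t ord0| < 1); last by rewrite ltr_norml.
rewrite ler_piMr //; apply: prodr_ile1 => i _; rewrite normr_ge0 /=.
by rewrite ltW // ltr_norml.
Qed.

(** * Fourier analysis on the torus *)

Section CubeFourier.
Import numFieldNormedType.Exports.
Local Open Scope classical_set_scope.
Context (R : realType).

Definition phase n (k : 'I_n -> int) (u : n.-tuple (measurableTypeR R)) : R :=
  \sum_(i < n) 2 * pi * tnth u i * (k i)%:~R.

Lemma measurable_cosR : measurable_fun [set: R] (@cos R).
Proof. by apply: continuous_measurable_fun; exact: continuous_cos. Qed.

Lemma measurable_phase n (k : 'I_n -> int) :
  measurable_fun [set: n.-tuple (measurableTypeR R)] (phase k).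
Proof.
apply: measurable_sum => i.
apply: measurable_funM; last exact: measurable_cst.
apply: measurable_funM; first exact: measurable_cst.
exact: measurable_tnth.
Qed.

Lemma measurable_cos_phase n (k : 'I_n -> int) c :
  measurable_fun [set: n.-tuple (measurableTypeR R)]
    (fun u => cos (c + phase k u)).
Proof.
apply: (measurableT_comp measurable_cosR).
by apply: measurable_funD; [exact: measurable_cst|exact: measurable_phase].
Qed.

Lemma measurable_Ecos_phase n (k : 'I_n -> int) c :
  measurable_fun [set: n.-tuple (measurableTypeR R)]
    (EFin \o (fun u => cos (c + phase k u))).
Proof. by apply/measurable_EFinP; exact: measurable_cos_phase. Qed.

Lemma cosDint (c : R) (k : int) : cos (c + 2 * pi * k%:~R) = cos c.
Proof.
have h (x : R) (m : nat) : cos (x + 2 * pi * m%:R) = cos x.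
  elim: m => [|m IH]; first by rewrite mulr0n mulr0 addr0.
  by rewrite -[m.+1%:R]natr1 mulrDr mulr1 addrA mulr_natl cosD2pi -mulr_natl.
case: k => m; first exact: h.
by rewrite NegzE -[LHS](h _ m.+1) mulrNz -pmulrn mulrN addrNK.
Qed.

Let is_derive_scale (a x : R) : is_derive x (1 : R) (fun y : R => a * y) a.
Proof.
rewrite -[X in is_derive _ _ _ X]mulr1.
exact: (is_deriveZ a (is_derive_id (x : R) (1 : R))).
Qed.

Let is_derive_sin_affine (w c x : R) :
  is_derive x (1 : R) (fun y : R => sin (c + w * y)) (cos (c + w * x) * w).
Proof.
apply: (@is_derive1_comp _ (@sin R) (fun y => c + w * y)).
rewrite -[X in is_derive _ _ _ X]add0r.
by apply: (@is_deriveD _ _ _ (cst c) (fun y : R => w * y)).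
Qed.

(** The shift [c] lets one statement about real integrals cover the sine as well, which is the
    cosine shifted by pi / 2. *)
Lemma uniform_cos (c : R) (k : int) :
  (\int[uniform_prob (@ltr01 R)]_x (cos (c + 2 * pi * x * k%:~R))%:E =
   (if k == 0 then cos c else 0)%:E)%E.
Proof.
pose w : R := 2 * pi * k%:~R.
have wE (x : R) : c + 2 * pi * x * k%:~R = c + w * x.
  by rewrite /w mulrAC.
have mc (f : R -> R) : continuous f ->
  measurable_fun [set: measurableTypeR R] f.
  exact: continuous_measurable_fun.
have cl : continuous (fun x : R => c + w * x).
  move=> x; apply: cvgD; first exact: cvg_cst.
  by apply: cvgM; [exact: cvg_cst|exact: cvg_id].
have cc : continuous (fun x : R => cos (c + w * x)).
  by move=> x; apply: continuous_comp; [exact: cl|exact: continuous_cos].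
have c1 : continuous (fun x : R => 1 + cos (c + w * x)).
  by move=> x; apply: cvgD; [exact: cvg_cst|exact: cc].
(* Integration against the uniform law is reduced to Lebesgue measure for nonnegative integrands,
   hence the added 1; it is subtracted again at the end. *)
have h1 : (\int[uniform_prob (@ltr01 R)]_x (1 + cos (c + w * x))%:E =
   (1 + if k == 0 then cos c else 0)%:E)%E.
  rewrite integral_uniform; last 2 first.
  - by apply/measurable_EFinP; apply: mc.
  - by move=> x; rewrite lee_fin -lerBlDl sub0r cos_geN1.
  rewrite subr0 invr1 mul1e.
  have [F [dF F01]] : exists F : R -> R,
      (forall x : R, is_derive x (1 : R) F (1 + cos (c + w * x))) /\
      F 1 - F 0 = 1 + if k == 0 then cos c else 0.
    have [k0|k0] := eqVneq k 0.
      exists (fun y => (1 + cos c) * y); split;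
        last by rewrite mulr1 mulr0 subr0.
      by move=> x; rewrite /w k0 mulr0 mul0r addr0.
    have w0 : w != 0.
      by rewrite /w mulf_neq0 ?intr_eq0 // mulf_neq0 ?pnatr_eq0 // gt_eqF //
        pi_gt0.
    exists (fun y => y + w^-1 * sin (c + w * y)); split.
      move=> x; rewrite -[X in 1 + X](mulKf w0) [w * cos _]mulrC.
      have hs : is_derive x (1 : R) (fun y => w^-1 * sin (c + w * y))
          (w^-1 * (cos (c + w * x) * w)).
        by apply: (@is_derive1_comp _ (fun y => w^-1 * y)).
      exact: (is_deriveD (is_derive_id x (1 : R)) hs).
    rewrite /= mulr1 mulr0 !addr0 add0r.
    have -> : sin (c + w) = sin c.
      by rewrite -[LHS]cosBpihalf addrAC cosDint cosBpihalf.
    by rewrite addrK.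
  have cF : continuous F.
    move=> x; apply: differentiable_continuous; apply/derivable1_diffP.
    by have [] := dF x.
  rewrite (@continuous_FTC2 _ _ F) ?ltr01 //; last 3 first.
  - by apply: continuous_subspaceT => x; exact: c1.
  - split; first by move=> x _; have [] := dF x.
      by apply: cvg_at_right_filter; exact: cF.
    by apply: cvg_at_left_filter; exact: cF.
  - by move=> x _; rewrite derive1E; have [_ ->] := dF x.
  by rewrite -EFinB F01.
under eq_integral do rewrite wE -[cos _](addKr 1) addrC EFinB.
rewrite integralB_EFin //=; last 2 first.
- apply: measurable_bounded_integrable => //.
  + by rewrite [X in (X < _)%E]probability_setT ltry.
  + exact: mc.
  + exists 2; split=> [|M M1]; first exact: num_real.
    move=> x _; apply: le_trans (ltW M1).
    by rewrite ger0_norm -?lerBlDl ?sub0r ?cos_geN1 // -lerBrDl cos_le1.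
- exact: finite_measure_integrable_cst.
rewrite h1 integral_cst // mul1e.
rewrite [X in (_ - X)%E](_ : _ = 1%:E); last exact: probability_setT.
by rewrite -EFinB addrAC subrr add0r.
Qed.

(** Induction on [n] by Fubini: in the integral over the remaining coordinates, the first one is
    absorbed into the shift, so the induction hypothesis must hold for all [c]. *)
Lemma cube_cos n (k : 'I_n -> int) (c : R) :
  (\int[cube R n]_u (cos (c + phase k u))%:E =
   (if [forall i, k i == 0] then cos c else 0)%:E)%E.
Proof.
elim: n k c => [|n IH] k c.
  rewrite integral_dirac //=; last exact: measurable_Ecos_phase.
  rewrite diracT mul1e /phase big_ord0 addr0; case: ifPn => // /forallPn[[]//].
pose f (p : measurableTypeR R * n.-tuple (measurableTypeR R)) : R :=
  cos (c + phase k (tcons p)).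
have fint : ((uniform_prob (@ltr01 R)) \x cube R n)%E.-integrable
    [set: _] (EFin \o f).
  apply: measurable_bounded_integrable => //.
  + by rewrite [X in (X < _)%E]probability_setT ltry.
  + exact: (measurableT_comp (measurable_cos_phase k c)
      (@measurable_tcons R n)).
  + exists 1; split=> [|M M1]; first exact: num_real.
    by move=> x _; apply: le_trans (ltW M1); rewrite ler_norml cos_geN1 cos_le1.
rewrite /= integral_distribution; last 2 first.
- exact: measurable_Ecos_phase.
- exact: fint.
rewrite -(integral12_prod_meas1 fint).
have step x : fubini_F (cube R n) (EFin \o f) x =
    (if [forall i, k (lift ord0 i) == 0]
     then cos (c + 2 * pi * x * (k ord0)%:~R) else 0)%:E.
  rewrite /fubini_F /f /= -IH; apply: eq_integral => y _.
  congr (cos _)%:E; rewrite /phase big_ord_recl -addrA; congr (_ + (_ + _)).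
  by apply: eq_bigr => i _; rewrite tnthS.
under eq_integral => x _ do rewrite step.
have -> : [forall i, k i == 0] =
    (k ord0 == 0) && [forall i, k (lift ord0 i) == 0].
  apply/forallP/andP => [h|[h0 /forallP h] i].
    by split=> //; apply/forallP => i.
  by case: (unliftP ord0 i) => [j ->|->].
case: [forall i, k (lift ord0 i) == 0]; last first.
  by rewrite andbF integral0_eq.
by rewrite andbT uniform_cos.
Qed.

End CubeFourier.

(** * The real-valued modulus and the unitary exponential *)

Section ComplexNorm.
Import ComplexField.Normc.
Context (R : realType).
Implicit Types (z : R[i]).

Lemma normc_triangle z1 z2 : normc (z1 + z2) <= normc z1 + normc z2.
Proof. exact: (@le_normcD R). Qed.

Lemma normc_opp z : normc (- z) = normc z.
Proof. exact: (@normcN R). Qed.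

Lemma normc_ge0 z : 0 <= normc z.
Proof. by case: z => a b; apply: sqrtr_ge0. Qed.

Lemma normc_triangleB z1 z2 : normc (z1 - z2) <= normc z1 + normc z2.
Proof. by rewrite (le_trans (normc_triangle _ _)) // normc_opp. Qed.

Lemma normc_sum (I : Type) (r : seq I) (P : pred I) (F : I -> R[i]) :
  normc (\sum_(i <- r | P i) F i) <= \sum_(i <- r | P i) normc (F i).
Proof.
elim/big_ind2: _ => [|z1 x1 z2 x2 h1 h2|//]; first by rewrite normc0.
exact: (le_trans (normc_triangle x1 x2) (lerD h1 h2)).
Qed.

Lemma normcX z n : normc (z ^+ n) = normc z ^+ n.
Proof.
elim: n => [|n IH]; first by rewrite !expr0 normc1.
by rewrite !exprS normcM IH.
Qed.

Lemma normc_real (x : R) : normc x%:C = `|x|.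
Proof. by rewrite /= expr0n addr0 sqrtr_sqr. Qed.

Lemma normc_conj z : normc z^* = normc z.
Proof. by case: z => a b /=; rewrite sqrrN. Qed.

Lemma Re_le_normc z : `|complex.Re z| <= normc z.
Proof.
case: z => a b /=; rewrite -sqrtr_sqr; apply: ler_wsqrtr.
by rewrite lerDl sqr_ge0.
Qed.

Lemma Im_le_normc z : `|complex.Im z| <= normc z.
Proof.
case: z => a b /=; rewrite -sqrtr_sqr; apply: ler_wsqrtr.
by rewrite lerDr sqr_ge0.
Qed.

Lemma normc_le_ReIm z : normc z <= `|complex.Re z| + `|complex.Im z|.
Proof.
rewrite {1}[z]complexE; apply: le_trans (normc_triangle _ _) _.
rewrite normc_real lerD2l normcM normc_real.
by rewrite /= expr0n expr1n add0r sqrtr1 mul1r.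
Qed.

Lemma normc_small_eq0 z : (forall e, 0 < e -> normc z <= e) -> z = 0.
Proof.
move=> h; apply/eq0_normc/le_anti; rewrite normc_ge0 andbT.
by apply/ler_addgt0Pl => e e0; rewrite addr0 h.
Qed.

Lemma expi0 : expi (0 : R) = 1.
Proof. by rewrite /expi cos0 sin0. Qed.

Lemma expiD (x y : R) : expi (x + y) = expi x * expi y.
Proof.
rewrite /expi cosD sinD; apply/eqP; rewrite eq_complex /=.
by rewrite [sin x * cos y + _]addrC !eqxx.
Qed.

Lemma expiN_conj (x : R) : expi (- x) = (expi x)^*.
Proof. by rewrite /expi cosN sinN. Qed.

Lemma normc_expi (x : R) : normc (expi x) = 1.
Proof. by rewrite /= cos2Dsin2 sqrtr1. Qed.

Lemma expi_neq0 (x : R) : expi x != 0.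
Proof.
apply/eqP => h; have := normc_expi x; rewrite h normc0 => /eqP.
by rewrite eq_sym oner_eq0.
Qed.

Lemma expiN (x : R) : expi (- x) = (expi x)^-1.
Proof.
by apply: (mulfI (expi_neq0 x)); rewrite -expiD subrr expi0 divff ?expi_neq0.
Qed.

End ComplexNorm.

(** * Uniform approximation by trigonometric polynomials with prescribed frequencies *)

Section TrigApprox.
Import ComplexField.Normc.
Import numFieldNormedType.Exports.
Context (R : realType) (E : vectType R) (ip : {dot E for idfun}).
Implicit Types (A B C : E -> Prop) (f g : E -> R[i]).

Definition trig A f : Prop := exists l : seq (R[i] * E),
  (forall p, p \in l -> A p.2) /\
  forall x, f x = \sum_(p <- l) p.1 * expi (ip p.2 x).

(** Membership in the uniform closure of the trigonometric polynomials with frequencies in [A]. It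
    takes the place of a bound on the Fourier support, so that 1 / C can be handled through
    truncated geometric series. *)
Definition appr A f : Prop := forall e : R, 0 < e ->
  exists g, trig A g /\ forall x, normc (f x - g x) <= e.

Lemma trig_appr A f : trig A f -> appr A f.
Proof.
by move=> h e e0; exists f; split=> // x; rewrite subrr normc0 ltW.
Qed.

Lemma trig_bounded A f : trig A f -> exists2 M : R, 0 <= M &
  forall x, normc (f x) <= M.
Proof.
move=> [l [_ h]]; exists (\sum_(p <- l) normc p.1).
  by rewrite sumr_ge0 // => p _; apply: normc_ge0.
move=> x; rewrite h; apply: le_trans (normc_sum _ _ _) _.
by apply: ler_sum => p _; rewrite normcM normc_expi mulr1.
Qed.

Lemma appr_bounded A f : appr A f -> exists2 M : R, 0 <= M &
  forall x, normc (f x) <= M.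
Proof.
move=> /(_ 1 ltr01)[g [/trig_bounded[M M0 hM] hg]]; exists (1 + M).
  by rewrite addr_ge0.
move=> x; rewrite -[f x](subrK (g x)).
exact: le_trans (normc_triangle _ _) (lerD (hg x) (hM x)).
Qed.

Lemma appr_sub A B f : (forall x, A x -> B x) -> appr A f -> appr B f.
Proof.
move=> AB h e e0; have [g [[l [hl hg]] hfg]] := h e e0; exists g; split=> //.
by exists l; split=> // p /hl/AB.
Qed.

Lemma appr_ext A f g : (forall x, f x = g x) -> appr A f -> appr A g.
Proof. by move=> /funext ->. Qed.

Lemma appr_expi A k : A k -> appr A (fun x => expi (ip k x)).
Proof.
move=> Ak; apply: trig_appr; exists [:: (1, k)]; split.
  by move=> p; rewrite inE => /eqP ->.
by move=> x; rewrite big_seq1 mul1r.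
Qed.

Lemma appr_cst A c : A 0 -> appr A (fun=> c).
Proof.
move=> A0; apply: trig_appr; exists [:: (c, 0)]; split.
  by move=> p; rewrite inE => /eqP ->.
by move=> x; rewrite big_seq1 ip0l expi0 mulr1.
Qed.

Lemma trigD A f g : trig A f -> trig A g -> trig A (fun x => f x + g x).
Proof.
move=> [l [hl hf]] [m [hm hg]]; exists (l ++ m); split.
  by move=> p; rewrite mem_cat => /orP[/hl|/hm].
by move=> x; rewrite big_cat /= hf hg.
Qed.

Lemma trigM A B C f g : (forall a b, A a -> B b -> C (a + b)) ->
  trig A f -> trig B g -> trig C (fun x => f x * g x).
Proof.
move=> ABC [l [hl hf]] [m [hm hg]].
exists [seq (p.1 * q.1, p.2 + q.2) | p <- l, q <- m]; split.
  by move=> _ /allpairsP[[p q] /= [/hl h1 /hm h2 ->]]; apply: ABC.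
move=> x; rewrite hf hg big_allpairs_dep mulr_suml; apply: eq_bigr => p _.
rewrite mulr_sumr; apply: eq_bigr => q _ /=.
by rewrite ipDl expiD mulrACA.
Qed.

Lemma apprD A f g : appr A f -> appr A g -> appr A (fun x => f x + g x).
Proof.
move=> hf hg e e0; have e2 : 0 < e / 2 by rewrite divr_gt0.
have [f' [tf af]] := hf _ e2; have [g' [tg ag]] := hg _ e2.
exists (fun x => f' x + g' x); split; first exact: trigD.
move=> x; rewrite opprD addrACA [leRHS]splitr.
exact: le_trans (normc_triangle _ _) (lerD (af x) (ag x)).
Qed.

(** By f g - f' g' = f (g - g') + (f - f') g', first g' is chosen from a bound on f, then f' from a
    bound on g'. The 1 in [M + 1] and [N + 1] prevents a division by 0. *)
Lemma apprM A B C f g : (forall a b, A a -> B b -> C (a + b)) ->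
  appr A f -> appr B g -> appr C (fun x => f x * g x).
Proof.
move=> ABC hf hg e e0.
have [M M0 hM] := appr_bounded hf.
have [g' [tg ag]] : exists g', trig B g' /\
    forall x, normc (g x - g' x) <= e / 2 / (M + 1).
  by apply: hg; rewrite !divr_gt0 // ltr_wpDl.
have [N N0 hN] := trig_bounded tg.
have [f' [tf af]] : exists f', trig A f' /\
    forall x, normc (f x - f' x) <= e / 2 / (N + 1).
  by apply: hf; rewrite !divr_gt0 // ltr_wpDl.
exists (fun x => f' x * g' x); split; first exact: trigM tf tg.
move=> x.
have -> : f x * g x - f' x * g' x = f x * (g x - g' x) + (f x - f' x) * g' x.
  by rewrite mulrBr mulrBl addrA subrK.
apply: le_trans (normc_triangle _ _) _; rewrite !normcM [leRHS]splitr.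
have h (a b K : R) : 0 <= a -> a <= K -> 0 <= K -> b <= e / 2 / (K + 1) ->
    a * b <= e / 2.
  move=> a0 aK K0 hb; apply: le_trans (ler_wpM2l a0 hb) _.
  have K1 : 0 < K + 1 by rewrite ltr_wpDl.
  rewrite mulrA ler_pdivrMr // mulrC ler_wpM2l ?divr_ge0 ?ltW //.
  by rewrite (le_lt_trans aK) // ltrDl.
apply: lerD; first exact: (h _ _ M (normc_ge0 _)).
by rewrite mulrC; apply: (h _ _ N (normc_ge0 _)).
Qed.

Lemma appr_sum A (I : Type) (r : seq I) (F : I -> E -> R[i]) : A 0 ->
  (forall i, appr A (F i)) -> appr A (fun x => \sum_(i <- r) F i x).
Proof.
move=> A0 hF; elim: r => [|i r IH].
  by apply: (@appr_ext _ (fun=> 0)) (appr_cst 0 A0) => x; rewrite big_nil.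
apply: (@appr_ext _ (fun x => F i x + \sum_(i <- r) F i x)) (apprD (hF i) IH).
by move=> x; rewrite big_cons.
Qed.

Lemma appr_prod A (I : Type) (r : seq I) (F : I -> E -> R[i]) : A 0 ->
  (forall a b, A a -> A b -> A (a + b)) ->
  (forall i, appr A (F i)) -> appr A (fun x => \prod_(i <- r) F i x).
Proof.
move=> A0 AD hF; elim: r => [|i r IH].
  by apply: (@appr_ext _ (fun=> 1)) (appr_cst 1 A0) => x; rewrite big_nil.
apply: (@appr_ext _ (fun x => F i x * \prod_(i <- r) F i x))
  (apprM AD (hF i) IH).
by move=> x; rewrite big_cons.
Qed.

Lemma appr_conj A B f : (forall a, A a -> B (- a)) -> appr A f ->
  appr B (fun x => (f x)^*).
Proof.
move=> AB h e e0; have [g [[l [hl hg]] hfg]] := h e e0.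
exists (fun x => (g x)^*); split; last first.
  by move=> x; rewrite -rmorphB normc_conj.
exists [seq (p.1^*, - p.2) | p <- l]; split.
  by move=> _ /mapP[p /hl hp ->]; apply: AB.
move=> x; rewrite hg rmorph_sum big_map; apply: eq_bigr => p _ /=.
by rewrite rmorphM ipNl expiN_conj.
Qed.

Lemma normc_texpi_lt1 (t y : R) : -1 < t < 1 -> normc (t%:C * expi y) < 1.
Proof. by move=> h; rewrite normcM normc_expi mulr1 normc_real ltr_norml. Qed.

Lemma onePtexpi_neq0 (t y : R) : -1 < t < 1 -> 1 + t%:C * expi y != 0.
Proof.
move=> h; apply/eqP => h0; have := normc_texpi_lt1 y h.
rewrite -(addKr 1 (t%:C * _)) h0 addr0 normc_opp normc1.
by rewrite ltxx.
Qed.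

(** With z = - t e^{ia}, the remainder z^N / (1 - z) of the geometric series is at most |t|^N / (1 -
    |t|), uniformly in [x]. *)
Lemma appr_geometric A a (t : R) : -1 < t < 1 -> (forall k, A (a *+ k)) ->
  appr A (fun x => (1 + t%:C * expi (ip a x))^-1).
Proof.
move=> ht hA e e0.
have t1 : `|t| < 1 by rewrite ltr_norml.
have d0 : 0 < 1 - `|t| by rewrite subr_gt0.
have [N hN] : exists N, `|t| ^+ N <= e * (1 - `|t|).
  have := @cvg_expr R t t1.
  move=> /cvgrPdist_le /(_ (e * (1 - `|t|)) (mulr_gt0 e0 d0)) [N _ hN].
  by exists N; have := hN N (leqnn N); rewrite sub0r normrN normrX.
pose z x := - (t%:C * expi (ip a x)).
exists (fun x => \sum_(k < N) z x ^+ k); split.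
  exists [seq ((- t%:C) ^+ val k, a *+ val k) | k <- index_enum 'I_N]; split.
    by move=> _ /mapP[k _ ->] /=.
  move=> x; rewrite big_map; apply: eq_bigr => k _ /=.
  rewrite /z -mulNr exprMn; congr (_ * _); elim: (k : nat) => [|m IH].
    by rewrite mulr0n ip0l expi0.
  by rewrite mulrS ipDl expiD exprS IH.
move=> x; have n0 := onePtexpi_neq0 (ip a x) ht.
have -> : (1 + t%:C * expi (ip a x))^-1 - \sum_(k < N) z x ^+ k =
    z x ^+ N / (1 + t%:C * expi (ip a x)).
  apply: (mulIf n0); rewrite mulrBl mulVf // divfK //.
  rewrite [_ * (1 + _)]mulrC (_ : 1 + t%:C * expi (ip a x) = 1 - z x);
    last by rewrite /z opprK.
  by rewrite -[1 - z x]opprB mulNr -subrX1 opprK addrC subrK.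
rewrite normcM normcV normcX /z normc_opp normcM normc_expi mulr1 normc_real.
have hd : 1 - `|t| <= normc (1 + t%:C * expi (ip a x)).
  rewrite lerBlDr -(@normc1 R) -{1}(addrK (t%:C * expi (ip a x)) 1).
  apply: le_trans (normc_triangleB _ _) _.
  by rewrite [X in _ + X]normcM normc_expi mulr1 normc_real.
rewrite ler_pdivrMr ?(lt_le_trans d0) //.
by apply: le_trans hN _; rewrite ler_wpM2l // ltW.
Qed.

End TrigApprox.

(** * Complex powers of a real number of either sign *)

Section ComplexPower.
Import ComplexField.Normc.
Context (R : realType).
Implicit Types (t s r : R).

Let theta t : R := if t < 0 then pi else 0.

(* [cpow t s] is a branch of [t ^ (- s)]. *)
Definition cpow t s : R[i] :=
  (expR (- (s * ln `|t|)))%:C * expi (s * theta t).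

Lemma cpowD t s r : cpow t (s + r) = cpow t s * cpow t r.
Proof.
rewrite /cpow !mulrDl opprD expRD rmorphM expiD; exact: mulrACA.
Qed.

Lemma cpow0 t : cpow t 0 = 1.
Proof. by rewrite /cpow !mul0r oppr0 expR0 expi0 mulr1. Qed.

Lemma cpowN1 t : t != 0 -> cpow t (-1) = t%:C.
Proof.
move=> t0; rewrite /cpow !mulN1r opprK lnK ?posrE ?normr_gt0 // /theta.
case: ltP => ht; last by rewrite oppr0 expi0 mulr1 ger0_norm.
have -> : expi (- pi) = -1 :> R[i].
  rewrite /expi cosN sinN cospi sinpi oppr0; apply/eqP.
  by rewrite eq_complex /= oppr0 !eqxx.
by rewrite ltr0_norm // rmorphN mulrN1 opprK.
Qed.

Lemma cpowNn t m : t != 0 -> cpow t (- m%:R) = (t ^+ m)%:C.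
Proof.
move=> t0; elim: m => [|m IH]; first by rewrite oppr0 cpow0.
by rewrite -natr1 opprD cpowD IH cpowN1 // exprSr rmorphM.
Qed.

Lemma normc_cpow t s : normc (cpow t s) = expR (- (s * ln `|t|)).
Proof.
by rewrite normcM normc_expi mulr1 normc_real ger0_norm // expR_ge0.
Qed.

End ComplexPower.

Lemma ReD (R : realType) (z1 z2 : R[i]) :
  complex.Re (z1 + z2) = complex.Re z1 + complex.Re z2.
Proof. by case: z1; case: z2. Qed.

Lemma ImD (R : realType) (z1 z2 : R[i]) :
  complex.Im (z1 + z2) = complex.Im z1 + complex.Im z2.
Proof. by case: z1; case: z2. Qed.

Lemma ReM (R : realType) (z1 z2 : R[i]) : complex.Re (z1 * z2) =
  complex.Re z1 * complex.Re z2 - complex.Im z1 * complex.Im z2.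
Proof. by case: z1; case: z2. Qed.

Lemma ImM (R : realType) (z1 z2 : R[i]) : complex.Im (z1 * z2) =
  complex.Re z1 * complex.Im z2 + complex.Im z1 * complex.Re z2.
Proof. by case: z1; case: z2. Qed.

(** * The constant term as an integral over the torus *)

Section ConstantTerm.
Import ComplexField.Normc.
Import numFieldNormedType.Exports.
Local Open Scope classical_set_scope.
Context (R : realType) (E : vectType R) (ip : {dot E for idfun}).
Context (n : nat) (b : n.-tuple E).
Implicit Types (A B C : E -> Prop) (f g : E -> R[i]).

Local Notation cubeT := (n.-tuple (measurableTypeR R)).
Local Notation par u := (torus_param b u).

Definition constant_term f : R[i] := cube_integral (f \o torus_param b).
Local Notation CT := constant_term.

(** A sufficient condition for integrability, the measure of the cube being finite; it is stable
    under uniform limits, as [appr_good] requires. *)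
Definition good f : Prop :=
  [/\ measurable_fun [set: cubeT] (fun u => complex.Re (f (par u))),
      measurable_fun [set: cubeT] (fun u => complex.Im (f (par u))) &
      exists2 M : R, 0 <= M & forall x, normc (f x) <= M].

Lemma ip_param k u : ip k (par u) =
  \sum_(i < n) 2 * pi * tnth u i * ip k (tnth b i).
Proof.
by rewrite /torus_param ip_sumr; apply: eq_bigr => i _; rewrite ipZr.
Qed.

Lemma measurable_ip_param k :
  measurable_fun [set: cubeT] (fun u => ip k (par u)).
Proof.
under eq_fun do rewrite ip_param.
apply: measurable_sum => i.
apply: measurable_funM; last exact: measurable_cst.
apply: measurable_funM; first exact: measurable_cst.
exact: measurable_tnth.
Qed.

Lemma measurable_ReIm_expi c k :
  measurable_fun [set: cubeT] (fun u => complex.Re (c * expi (ip k (par u)))) /\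
  measurable_fun [set: cubeT] (fun u => complex.Im (c * expi (ip k (par u)))).
Proof.
have mc : measurable_fun [set: R] (@cos R).
  by apply: continuous_measurable_fun; exact: continuous_cos.
have ms : measurable_fun [set: R] (@sin R).
  by apply: continuous_measurable_fun; exact: continuous_sin.
have mck := measurableT_comp mc (measurable_ip_param k).
have msk := measurableT_comp ms (measurable_ip_param k).
split.
  under eq_fun do rewrite ReM /=.
  by apply: measurable_funB; apply: measurable_funM.
under eq_fun do rewrite ImM /=.
by apply: measurable_funD; apply: measurable_funM.
Qed.

Lemma trig_good A f : trig ip A f -> good f.
Proof.
move=> tf; have bf := trig_bounded tf; case: tf => l [_ hf].
suff [h1 h2] : measurable_fun [set: cubeT] (fun u => complex.Re (f (par u))) /\
  measurable_fun [set: cubeT] (fun u => complex.Im (f (par u))) by split.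
have -> : f = fun x => \sum_(p <- l) p.1 * expi (ip p.2 x) by apply/funext.
elim: (l) => [|p s [IH1 IH2]].
  by split; under eq_fun do rewrite big_nil; exact: measurable_cst.
have [h1 h2] := measurable_ReIm_expi p.1 p.2.
split; under eq_fun do rewrite big_cons.
  by under eq_fun do rewrite ReD; apply: measurable_funD.
by under eq_fun do rewrite ImD; apply: measurable_funD.
Qed.

(** Measurability passes to the limit of the approximations of precision 1 / (m + 1). *)
Lemma appr_good A f : appr ip A f -> good f.
Proof.
move=> hf; split; last exact: appr_bounded hf.
all: have e0 m : 0 < (m.+1%:R^-1 : R) by rewrite invr_gt0 ltr0n.
all: have [g hg] := choice (fun m => hf _ (e0 m)).
all: have inv0 : (m.+1%:R^-1 : R) @[m --> \oo] --> (0 : R)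
  by exact: cvg_harmonic.
  apply: (@measurable_fun_cvg _ _ _ _ (fun m u => complex.Re (g m (par u)))).
    by move=> m; have [/trig_good[]] := hg m.
  move=> u _; apply/cvgrPdist_le => e e1.
  move/cvgrPdist_le: inv0 => /(_ e e1); apply: filterS => m.
  rewrite sub0r normrN (ger0_norm (ltW (e0 m))) => he.
  have [_ /(_ (par u)) h] := hg m; apply: le_trans he; apply: le_trans h.
  apply: le_trans (Re_le_normc _).
  by case: (f _) (g m _) => [? ?] [? ?].
apply: (@measurable_fun_cvg _ _ _ _ (fun m u => complex.Im (g m (par u)))).
  by move=> m; have [/trig_good[]] := hg m.
move=> u _; apply/cvgrPdist_le => e e1.
move/cvgrPdist_le: inv0 => /(_ e e1); apply: filterS => m.
rewrite sub0r normrN (ger0_norm (ltW (e0 m))) => he.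
have [_ /(_ (par u)) h] := hg m; apply: le_trans he; apply: le_trans h.
apply: le_trans (Im_le_normc _).
by case: (f _) (g m _) => [? ?] [? ?].
Qed.

Lemma good_integrable f : good f ->
  (cube R n).-integrable [set: _] (EFin \o (fun u => complex.Re (f (par u)))) /\
  (cube R n).-integrable [set: _] (EFin \o (fun u => complex.Im (f (par u)))).
Proof.
move=> [h1 h2 [M M0 hM]]; split; apply: measurable_bounded_integrable => //.
- by rewrite [X in (X < _)%E]probability_setT ltry.
- exists M; split=> [|N MN]; first exact: num_real.
  by move=> u _; apply: le_trans (Re_le_normc _) (le_trans (hM _) (ltW MN)).
- by rewrite [X in (X < _)%E]probability_setT ltry.
- exists M; split=> [|N MN]; first exact: num_real.
  by move=> u _; apply: le_trans (Im_le_normc _) (le_trans (hM _) (ltW MN)).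
Qed.

Lemma CTD f g : good f -> good g -> CT (fun x => f x + g x) = CT f + CT g.
Proof.
move=> /good_integrable[f1 f2] /good_integrable[g1 g2].
rewrite /CT /cube_integral.
have -> (x y z t : R) : (x +i* y) + (z +i* t) = (x + z) +i* (y + t) by [].
rewrite -!RintegralD //; congr (_ +i* _); apply: eq_Rintegral => u _ /=.
  exact: ReD.
exact: ImD.
Qed.

Lemma CTZ c f : good f -> CT (fun x => c * f x) = c * CT f.
Proof.
move=> /good_integrable[f1 f2]; case: c => c d.
rewrite /CT /cube_integral.
have -> (x y : R) : (c +i* d) * (x +i* y) =
  (c * x - d * y) +i* (c * y + d * x) by [].
have i1 k : (cube R n).-integrable [set: _]
    (EFin \o (fun u => k * complex.Re (f (par u)))).
  by apply: (eq_integrable _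
      (fun u => k%:E * (complex.Re (f (par u)))%:E)%E) => //;
    exact: integrableZl.
have i2 k : (cube R n).-integrable [set: _]
    (EFin \o (fun u => k * complex.Im (f (par u)))).
  by apply: (eq_integrable _
      (fun u => k%:E * (complex.Im (f (par u)))%:E)%E) => //;
    exact: integrableZl.
rewrite -!RintegralZl // -RintegralB // -RintegralD //.
by congr (_ +i* _); apply: eq_Rintegral => u _ /=; case: (f _).
Qed.

(** The crude factor 2 comes from bounding real and imaginary parts separately; it suffices for
    continuity. *)
Lemma CT_bound f (M : R) : good f -> (forall x, normc (f x) <= M) ->
  normc (CT f) <= M + M.
Proof.
move=> /good_integrable[f1 f2] hM; apply: le_trans (normc_le_ReIm _) _.
have h (g : cubeT -> R) : (cube R n).-integrable [set: _] (EFin \o g) ->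
    (forall u, `|g u| <= M) -> `|\int[cube R n]_u g u| <= M.
  move=> ig gM; apply: le_trans (le_normr_Rintegral _ ig) _ => //.
  have -> : M = \int[cube R n]_u (cst M u).
    rewrite Rintegral_cst // [X in fine X](_ : _ = 1%:E) ?mulr1 //.
    exact: probability_setT.
  apply: le_Rintegral => //.
    exact: (integrable_norm ig).
  exact: finite_measure_integrable_cst.
rewrite /CT /cube_integral /= lerD //; apply: h => // u.
  exact: le_trans (Re_le_normc _) (hM _).
exact: le_trans (Im_le_normc _) (hM _).
Qed.

End ConstantTerm.

(** * Reading constant terms off the frequencies *)

Section ConstantTermTheory.
Import ComplexField.Normc.
Context (R : realType) (E : vectType R) (ip : {dot E for idfun}).
Context (n : nat) (b : n.-tuple E) (b_basis : basis_of fullv b).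
Context (L : E -> Prop).
Context (L_int : forall k, L k -> forall i, ip k (tnth b i) \is a Num.int).
Implicit Types (A B C : E -> Prop) (f g : E -> R[i]).

Local Notation CT := (constant_term b).
Local Notation good := (good b).

(** The pairings of [k] with the basis are integers, and [cube_cos] tests whether they all vanish;
    since the basis spans E, this happens only for k = 0. The imaginary part is the case of shift -
    pi / 2, whose value at k = 0 is also 0. *)
Lemma CT_expi k : L k -> CT (fun x => expi (ip k x)) = (k == 0)%:R.
Proof.
move=> /L_int hk.
have [m hm] : exists m : 'I_n -> int, forall i, (m i)%:~R = ip k (tnth b i).
  have [m hm] := choice (fun i => intrP (hk i)).
  by exists m => i; rewrite hm.
have kE : (k == 0) = [forall i, m i == 0].
  apply/eqP/forallP => [k0 i|h].
    by rewrite -(intr_eq0 R) hm k0 ip0l.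
  have kb i : ip k (tnth b i) = 0 by rewrite -hm (eqP (h i)).
  apply: (@ip_nondeg _ _ ip) => x.
  have : x \in <<b>>%VS by rewrite (span_basis b_basis) memvf.
  move=> /(coord_span (X := b)) ->; rewrite ip_sumr big1 // => i _.
  by rewrite ipZr -tnth_nth kb mulr0.
have ph (u : n.-tuple (measurableTypeR R)) :
    ip k (torus_param b u) = phase m u.
  by rewrite ip_param; apply: eq_bigr => i _; rewrite hm.
rewrite /constant_term /cube_integral /=.
have hc c : \int[cube R n]_u cos (c + phase m u) = if k == 0 then cos c else 0.
  by rewrite /Rintegral cube_cos kE.
under eq_Rintegral => u _ do rewrite ph -[phase m u]add0r.
under [X in _ +i* X]eq_Rintegral => u _ do rewrite ph -cosBpihalf addrC.
rewrite !hc; case: (k == 0); last by [].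
by rewrite cos0 cosN cos_pihalf.
Qed.

Lemma CT_cst0 : CT (fun=> 0) = 0.
Proof.
rewrite /constant_term /cube_integral /Rintegral /=.
by rewrite integral0_eq.
Qed.

Lemma CT_ext f g : (forall x, f x = g x) -> CT f = CT g.
Proof. by move=> /funext ->. Qed.

Lemma CT_sum (I : Type) (r : seq I) (F : I -> E -> R[i]) A :
  (forall i, appr ip A (F i)) ->
  CT (fun x => \sum_(i <- r) F i x) = \sum_(i <- r) CT (F i).
Proof.
move=> hF; have hg i : good (F i) by apply: appr_good (hF i).
suff [h _] : CT (fun x => \sum_(i <- r) F i x) = \sum_(i <- r) CT (F i) /\
  good (fun x => \sum_(i <- r) F i x) by [].
elim: r => [|i r [IH1 IH2]].
  rewrite big_nil; split.
    rewrite -[RHS]CT_cst0.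
    by apply: CT_ext => x; rewrite big_nil.
  apply: (@trig_good _ _ ip _ _ (fun=> True)); exists [::]; split=> // x.
  by rewrite !big_nil.
have -> : (fun x => \sum_(j <- i :: r) F j x) =
    (fun x => F i x + \sum_(j <- r) F j x).
  by apply/funext => x; rewrite big_cons.
rewrite CTD // IH1 big_cons; split=> //.
have [[h1 h2 [M M0 hM]] [h3 h4 [N N0 hN]]] := (hg i, IH2); split.
- by under eq_fun do rewrite ReD; apply: measurable_funD.
- by under eq_fun do rewrite ImD; apply: measurable_funD.
- exists (M + N); first exact: addr_ge0.
  by move=> x; apply: le_trans (normc_triangle _ _) (lerD (hM x) (hN x)).
Qed.

Lemma CT_trig (l : seq (R[i] * E)) : (forall p, p \in l -> L p.2) ->
  CT (fun x => \sum_(p <- l) p.1 * expi (ip p.2 x)) =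
  \sum_(p <- l) p.1 * (p.2 == 0)%:R.
Proof.
move=> hl; have ap p : appr ip (fun=> True) (fun x => p.1 * expi (ip p.2 x)).
  apply: (apprM (A := fun=> True) (B := fun=> True)) => //.
    exact: appr_cst.
  exact: appr_expi.
rewrite (CT_sum _ ap) big_seq [RHS]big_seq; apply: eq_bigr => p /hl hp.
have ae : appr ip (fun=> True) (fun x => expi (ip p.2 x)) by exact: appr_expi.
by rewrite CTZ ?CT_expi //; apply: appr_good ae.
Qed.

Lemma CTB f g A B : appr ip A f -> appr ip B g ->
  CT (fun x => f x - g x) = CT f - CT g.
Proof.
move=> hf hg; have gg := appr_good b hg.
have hng : appr ip B (fun x => (-1) * g x).
  apply: (apprM (A := fun z => z = 0)) hg => [z1 z2 ->|];
    first by rewrite add0r.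
  exact: appr_cst.
rewrite (@CT_ext _ (fun x => f x + (-1) * g x)) => [|x]; last by rewrite mulN1r.
rewrite CTD ?CTZ ?mulN1r //; [exact: appr_good hf|exact: appr_good hng].
Qed.

(* Uniform approximation by trigonometric polynomials reduces these facts to
   exponentials. *)
Lemma CT_small A f : appr ip A f -> (forall k, A k -> L k) -> forall e, 0 < e ->
  exists l : seq (R[i] * E), [/\ forall p, p \in l -> A p.2,
    forall x, normc (f x - \sum_(p <- l) p.1 * expi (ip p.2 x)) <= e &
    normc (CT f - \sum_(p <- l) p.1 * (p.2 == 0)%:R) <= e + e].
Proof.
move=> hf AL e e0; have [g [[l [hl hg]] hfg]] := hf e e0.
exists l; split=> // [x|]; first by rewrite -hg.
rewrite -CT_trig; last by move=> p /hl/AL.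
rewrite -(CT_ext hg).
have ag : appr ip A g by apply: trig_appr; exists l.
rewrite -(CTB hf ag); apply: CT_bound => //.
have ang : appr ip A (fun x => (-1) * g x).
  apply: (apprM (A := fun z => z = 0)) ag => [z1 z2 ->|];
    first by rewrite add0r.
  exact: appr_cst.
apply: (@appr_good _ _ ip _ _ A); apply: appr_ext (apprD hf ang) => x.
by rewrite mulN1r.
Qed.

Lemma CT_eq0 A f : appr ip A f -> (forall k, A k -> L k /\ k <> 0) -> CT f = 0.
Proof.
move=> hf AL; apply: normc_small_eq0 => e e0.
have e2 : 0 < e / 2 by rewrite divr_gt0.
have [l [hl _ hc]] := CT_small hf (fun k Ak => (AL k Ak).1) e2.
move: hc; rewrite -splitr big_seq big1 ?subr0 // => p /hl/AL[_ /eqP/negbTE ->].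
by rewrite mulr0.
Qed.

(** This replaces a change of variables: composing with [w] turns the frequency [k] into [w' k], for
    the adjoint [w'], which keeps the frequencies in the lattice and neither creates nor destroys
    the frequency 0. *)
Lemma CT_comp A f (w w' : E -> E) : appr ip A f -> (forall k, A k -> L k) ->
  (forall k x, ip k (w x) = ip (w' k) x) -> (forall k, A k -> L (w' k)) ->
  (forall k, (w' k == 0) = (k == 0)) ->
  CT (fun x => f (w x)) = CT f.
Proof.
move=> hf AL hw AL' w'0; apply/eqP; rewrite -subr_eq0; apply/eqP.
apply: normc_small_eq0 => e e0.
have e4 : 0 < e / 2 / 2 by rewrite !divr_gt0.
have [l [hl hfl hc]] := CT_small hf AL e4.
pose l' := [seq (p.1, w' p.2) | p <- l].
have hl' p : p \in l' -> L p.2 by move=> /mapP[q /hl/AL' hq ->].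
have al' : trig ip L (fun x => \sum_(p <- l') p.1 * expi (ip p.2 x)).
  by exists l'; split=> // p /hl'.
have aw : appr ip L (fun x => f (w x)).
  move=> d d0; have [g [[m [hm hg]] hfg]] := hf d d0.
  exists (fun x => g (w x)); split; last by move=> x; apply: hfg.
  exists [seq (p.1, w' p.2) | p <- m]; split.
    by move=> _ /mapP[q /hm/AL' hq ->].
  by move=> x; rewrite big_map hg; apply: eq_bigr => p _; rewrite hw.
have hc' : normc (CT (fun x => f (w x)) - \sum_(p <- l) p.1 * (p.2 == 0)%:R) <=
    e / 2 / 2 + e / 2 / 2.
  have -> : \sum_(p <- l) p.1 * (p.2 == 0)%:R =
      \sum_(p <- l') p.1 * (p.2 == 0)%:R.
    by rewrite big_map; apply: eq_bigr => p _; rewrite w'0.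
  rewrite -CT_trig // -(CTB aw (trig_appr al')).
  apply: CT_bound => [|x].
    have al'' : trig ip L (fun x =>
      (-1) * \sum_(p <- l') p.1 * expi (ip p.2 x)).
      apply: (trigM (A := fun z => z = 0) _ _ al') => [z1 z2 ->|].
        by rewrite add0r.
      exists [:: (-1, 0)]; split=> [p|x]; first by rewrite inE => /eqP ->.
      by rewrite big_seq1 ip0l expi0 mulr1.
    apply: (@appr_good _ _ ip _ _ L);
      apply: appr_ext (apprD aw (trig_appr al'')).
    by move=> x; rewrite mulN1r.
  rewrite big_map /=; under eq_bigr do rewrite -hw.
  exact: hfl.
rewrite -splitr in hc hc'.
rewrite -[CT (fun x => f (w x))](subrK (\sum_(p <- l) p.1 * (p.2 == 0)%:R)).
rewrite -addrA -[X in _ + X]opprB [leRHS]splitr.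
exact: le_trans (normc_triangleB _ _) (lerD hc' hc).
Qed.

End ConstantTermTheory.

(** * The Jacobian, and the inner product as a constant term *)

Section Gram.
Context (R : realType) (E : vectType R) (ip : {dot E for idfun}).

(* The segment from the identity to the Gram matrix stays inside the positive
   definite matrices, so the determinant cannot change sign along it. *)
Lemma gram_det_gt0 n (b : 'I_n -> E) :
  (forall k : 'I_n -> R, \sum_i k i *: b i = 0 -> forall i, k i = 0) ->
  0 < \det (\matrix_(i < n, j < n) ip (b i) (b j)).
Proof.
move=> free_b; set G := \matrix_(i, j) _.
(* A matrix with polynomial entries, so that its determinant along the segment is a polynomial in
   [s], to which the intermediate value theorem applies. *)
pose P : 'M[{poly R}]_n := \matrix_(i, j)
  ((1 - 'X) * ((i == j)%:R)%:P + 'X * (G i j)%:P).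
have PE s : (\det P).[s] = \det ((1 - s)%:M + s *: G).
  rewrite -[LHS]/(horner_eval s (\det P)) -det_map_mx; congr (\det _).
  apply/matrixP => i j; rewrite !mxE /= /horner_eval !hornerE.
  by case: (i == j); rewrite ?mulr1 ?mulr0 ?mulr1n ?mulr0n.
(* A kernel vector u gives (1 - s) |u|^2 + s |sum u_i b_i|^2 = 0, where both terms are nonnegative;
   for s = 1 freeness of the [b i] takes over. *)
have nz s : 0 <= s -> s <= 1 -> \det ((1 - s)%:M + s *: G) != 0.
  move=> s0 s1; apply/det0P => -[u u0 uG].
  have h : (1 - s) * \sum_i u 0 i ^+ 2 +
      s * ip (\sum_i u 0 i *: b i) (\sum_i u 0 i *: b i) = 0.
    have hu : (u *m ((1 - s)%:M + s *: G) *m u^T) 0 0 = 0.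
      by rewrite uG mul0mx mxE.
    rewrite -[RHS]hu mulmxDr mulmxDl mxE; congr (_ + _).
      rewrite mul_mx_scalar -scalemxAl mxE; congr (_ * _).
      by rewrite mxE; apply: eq_bigr => i _; rewrite mxE expr2.
    rewrite -scalemxAr -scalemxAl mxE; congr (_ * _).
    rewrite ip_sumr mxE; apply: eq_bigr => j _.
    rewrite ipZr !mxE mulrC ip_suml; congr (_ * _).
    by apply: eq_bigr => i _; rewrite ipZl !mxE.
  have q0 : 0 <= \sum_i u 0 i ^+ 2.
    by rewrite sumr_ge0 // => i _; rewrite sqr_ge0.
  case/eqP: u0; apply/rowP => i; rewrite mxE.
  have [s_1|s_1] := eqVneq s 1.
    move: h; rewrite s_1 subrr mul0r add0r mul1r => /eqP; rewrite ip_eq0.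
    by move/eqP/free_b.
  have ds : 0 < 1 - s by rewrite subr_gt0 lt_neqAle s_1.
  have hz : \sum_i u 0 i ^+ 2 = 0.
    apply/le_anti; rewrite q0 andbT -(pmulr_rle0 _ ds).
    move/eqP: h; rewrite addr_eq0 => /eqP ->.
    by rewrite oppr_le0 mulr_ge0 // ip_ge0.
  move: hz => /eqP; rewrite psumr_eq0 => [/allP/(_ i)|j _]; last exact: sqr_ge0.
  by rewrite mem_index_enum => /(_ isT); rewrite sqrf_eq0 => /eqP.
rewrite ltNge; apply/negP => neg.
have h0 : (\det P).[0] = 1 by rewrite PE subr0 scale0r addr0 det1.
have h1 : (\det P).[1] = \det G by rewrite PE subrr scale1r raddf0 add0r.
have [||s /andP[s0 s1] /rootP rs] := @poly_ivt R (- \det P) 0 1;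
  first exact: ler01.
  by rewrite !hornerE h0 h1 oppr_le0 ler01 oppr_ge0.
move: rs; rewrite hornerN PE => /eqP; rewrite oppr_eq0.
by apply/negP/nz.
Qed.

Lemma torus_jacobian_neq0 n (b : n.-tuple E) : basis_of fullv b ->
  torus_jacobian ip b != 0.
Proof.
move=> /basis_free /freeP fb; rewrite /torus_jacobian sqrtr_eq0 -ltNge.
apply: (@gram_det_gt0 _ (fun i => (2 * pi) *: tnth b i)) => k hk i.
have c0 : (2 * pi : R) != 0 by rewrite mulf_neq0 ?pnatr_eq0 // gt_eqF // pi_gt0.
apply: (mulIf c0); rewrite mul0r.
apply: (fb (fun i => k i * (2 * pi))) => //; rewrite -[RHS]hk.
by apply: eq_bigr => j _; rewrite scalerA (tnth_nth 0).
Qed.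

(** The volume of the torus is the Jacobian times the integral of 1, so the nonzero Jacobian
    cancels. *)
Lemma innerE n (b : n.-tuple E) (roots pos : seq E) Ms Ml (ts : 'I_Ms -> R)
  (tl : 'I_Ml -> R) (f g : E -> R[i]) : basis_of fullv b ->
  inner ip roots pos b ts tl f g = (weyl_order ip roots)%:R^-1 *
  constant_term b (fun x => f x * (g x)^* * weight ip roots pos ts tl x).
Proof.
move=> bb; rewrite /inner /torus_vol /torus_integral.
have J0 : (torus_jacobian ip b)%:C != 0 :> R[i].
  by apply/eqP => /complexI/eqP; rewrite (negbTE (torus_jacobian_neq0 bb)).
have -> : cube_integral ((fun=> 1) \o torus_param b) = 1 :> R[i].
  have h1 : constant_term b (fun x => expi (ip 0 x)) = 1 :> R[i].
    rewrite (CT_expi bb (L := fun k => k = 0)) ?eqxx // => k -> i.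
    by rewrite ip0l.
  rewrite -[RHS]h1 /constant_term; congr cube_integral; apply/funext => u /=.
  by rewrite ip0l expi0.
rewrite mulr1 invfM -mulrA; congr (_ * _); rewrite mulrA mulVf // mul1r.
by [].
Qed.

End Gram.

(** * Root systems and Weyl groups *)

Section RootSystem.
Import ComplexField.Normc.
Context (R : realType) (E : vectType R) (ip : {dot E for idfun}).
Context (roots pos : seq E) (HR : root_system ip roots).
Context (v : E) (v_root : forall a, a \in roots -> ip v a != 0).
Context (posE : forall a, (a \in pos) = (a \in roots) && (0 < ip v a)).
Context (pos_uniq : uniq pos).
Implicit Types (x y a b d : E) (w : 'End(E)).

Local Notation rfl := (reflection ip).
Local Notation S d := (linfun (rfl d)).
Local Notation weyl := (weyl_group ip roots).
Local Notation rho := (half_sum pos).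

Lemma root_neq0 a : a \in roots -> a != 0.
Proof. by move=> h; apply: contraNneq (roots_neq0 HR) => <-. Qed.

Lemma root_opp a : a \in roots -> - a \in roots.
Proof.
by move=> h; rewrite -(reflection_id ip (root_neq0 h)) (roots_reflection HR).
Qed.

Lemma pos_root a : a \in pos -> a \in roots.
Proof. by rewrite posE => /andP[]. Qed.

Lemma pos_gt0 a : a \in pos -> 0 < ip v a.
Proof. by rewrite posE => /andP[]. Qed.

Lemma pos_neq0 a : a \in pos -> a != 0.
Proof. by move/pos_root/root_neq0. Qed.

Lemma pos_opp a : a \in roots -> (- a \in pos) = (a \notin pos).
Proof.
move=> ar; rewrite !posE root_opp // ar /= ipNr oppr_gt0 -leNgt.
by rewrite le_eqVlt (negbTE (v_root ar)).
Qed.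

(** The positive one of a root and its opposite; through it a Weyl group element acts on the
    positive roots by a permutation. *)
Definition pabs x := if x \in pos then x else - x.

Lemma pabs_pos a : a \in roots -> pabs a \in pos.
Proof.
by move=> ar; rewrite /pabs; case: ifPn => // h; rewrite pos_opp.
Qed.

Lemma pabsN a : a \in roots -> pabs (- a) = pabs a.
Proof.
by move=> ar; rewrite /pabs pos_opp //; case: (a \in pos); rewrite //= opprK.
Qed.

Lemma pos_subst_rem D d : uniq D -> d \in D -> cone (rem d D) d ->
  forall x, cone D x -> cone (rem d D) x.
Proof.
move=> uD dD hd x [c [c0 ->]]; rewrite (big_rem d) //=.
apply: cone_add; first exact: cone_scale.
by apply: cone_sum => a ha; apply/cone_scale/cone_mem => //; rewrite rem_uniq.
Qed.

(** Deleting a generator that lies in the cone of the others keeps the cone and shortens the list,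
    so the process stops. *)
Lemma min_generators : exists D : seq E,
  [/\ uniq D, {subset D <= pos}, (forall a, a \in pos -> cone D a) &
      forall d, d \in D -> ~ cone (rem d D) d].
Proof.
suff H n D : (size D < n)%N -> uniq D -> {subset D <= pos} ->
    (forall a, a \in pos -> cone D a) -> exists D : seq E,
  [/\ uniq D, {subset D <= pos}, (forall a, a \in pos -> cone D a) &
      forall d, d \in D -> ~ cone (rem d D) d].
  by apply: (H (size pos).+1 pos) => // a; apply: cone_mem.
elim: n D => // n IH D /ltnSE sD uD subD genD.
have [[d [dD hd]]|h] := EM (exists d, d \in D /\ cone (rem d D) d); last first.
  by exists D; split=> // d dD hd; apply: h; exists d.
apply: (IH (rem d D)).
- by rewrite size_rem // prednK //; case: (D) dD sD.
- by rewrite rem_uniq.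
- by move=> a /mem_rem/subD.
- by move=> a /genD; apply: pos_subst_rem.
Qed.

(* Minimality of a generating set of the cone spanned by the positive roots is
   exactly what makes the reflection in a generator permute the other positive
   roots: [rfl d a] negative would put [a] on the ray of [d]. *)
Lemma base_exists : exists D : seq E,
  [/\ {subset D <= pos}, (forall a, a \in pos -> cone D a) &
      forall d a, d \in D -> a \in pos -> a != d -> rfl d a \in pos].
Proof.
have [D [uD subD genD minD]] := min_generators.
exists D; split=> // d a dD ap ad; apply/negPn/negP => hn.
have dp := subD _ dD.
have ar := pos_root ap; have dr := pos_root dp.
have bp : - rfl d a \in pos by rewrite pos_opp // (roots_reflection HR).
have [c [c0 ha]] := genD _ ap; have [c' [c'0 hb]] := genD _ bp.
set k := ip a (coroot ip d).
have hk : k *: d = \sum_(x <- D) (c x + c' x) *: x.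
  under eq_bigr do rewrite scalerDl.
  by rewrite big_split /= -ha -hb /reflection opprB addrC subrK.
have hr : (k - (c d + c' d)) *: d = \sum_(x <- rem d D) (c x + c' x) *: x.
  rewrite scalerBl hk (big_rem d) //=.
  by rewrite addrAC subrr add0r.
(* A positive coefficient puts [d] in the cone of the other generators. Otherwise a nonnegative
   combination of positive roots pairs nonpositively with [v], so its coefficients vanish and [a] is
   a multiple of [d]. *)
have [k0|k0] := ltP 0 (k - (c d + c' d)).
  apply: (minD _ dD); exists (fun x => (k - (c d + c' d))^-1 * (c x + c' x)).
  split; first by move=> x; rewrite mulr_ge0 ?addr_ge0 // invr_ge0 ltW.
  under eq_bigr do rewrite -scalerA.
  by rewrite -scaler_sumr -hr scalerA mulVf ?scale1r // gt_eqF.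
have hz : \sum_(x <- rem d D) (c x + c' x) * ip v x = 0.
  apply/le_anti/andP; split; last first.
    rewrite big_seq sumr_ge0 // => x /mem_rem/subD/pos_gt0/ltW h.
    by rewrite mulr_ge0 // addr_ge0.
  rewrite [leLHS](_ : _ = (k - (c d + c' d)) * ip v d).
    by rewrite mulr_le0_ge0 // ltW // pos_gt0.
  by rewrite -ipZr hr ip_sumr; apply: eq_bigr => x _; rewrite ipZr.
have cz x : x \in rem d D -> c x = 0.
  move=> xD; move: hz; rewrite big_seq => /eqP; rewrite psumr_eq0; last first.
    by move=> y /mem_rem/subD/pos_gt0/ltW h; rewrite mulr_ge0 // addr_ge0.
  move=> /allP/(_ _ xD); rewrite xD /= mulf_eq0 orbC.
  rewrite gt_eqF ?pos_gt0 ?subD ?(mem_rem xD) //= => /eqP h.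
  by apply/le_anti; rewrite c0 andbT -h lerDl.
have had : a = c d *: d.
  rewrite ha (big_rem d) //= big_seq big1 ?addr0 // => x /cz ->.
  by rewrite scale0r.
have := roots_reduced HR dr (c := c d); rewrite -had => /(_ ar)[h|h].
  by move: ad; rewrite had h scale1r eqxx.
by move: ap; rewrite had h scaleN1r pos_opp // dp.
Qed.

(** * Simple roots and words in simple reflections *)

Context (D : seq E) (D_pos : {subset D <= pos}).
Context (D_gen : forall a, a \in pos -> cone D a).
Context (D_refl : forall d a, d \in D -> a \in pos -> a != d ->
  rfl d a \in pos).

Lemma D_neq0 d : d \in D -> d != 0. Proof. by move/D_pos/pos_neq0. Qed.
Lemma D_root d : d \in D -> d \in roots. Proof. by move/D_pos/pos_root. Qed.

Lemma cone_ge0 x a : (forall d, d \in D -> 0 <= ip x d) -> a \in pos ->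
  0 <= ip x a.
Proof.
move=> h /D_gen [c [c0 ->]]; rewrite ip_sumr big_seq sumr_ge0 // => d dD.
by rewrite ipZr mulr_ge0 // h.
Qed.

(** A vanishing sum of nonnegative terms has only zero terms. This reduces a positive root
    orthogonal to a dominant [x] to the simple roots orthogonal to [x]. *)
Lemma cone_simple x a : (forall d, d \in D -> 0 <= ip x d) -> a \in pos ->
  ip x a = 0 -> exists c : E -> R, [/\ forall d, 0 <= c d,
    a = \sum_(d <- D) c d *: d & forall d, d \in D -> ip x d != 0 -> c d = 0].
Proof.
move=> h /D_gen [c [c0 ha]] hx; exists c; split=> // d dD xd.
move: hx; rewrite ha ip_sumr big_seq => /eqP; rewrite psumr_eq0; last first.
  by move=> e eD; rewrite ipZr mulr_ge0 // h.
move=> /allP/(_ _ dD); rewrite dD /= ipZr mulf_eq0 (negbTE xd) orbF.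
by move/eqP.
Qed.

(** As <a, a> > 0, some simple [d] has <a, d> > 0. Reflecting in [d] then lowers <v, a>, hence the
    number of positive roots with a smaller value. *)
Lemma pos_ind (P : E -> Prop) : (forall d, d \in D -> P d) ->
  (forall a d, a \in pos -> d \in D -> a != d -> P (rfl d a) -> P a) ->
  forall a, a \in pos -> P a.
Proof.
move=> PD PS a; have [n] := ubnP (count (fun b => ip v b < ip v a) pos).
elim: n a => // n IH a /ltnSE hn ap.
have [/PD//|aD] := boolP (a \in D).
have [d dD ad] : exists2 d, d \in D & 0 < ip a d.
  apply/not_exists2P => hno.
  have : 0 < ip a a by rewrite ip_gt0 // pos_neq0.
  have [c [c0 {2}->]] := D_gen ap; apply/negP; rewrite -leNgt ip_sumr.
  rewrite big_seq sumr_le0 // => d dD; rewrite ipZr mulr_ge0_le0 // leNgt.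
  by apply/negP; have [] := hno d.
have ne : a != d by apply: contraNneq aD => ->.
have bp := D_refl dD ap ne.
apply: (PS a d) => //; apply: IH => //; apply: leq_trans hn.
have hlt : ip v (rfl d a) < ip v a.
  rewrite /reflection ipBr ipZr ltrBlDr ltrDl mulr_gt0 ?pos_gt0 ?D_pos //.
  by rewrite coroot_gt0 ?D_neq0.
apply: (@count_lt _ _ _ _ (rfl d a)) => //=; first by rewrite ltxx.
by move=> y; move/lt_trans; apply.
Qed.

Lemma lrflE d x : S d x = rfl d x. Proof. by rewrite lfunE. Qed.

Lemma weyl_ip w x y : weyl w -> ip (w x) (w y) = ip x y.
Proof.
elim=> [|a w' ar _ IH]; first by rewrite !id_lfunE.
by rewrite !comp_lfunE !lrflE reflection_isom // root_neq0.
Qed.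

Lemma weyl_root w a : weyl w -> a \in roots -> w a \in roots.
Proof.
move=> ww ar; elim: ww => [|b w' br _ IH]; first by rewrite id_lfunE.
by rewrite comp_lfunE lrflE (roots_reflection HR).
Qed.

Lemma weyl_comp w1 w2 : weyl w1 -> weyl w2 -> weyl (w1 \o w2)%VF.
Proof.
move=> h1 h2; elim: h1 => [|a w ar _ IH]; first by rewrite comp_lfun1l.
by rewrite -comp_lfunA; apply: weyl_reflection.
Qed.

Lemma weyl_refl a : a \in roots -> weyl (S a).
Proof.
by move=> ar; rewrite -[S a]comp_lfun1r; apply/weyl_reflection/weyl_id.
Qed.

Lemma weyl_lker w : weyl w -> lker w == 0%VS.
Proof.
move=> ww; apply/lker0P => x y /eqP; rewrite -subr_eq0 -linearB /= => /eqP h.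
apply/eqP; rewrite -subr_eq0 -(ip_eq0 ip) -(weyl_ip _ _ ww) h.
by rewrite ip0r.
Qed.

Lemma weylK w : weyl w -> cancel w (w^-1)%VF.
Proof. by move=> ww; apply/lker0_lfunK/weyl_lker. Qed.

Lemma weylVK w : weyl w -> cancel (w^-1)%VF w.
Proof. by move=> ww; apply/lker0_lfunVK/weyl_lker. Qed.

Lemma weyl_inj w : weyl w -> injective w.
Proof. by move/weylK/can_inj. Qed.

Lemma reflSK a : a \in roots -> (S a \o S a = \1)%VF.
Proof.
move=> ar; apply/lfunP => x; rewrite comp_lfunE !lrflE id_lfunE.
by rewrite reflectionK // root_neq0.
Qed.

Lemma weyl_inv w : weyl w -> weyl (w^-1)%VF.
Proof.
move=> ww; suff [w' ww' h] : exists2 w', weyl w' & (w' \o w = \1)%VF.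
  rewrite [(w^-1)%VF](_ : _ = w') //; apply/lfunP => x.
  have := congr1 (fun f : 'End(E) => f ((w^-1)%VF x)) h.
  by rewrite comp_lfunE id_lfunE weylVK.
elim: ww => [|a w1 ar _ [w' ww' h]].
  by exists \1%VF; [apply: weyl_id|rewrite comp_lfun1l].
exists (w' \o S a)%VF; first by apply: weyl_comp => //; apply: weyl_refl.
by rewrite -comp_lfunA (comp_lfunA (S a)) reflSK // comp_lfun1l.
Qed.

Lemma weyl_ipl w x y : weyl w -> ip (w x) y = ip x ((w^-1)%VF y).
Proof. by move=> ww; rewrite -(weyl_ip x _ ww) weylVK. Qed.

Lemma weyl_invK w : weyl w -> (w^-1^-1)%VF = w.
Proof.
move=> ww; apply/lfunP => x; apply: (weyl_inj (weyl_inv ww)).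
by rewrite weylVK ?weylK //; apply: weyl_inv.
Qed.

Lemma weyl_equivariant w a x : weyl w ->
  w (rfl a x) = rfl (w a) (w x).
Proof.
move=> ww; rewrite /reflection linearB linearZ /=.
by rewrite !ip_corootE !(weyl_ip _ _ ww).
Qed.

Definition word (s : seq E) : 'End(E) :=
  foldr (fun d w => (S d \o w)%VF) \1%VF s.

Lemma word_cat s1 s2 : word (s1 ++ s2) = (word s1 \o word s2)%VF.
Proof.
by elim: s1 => [|d s IH] /=; rewrite ?comp_lfun1l // IH comp_lfunA.
Qed.

Lemma weyl_word s : {subset s <= D} -> weyl (word s).
Proof.
elim: s => [|d s IH] h /=; first exact: weyl_id.
apply: weyl_reflection; first by apply/D_root/h; rewrite mem_head.
by apply: IH => x xs; apply: h; rewrite inE xs orbT.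
Qed.

(** By [pos_ind] applied to s_a = s_d s_b s_d, where b = s_d a. *)
Lemma weyl_is_word w : weyl w -> exists2 s, {subset s <= D} & w = word s.
Proof.
have refl_word a : a \in pos -> exists2 s, {subset s <= D} & S a = word s.
  move=> ap; elim/pos_ind: a / ap => [d dD|a d ap dD _ [s sD hs]].
    exists [:: d]; last by rewrite /= comp_lfun1r.
    by move=> x; rewrite inE => /eqP ->.
  exists ([:: d] ++ s ++ [:: d]).
    by move=> x; rewrite !mem_cat !inE => /or3P[/eqP->//|/sD//|/eqP->//].
  have ww := weyl_refl (D_root dD).
  rewrite !word_cat -hs /= comp_lfun1r; apply/lfunP => x.
  rewrite !comp_lfunE (lrflE (rfl d a)) (weyl_equivariant _ _ ww) !lrflE.
  by rewrite !reflectionK // D_neq0.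
elim=> [|a w' ar _ [s sD ->]]; first by exists [::].
have [s' s'D hs'] : exists2 s, {subset s <= D} & S a = word s.
  have [/refl_word//|an] := boolP (a \in pos).
  have [|s' s'D hs] := refl_word (- a); first by rewrite pos_opp.
  exists s' => //; rewrite -hs; apply/lfunP => x; rewrite !lrflE.
  by rewrite /reflection !ip_corootE !ipNr !ipNl opprK scalerN -scaleNr mulrN
    mulNr opprK.
exists (s' ++ s); last by rewrite word_cat hs'.
by move=> x; rewrite mem_cat => /orP[/s'D|/sD].
Qed.

(** The exchange condition. At some letter [e] the image of [d] turns negative; before that letter
    it must be [e] itself, as the reflection in [e] keeps the other positive roots positive. This
    letter can be deleted. *)
Lemma word_exchange s d : {subset s <= D} -> d \in D -> word s d \notin pos ->
  exists s', [/\ (size s' < size s)%N, {subset s' <= D} &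
                 word s' = (word s \o S d)%VF].
Proof.
move=> sD dD; elim: s sD => [|e s IH] sD /=.
  by rewrite id_lfunE D_pos.
have eD : e \in D by apply: sD; rewrite mem_head.
have {}sD : {subset s <= D} by move=> x xs; apply: sD; rewrite inE xs orbT.
rewrite comp_lfunE lrflE => hn.
have [wd|wd] := boolP (word s d \in pos); last first.
  have [s' [h1 h2 h3]] := IH sD wd; exists (e :: s'); split=> //.
    by move=> x; rewrite inE => /orP[/eqP->//|/h2].
  by rewrite /= h3 comp_lfunA.
have he : word s d = e.
  by apply/eqP; apply: contraNT hn; apply: D_refl.
exists s; split=> //; apply/lfunP => x; rewrite !comp_lfunE !lrflE.
rewrite (weyl_equivariant _ _ (weyl_word sD)) he reflectionK //.
exact: D_neq0.
Qed.

(** Induction on the length of a word for [w]. If [w] makes a simple [d] negative, then w s_d has a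
    shorter word. If it makes none negative, the exchange condition at the last letter gives a
    shorter word for [w] itself. *)
Lemma weyl_ind_pos (P : 'End(E) -> Prop) : P \1%VF ->
  (forall w d, weyl w -> d \in D -> w d \in pos -> P w -> P (w \o S d)%VF) ->
  forall w, weyl w -> P w.
Proof.
move=> P1 PS w /weyl_is_word [s sD ->]; have [n] := ubnP (size s).
elim: n s sD => // n IH s sD /ltnSE hn.
have SdK d (u : 'End(E)) : d \in D -> ((u \o S d) \o S d)%VF = u.
  by move=> dD; rewrite -comp_lfunA reflSK ?comp_lfun1r // D_root.
have [[d dD hd]|hno] := EM (exists2 d, d \in D & word s d \notin pos).
  have [s' [h1 h2 h3]] := word_exchange sD dD hd.
  rewrite -(SdK d (word s) dD) -h3; apply: PS => //; first exact: weyl_word.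
    rewrite h3 comp_lfunE lrflE reflection_id ?D_neq0 // linearN /=.
    by rewrite pos_opp // weyl_root ?D_root //; apply: weyl_word.
  by apply: IH => //; apply: leq_trans hn.
case/lastP: s sD hn hno => [//|s d] sD hn hno.
have dD : d \in D by apply: sD; rewrite mem_rcons mem_head.
have {}sD : {subset s <= D}.
  by move=> x xs; apply: sD; rewrite mem_rcons inE xs orbT.
have hw : word (rcons s d) = (word s \o S d)%VF.
  by rewrite -cats1 word_cat /= comp_lfun1r.
have wd : word s d \notin pos.
  apply/negP => wd; apply: hno; exists d => //; rewrite hw comp_lfunE lrflE.
  rewrite reflection_id ?D_neq0 // linearN /= pos_opp ?wd //.
  by rewrite weyl_root ?D_root //; apply: weyl_word.
have [s' [h1 h2 h3]] := word_exchange sD dD wd.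
rewrite hw -h3; apply: IH => //; apply: leq_trans h1 _.
by apply: leq_trans hn; rewrite size_rcons.
Qed.

(** As the roots span E, an element is determined by the indices of the images of the roots, and
    there are finitely many such codes. *)
Lemma weyl_finite : finite_set (weyl_group ip roots : set 'End(E)).
Proof.
pose k := size roots.
pose code (w : 'End(E)) : {ffun 'I_k -> 'I_k.+1} :=
  [ffun i : 'I_k => inord (index (w (nth 0 roots i)) roots)].
pose A := (weyl_group ip roots : set 'End(E)).
apply: (@sub_finite_set _ _
  ((fun f => xget \1%VF [set w | A w /\ code w = f]) @`
    [set: {ffun 'I_k -> 'I_k.+1}])%classic).
  move=> w ww; exists (code w) => //=.
  case: xgetP => [u _ [wu hu]|/(_ w) h]; last by exfalso; apply: h.
  have agree a : a \in roots -> u a = w a.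
    move=> ar; have ak : (index a roots < k)%N by rewrite index_mem.
    have := congr1 (fun f : {ffun 'I_k -> 'I_k.+1} => val (f (Ordinal ak))) hu.
    rewrite /code !ffunE /= nth_index // !inordK ?ltnS ?index_size // => hi.
    rewrite -(nth_index 0 (weyl_root wu ar)) hi.
    by rewrite nth_index // weyl_root.
  apply/lfunP => x; have : x \in <<roots>>%VS by rewrite (roots_span HR) memvf.
  move/(@coord_span _ _ _ (in_tuple roots)) => ->; rewrite !linear_sum.
  apply: eq_bigr => i _; rewrite !linearZ /= agree //.
exact: mem_nth.
exact/finite_image/finite_finset.
Qed.

(** * Sums and products over invariant sets of positive roots *)

Section Invariant.
Context (Q : pred E) (QN : forall a, a \in roots -> Q (- a) = Q a).

Lemma Q_pabs a : a \in roots -> Q (pabs a) = Q a.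
Proof. by move=> ar; rewrite /pabs; case: ifP => // _; apply: QN. Qed.

(** Injectivity holds because two positive roots with opposite images would be opposite to each
    other. *)
Lemma perm_pabs w : weyl w -> (forall a, a \in roots -> Q (w a) = Q a) ->
  perm_eq [seq pabs (w a) | a <- [seq a <- pos | Q a]] [seq a <- pos | Q a].
Proof.
move=> ww Qw; apply: (@perm_map_in _ _ (fun a => pabs (w a))).
- exact: filter_uniq.
- move=> a b; rewrite !mem_filter => /andP[_ ap] /andP[_ bp].
  have h c d : c \in pos -> d \in pos -> w c = - w d -> c = d.
    move=> cp dp; rewrite -linearN => /(weyl_inj ww) cd.
    by move: cp; rewrite cd pos_opp ?dp // pos_root.
  rewrite /pabs; case: (w a \in pos); case: (w b \in pos).
  + exact: (weyl_inj ww).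
  + exact: h.
  + by move=> /esym/(h _ _ bp ap) ->.
  + by move=> /oppr_inj/(weyl_inj ww).
- move=> a; rewrite !mem_filter => /andP[Qa ap].
  have war := weyl_root ww (pos_root ap).
  by rewrite Q_pabs // Qw ?Qa ?pos_root //= pabs_pos.
Qed.

Lemma big_pabs (T : Type) (idx : T) (op : Monoid.com_law idx) w (F : E -> T) :
  weyl w -> (forall a, a \in roots -> Q (w a) = Q a) ->
  \big[op/idx]_(a <- [seq a <- pos | Q a]) F (pabs (w a)) =
  \big[op/idx]_(a <- [seq a <- pos | Q a]) F a.
Proof.
by move=> ww Qw; rewrite -[RHS](perm_big _ (perm_pabs ww Qw)) big_map.
Qed.

End Invariant.

(** The reflection in [d] permutes the positive roots other than [d] and negates [d], so it lowers
    the weighted sum by 2 f(d) d. For f = 1 this is <rho, d^vee> = 1. *)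
Lemma ip_inv_sum (f : E -> R) d : d \in D ->
  (forall a, a \in roots -> f (- a) = f a) ->
  (forall a, a \in roots -> f (rfl d a) = f a) ->
  ip (\sum_(a <- pos) f a *: a) (coroot ip d) = 2 * f d.
Proof.
move=> dD fN fd; have dr := D_root dD; have d0 := D_neq0 dD.
set s := \sum_(a <- pos) f a *: a.
have hs : s = rfl d s + (2 * f d) *: d.
  have := @big_pabs predT (fun _ _ => erefl) _ _ _ (S d) (fun a => f a *: a)
    (weyl_refl dr) (fun _ _ => erefl).
  rewrite filter_predT {1}/s => <-; rewrite linear_sum /=.
  rewrite (bigD1_seq d) //= ?D_pos // [in RHS](bigD1_seq d) ?D_pos //=.
  rewrite -addrA [in RHS]addrC -addrA addrC; congr (_ + _).
    rewrite big_seq_cond [RHS]big_seq_cond; apply: eq_bigr => a /andP[ap ad].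
    by rewrite lrflE /pabs D_refl // fd ?pos_root // linearZ.
  rewrite lrflE linearZ /= reflection_id // pabsN // /pabs D_pos //.
  by rewrite scalerN -scalerBl mulrDl !mul1r addrK.
have : ip s (coroot ip d) *: d = (2 * f d) *: d.
  by apply: (addrI (rfl d s)); rewrite -hs /reflection subrK.
move/eqP; rewrite -subr_eq0 -scalerBl scaler_eq0 (negbTE d0) orbF subr_eq0.
by move/eqP.
Qed.

Lemma ip_half_sum (Q : pred E) d : d \in D ->
  (forall a, a \in roots -> Q (- a) = Q a) ->
  (forall a, a \in roots -> Q (rfl d a) = Q a) ->
  ip (half_sum [seq a <- pos | Q a]) (coroot ip d) = (Q d)%:R.
Proof.
move=> dD QN Qd; rewrite /half_sum ipZl.
have -> : \sum_(a <- [seq a <- pos | Q a]) a = \sum_(a <- pos) (Q a)%:R *: a.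
  rewrite big_filter big_mkcond /=; apply: eq_bigr => a _.
  by case: (Q a); rewrite ?scale1r ?scale0r.
rewrite (@ip_inv_sum (fun a => (Q a)%:R)) => // [|a ar|a ar].
- by rewrite mulKf // pnatr_eq0.
- by rewrite QN.
- by rewrite Qd.
Qed.

(** The invariant weights 2 / <a, a> turn the sum of roots of [ip_inv_sum] into a sum of coroots. *)
Lemma ht_simple (Q : pred E) d : d \in D ->
  (forall a, a \in roots -> Q (- a) = Q a) ->
  (forall a, a \in roots -> Q (rfl d a) = Q a) ->
  ht ip [seq a <- pos | Q a] d = (Q d)%:R.
Proof.
move=> dD QN Qd; have d0 := D_neq0 dD.
have h := @ip_inv_sum (fun a => (Q a)%:R * (2 / ip a a)) d dD.
have {h} : ip (\sum_(a <- pos) ((Q a)%:R * (2 / ip a a)) *: a) (coroot ip d) =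
    2 * ((Q d)%:R * (2 / ip d d)).
  apply: h => a ar; first by rewrite QN // ipNl ipNr opprK.
  by rewrite Qd // reflection_isom.
set s := \sum_(a <- pos) _ => h.
have nz : 2 / ip d d != 0.
  by rewrite mulf_neq0 ?pnatr_eq0 // invr_eq0 ip_eq0.
have hs : ip d s = 2 * (Q d)%:R.
  by apply: (mulfI nz); rewrite ipC -ipZr -/(coroot ip d) h mulrA mulrC.
rewrite -[RHS](mulKf (x := 2)) ?pnatr_eq0 // -hs ip_sumr mulr_sumr.
rewrite /ht big_filter big_mkcond /=; apply: eq_bigr => a _.
rewrite /coroot !ipZr; case: (Q a); rewrite /= ?mul0r ?mulr0 //.
by rewrite mul1r mulrC.
Qed.

(** * The sign character *)

Section Eps.
Context (K : comNzRingType).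

Definition psign x : K := if x \in pos then 1 else -1.
(** This is the determinant of [w] when [w] is in the Weyl group; in this form its multiplicativity
    is a reindexing of the positive roots. *)
Definition eps w : K := \prod_(a <- pos) psign (w a).

Lemma psignN a : a \in roots -> psign (- a) = - psign a.
Proof.
by move=> ar; rewrite /psign pos_opp //; case: (a \in pos); rewrite //= opprK.
Qed.

Lemma psign_split w a : weyl w -> a \in roots ->
  psign (w a) = psign a * psign (w (pabs a)).
Proof.
move=> ww ar; rewrite /pabs {2}/psign; case: ifP; first by rewrite mul1r.
by rewrite linearN psignN ?weyl_root //= mulrNN mul1r.
Qed.

Lemma eps1 : eps \1%VF = 1.
Proof.
by rewrite /eps big_seq big1 // => a ap; rewrite id_lfunE /psign ap.
Qed.

Lemma eps_comp w1 w2 : weyl w1 -> weyl w2 ->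
  eps (w1 \o w2)%VF = eps w1 * eps w2.
Proof.
move=> h1 h2; rewrite mulrC /eps.
have := @big_pabs predT (fun _ _ => erefl) _ _ _ w2 (fun a => psign (w1 a)) h2
  (fun _ _ => erefl).
rewrite filter_predT => <-; rewrite -big_split /= big_seq [RHS]big_seq.
apply: eq_bigr => a ap; rewrite comp_lfunE psign_split //.
by rewrite weyl_root // pos_root.
Qed.

Lemma eps_simple d : d \in D -> eps (S d) = -1.
Proof.
move=> dD; have dp := D_pos dD; rewrite /eps (bigD1_seq d) //= lrflE.
rewrite reflection_id ?D_neq0 // psignN ?D_root // {1}/psign dp.
rewrite big_seq_cond big1 ?mulr1 // => a /andP[ap ad].
by rewrite lrflE /psign D_refl.
Qed.

Lemma eps_sq w : eps w * eps w = 1.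
Proof.
rewrite /eps -big_split /= big1 // => a _.
by rewrite /psign; case: ifP => _; rewrite ?mulr1 ?mulrNN ?mulr1.
Qed.

Lemma eps_inv w : weyl w -> eps (w^-1)%VF = eps w.
Proof.
move=> ww; have wi := weyl_inv ww.
have h : (w \o w^-1)%VF = \1%VF.
  by apply/lfunP => x; rewrite comp_lfunE id_lfunE weylVK.
by rewrite -[LHS]mul1r -(eps_sq w) -mulrA -eps_comp // h eps1 mulr1.
Qed.

End Eps.

(** * The dominance order and dominant weights *)

Definition Qp x : Prop := exists k : E -> nat, x = \sum_(a <- pos) a *+ k a.

Lemma Qp0 : Qp 0.
Proof. by exists (fun=> 0%N); rewrite big1. Qed.

Lemma QpD x y : Qp x -> Qp y -> Qp (x + y).
Proof.
move=> [k ->] [l ->]; exists (fun a => (k a + l a)%N).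
by rewrite -big_split /=; apply: eq_bigr => a _; rewrite mulrnDr.
Qed.

Lemma Qp_pos a : a \in pos -> Qp a.
Proof.
move=> ap; exists (fun b => (b == a) : nat).
rewrite (bigD1_seq a) //= eqxx mulr1n big1 ?addr0 // => b /negbTE ->.
by rewrite mulr0n.
Qed.

Lemma QpMn x n : Qp x -> Qp (x *+ n).
Proof.
by move=> hx; elim: n => [|n IH]; rewrite ?mulr0n ?mulrS;
  [apply: Qp0|apply: QpD].
Qed.

Lemma Qp_sum (I : Type) (r : seq I) (P : pred I) (F : I -> E) :
  (forall i, P i -> Qp (F i)) -> Qp (\sum_(i <- r | P i) F i).
Proof. by move=> h; elim/big_ind: _ => //; [apply: Qp0|apply: QpD]. Qed.

Lemma Qp_ip y x : (forall a, a \in pos -> 0 <= ip y a) -> Qp x -> 0 <= ip y x.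
Proof.
move=> h [k ->]; rewrite ip_sumr big_seq sumr_ge0 // => a ap.
by rewrite ipMnr mulrn_wge0 // h.
Qed.

Lemma Qp_v x : Qp x -> 0 <= ip v x.
Proof. by apply: Qp_ip => a /pos_gt0/ltW. Qed.

Lemma Qp_eq0 y x : (forall a, a \in pos -> 0 < ip y a) ->
  Qp x -> ip y x <= 0 -> x = 0.
Proof.
move=> h [k ->] h0; rewrite big_seq big1 // => a ap.
move: h0; rewrite ip_sumr => h0.
have : \sum_(a <- pos | a \in pos) ip y (a *+ k a) == 0.
  rewrite -big_seq eq_le h0 big_seq sumr_ge0 // => b bp.
  by rewrite ipMnr mulrn_wge0 // ltW // h.
rewrite psumr_eq0 => [|b bp]; last by rewrite ipMnr mulrn_wge0 // ltW // h.
move=> /allP/(_ _ ap); rewrite ap /= ipMnr mulrn_eq0 (gt_eqF (h _ ap)) orbF.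
by move/eqP ->; rewrite mulr0n.
Qed.

Lemma Qp_anti x : Qp x -> Qp (- x) -> x = 0.
Proof.
move=> h1 h2; apply: (@Qp_eq0 v) => //; first exact: pos_gt0.
by have := Qp_v h2; rewrite ipNr oppr_ge0.
Qed.

Lemma coroot_rfl a b : a != 0 ->
  coroot ip (rfl a b) = rfl a (coroot ip b).
Proof. by move=> a0; rewrite /coroot reflection_isom // linearZ. Qed.

Lemma coroot_weyl w a : weyl w -> coroot ip (w a) = w (coroot ip a).
Proof. by move=> ww; rewrite /coroot weyl_ip // linearZ. Qed.

Lemma corootN a : coroot ip (- a) = - coroot ip a.
Proof. by rewrite /coroot ipNl ipNr opprK scalerN. Qed.

(** For b = s_d a one has <x, a^vee> = <x, b^vee> - <x, d^vee> <d, b^vee>, so integrality propagates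
    along [pos_ind]. *)
Lemma simple_int x :
  (forall d, d \in D -> ip x (coroot ip d) \is a Num.int) ->
  forall a, a \in roots -> ip x (coroot ip a) \is a Num.int.
Proof.
move=> h; suff hp a : a \in pos -> ip x (coroot ip a) \is a Num.int.
  move=> a ar; have [/hp//|an] := boolP (a \in pos).
  by rewrite -[a]opprK corootN ipNr rpredN hp // pos_opp.
move=> ap; elim/pos_ind: a / ap => // a d ap dD ad.
move=> hd; rewrite -[a](reflectionK ip (D_neq0 dD)) coroot_rfl ?D_neq0 //.
rewrite -reflection_ipl /reflection ipBl ipZl rpredB //.
have dr := D_root dD; apply: rpredM; first exact: h.
by apply/(roots_crystallographic HR)/dr/(roots_reflection HR)/pos_root.
Qed.

Lemma simple_dominant x :
  (forall d, d \in D -> ip x (coroot ip d) \is a Num.nat) ->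
  dominant ip roots pos x.
Proof.
move=> h; have hi : weight_lattice ip roots x.
  by apply: simple_int => d dD; apply/intr_nat/h.
split=> // a ap; rewrite natrEint hi ?pos_root //=.
rewrite coroot_ge0 ?pos_neq0 //; apply: cone_ge0 => // d dD.
by rewrite -coroot_ge0 ?D_neq0 // natr_ge0 // h.
Qed.

Lemma cone_gt0 x a : (forall d, d \in D -> 0 < ip x d) -> a \in pos ->
  0 < ip x a.
Proof.
move=> h ap; have h0 d : d \in D -> 0 <= ip x d by move=> /h/ltW.
rewrite lt_def cone_ge0 // andbT; apply/eqP => hx.
have [c [c0 ha hc]] := cone_simple h0 ap hx.
have := pos_neq0 ap; rewrite ha big_seq big1 ?eqxx // => d dD.
by rewrite hc // ?scale0r // gt_eqF // h.
Qed.

Lemma ip_rho d : d \in D -> ip rho (coroot ip d) = 1.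
Proof.
move=> dD; have := ip_half_sum (Q := predT) dD.
by rewrite filter_predT => ->.
Qed.

Lemma rho_gt0 a : a \in pos -> 0 < ip rho a.
Proof.
apply: cone_gt0 => d dD; rewrite -(coroot_gt0 _ _ (D_neq0 dD)).
by rewrite ip_rho.
Qed.

Lemma Qp_int x a : Qp x -> a \in roots -> ip x (coroot ip a) \is a Num.int.
Proof.
move=> [k ->] ar; rewrite ip_suml big_seq rpred_sum // => b bp.
by rewrite ipMnl rpredMn // (roots_crystallographic HR) // pos_root.
Qed.

(** Write rho as half the sum of the roots |w a|: half of |w a| - w a is 0 or - w a according to the
    sign of w a. *)
Lemma rho_weyl w : weyl w ->
  rho - w rho = \sum_(a <- pos | w a \notin pos) - w a.
Proof.
move=> ww; have := @big_pabs predT (fun _ _ => erefl)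
  _ _ _ w id ww (fun _ _ => erefl).
rewrite filter_predT => hs.
rewrite /half_sum linearZ /= -scalerBr [w _]linear_sum /= -{1}hs -sumrB.
rewrite [RHS]big_mkcond.
rewrite scaler_sumr.
apply: eq_bigr => a _; rewrite /pabs; case: ifP => _ /=.
  by rewrite subrr scaler0.
have -> : - w a - w a = 2 *: (- w a) by rewrite scaler_nat mulr2n.
by rewrite scalerA mulVf ?scale1r // pnatr_eq0.
Qed.

(** * Alternating sums over a stabilizer *)

Section Parabolic.
Context (l0 : E) (l0_ge0 : forall a, a \in pos -> 0 <= ip l0 a).

Definition weyl_enum : seq 'End(E) :=
  fset_set (weyl_group ip roots : set 'End(E)).

Lemma weyl_enum_uniq : uniq weyl_enum. Proof. exact: fset_uniq. Qed.

Lemma mem_weyl_enum w : w \in weyl_enum <-> weyl w.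
Proof.
rewrite [w \in weyl_enum](@in_fset_set _ _ weyl_finite).
by rewrite inE.
Qed.

(** It is taken at [l0 = 0], where it is the whole Weyl group, at lambda~, and at the dominant
    weights indexing the monomials. *)
Definition par : seq 'End(E) := [seq w : 'End(E) <- weyl_enum | w l0 == l0].

Lemma mem_par w : w \in par <-> weyl w /\ w l0 = l0.
Proof.
rewrite mem_filter; split; first by move=> /andP[/eqP h /mem_weyl_enum].
by move=> [/mem_weyl_enum -> ->]; rewrite eqxx.
Qed.

Lemma par_uniq : uniq par. Proof. exact/filter_uniq/weyl_enum_uniq. Qed.

Lemma par_weyl w : w \in par -> weyl w. Proof. by move/mem_par => []. Qed.

Lemma par1 : \1%VF \in par.
Proof. by apply/mem_par; rewrite id_lfunE; split=> //; apply: weyl_id. Qed.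

Lemma par_comp w1 w2 : w1 \in par -> w2 \in par -> (w1 \o w2)%VF \in par.
Proof.
move=> /mem_par[h1 e1] /mem_par[h2 e2]; apply/mem_par; rewrite comp_lfunE e2.
by split=> //; apply: weyl_comp.
Qed.

Lemma par_inv w : w \in par -> (w^-1)%VF \in par.
Proof.
move=> /mem_par[h e]; apply/mem_par; split; first exact: weyl_inv.
by rewrite -{1}e weylK.
Qed.

Lemma big_par_mulr (T : Type) (idx : T) (op : Monoid.com_law idx) u
    (F : 'End(E) -> T) : u \in par ->
  \big[op/idx]_(w <- par) F (w \o u)%VF = \big[op/idx]_(w <- par) F w.
Proof.
move=> up; have p : perm_eq [seq (w \o u)%VF | w <- par] par.
  apply: (@perm_map_in _ _ (fun w => (w \o u)%VF)); first exact: par_uniq.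
    move=> w1 w2 _ _ /lfunP h; apply/lfunP => x.
    by have := h (u^-1%VF x); rewrite !comp_lfunE (weylVK (par_weyl up)).
  by move=> w wp; apply: par_comp.
by rewrite -[RHS](perm_big _ p) big_map.
Qed.

Lemma big_par_inv (T : Type) (idx : T) (op : Monoid.com_law idx)
    (F : 'End(E) -> T) :
  \big[op/idx]_(w <- par) F (w^-1)%VF = \big[op/idx]_(w <- par) F w.
Proof.
have p : perm_eq [seq (w^-1)%VF | w <- par] par.
  apply: (@perm_map_in _ _ (fun w => (w^-1)%VF)); first exact: par_uniq.
    move=> w1 w2 /par_weyl h1 /par_weyl h2 h.
    by rewrite -(weyl_invK h1) h (weyl_invK h2).
  exact: par_inv.
by rewrite -[RHS](perm_big _ p) big_map.
Qed.

Lemma par_ip w a : w \in par -> ip l0 (w a) = ip l0 a.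
Proof. by move=> /mem_par[h e]; rewrite -{1}e weyl_ip. Qed.

(** The stabilizer of a dominant vector is generated by the simple reflections in it: if w s_d fixes
    [l0] and w d > 0, then <l0, d> = - <l0, w d> <= 0, so [d] is orthogonal to [l0] and [w] fixes
    [l0] too. *)
Lemma par_ind (P : 'End(E) -> Prop) : P \1%VF ->
  (forall w d, w \in par -> d \in D -> ip l0 d = 0 -> w d \in pos -> P w ->
    P (w \o S d)%VF) ->
  forall w, w \in par -> P w.
Proof.
move=> P1 PS w /mem_par[ww].
elim/weyl_ind_pos: w / ww => //.
move=> w d ww dD wd IH hl0.
have dl : ip l0 d = 0.
  apply/le_anti; rewrite l0_ge0 ?D_pos // andbT.
  have wu : weyl (w \o S d)%VF by apply/weyl_comp/weyl_refl/D_root.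
  rewrite -(weyl_ip _ _ wu) hl0 comp_lfunE lrflE reflection_id ?D_neq0 //.
  by rewrite linearN ipNr oppr_le0 l0_ge0.
have wl0 : w l0 = l0.
  by rewrite -{2}hl0 comp_lfunE lrflE reflection_fix ?D_neq0.
by apply: PS => //; [apply/mem_par|apply: IH].
Qed.

Lemma par_neg_simple w : w \in par -> w <> \1%VF ->
  exists d, [/\ d \in D, ip l0 d = 0 & w d \notin pos].
Proof.
elim/par_ind: w / => // w d wp dD ld wd _ _; exists d; split=> //.
have ww := par_weyl wp.
rewrite comp_lfunE lrflE reflection_id ?D_neq0 // linearN /=.
by rewrite pos_opp ?wd // weyl_root ?D_root.
Qed.

(** Along [par_ind], x - w s_d x = (x - w x) + <x, d^vee> w d with w d positive. *)
Lemma par_le x w : w \in par ->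
  (forall d, d \in D -> ip l0 d = 0 -> ip x (coroot ip d) \is a Num.nat) ->
  Qp (x - w x).
Proof.
move=> wp hx; elim/par_ind: w / wp => [|w d wp dD ld wd IH].
  by rewrite id_lfunE subrr; apply: Qp0.
have /natrP[m hm] := hx d dD ld.
rewrite comp_lfunE lrflE /reflection hm linearB linearZ /= scaler_nat.
by rewrite opprB addrCA addrC; apply: QpD => //; apply/QpMn/Qp_pos.
Qed.

Definition ppos : seq E := [seq a <- pos | ip l0 a == 0].

Lemma mem_ppos a : (a \in ppos) = (ip l0 a == 0) && (a \in pos).
Proof. by rewrite mem_filter. Qed.

Lemma par_pos w a : w \in par -> a \in pos -> ip l0 a != 0 -> w a \in pos.
Proof.
move=> wp ap la; have ww := par_weyl wp.
have wr : w a \in roots by rewrite weyl_root // pos_root.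
rewrite -[_ \in pos]negbK -pos_opp //; apply/negP => /l0_ge0.
by rewrite ipNr par_ip // oppr_ge0 leNgt lt_def la l0_ge0.
Qed.

Definition strict x : bool := all (fun a => 0 < ip x a) ppos.

Lemma strict_uniq x u : strict x -> u \in par ->
  (forall a, a \in ppos -> 0 <= ip (u x) a) -> u = \1%VF.
Proof.
move=> /allP sx up hu; apply: contrapT => /(par_neg_simple up) [d [dD ld ud]].
have ww := par_weyl up.
have dp : d \in ppos by rewrite mem_ppos ld eqxx D_pos.
have := sx _ dp; rewrite /= -(weyl_ip _ _ ww) ltNge -oppr_ge0 -ipNr hu //.
rewrite mem_ppos ipNr par_ip // ld oppr0 eqxx /=.
by rewrite pos_opp // weyl_root // D_root.
Qed.

(** Maximize <v, w x> over the stabilizer: if <w x, a> < 0, the reflection in [a] would increase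
    it. *)
Lemma par_chamber x : exists2 w, w \in par &
  forall a, a \in ppos -> 0 <= ip (w x) a.
Proof.
have [w wp hw] := seq_argmax (fun w : 'End(E) => ip v (w x)) par1.
exists w => // a; rewrite mem_ppos => /andP[/eqP la ap].
have a0 := pos_neq0 ap.
have := hw (S a \o w)%VF; rewrite par_comp //; last first.
  apply/mem_par; split; first exact/weyl_refl/pos_root.
  by rewrite lrflE reflection_fix.
move=> /(_ isT); rewrite comp_lfunE lrflE /reflection ipBr ipZr gerBl.
by rewrite pmulr_lge0 ?pos_gt0 // coroot_ge0.
Qed.

(** * Alternating orbit sums *)

Section OrbitSums.
Context (K : numDomainType) (e : E -> K).

Local Notation eps := (eps K).

Definition orb x : K := \sum_(w <- par) eps w * e (w x).

Lemma orb_par u x : u \in par -> orb (u x) = eps u * orb x.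
Proof.
move=> up; rewrite /orb -[in RHS](big_par_mulr _ _ up) mulr_sumr.
rewrite big_seq [RHS]big_seq; apply: eq_bigr => w wp.
rewrite (eps_comp _ (par_weyl wp) (par_weyl up)) comp_lfunE.
by rewrite !mulrA [eps u * _]mulrC -(mulrA (eps w)) eps_sq mulr1.
Qed.

Lemma orb_singular d x : d \in D -> ip l0 d = 0 -> ip x d = 0 -> orb x = 0.
Proof.
move=> dD ld xd.
have sp : S d \in par.
  apply/mem_par; rewrite lrflE reflection_fix ?D_neq0 //; split=> //.
  exact/weyl_refl/D_root.
have := orb_par x sp; rewrite lrflE reflection_fix ?D_neq0 //.
rewrite eps_simple // mulN1r.
by move/eqP; rewrite -addr_eq0 -mulr2n mulrn_eq0 /= => /eqP.
Qed.

(** At most one [w] carries [x] into the open chamber, and the two signs of its term cancel. If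
    there is none, the sum is empty and [x] is conjugate to a point on a wall, where [orb]
    vanishes. *)
Lemma orb_expand x :
  orb x = \sum_(w <- par | strict (w x)) eps w * orb (w x).
Proof.
have [u up hu] := par_chamber x; have uw := par_weyl up.
have [su|nsu] := boolP (strict (u x)).
  rewrite big_mkcond (bigD1_seq u) //=; last exact: par_uniq.
  rewrite su orb_par // mulrA eps_sq mul1r big_seq_cond big1 ?addr0 //.
  move=> w /andP[wp wu]; case: ifP => // sw; case/eqP: wu.
  have h : (w \o u^-1)%VF = \1%VF.
    apply: (strict_uniq su); first by apply: par_comp => //; apply: par_inv.
    by move=> a ap; rewrite comp_lfunE weylK // ltW // (allP sw).
  apply/lfunP => y; have /lfunP/(_ (u y)) := h.
  by rewrite comp_lfunE id_lfunE weylK.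
rewrite [RHS]big_seq_cond [RHS]big1 => [|w /andP[wp sw]]; last first.
  exfalso; case/negP: nsu.
  have h : (u \o w^-1)%VF = \1%VF.
    apply: (strict_uniq sw); first by apply: par_comp => //; apply: par_inv.
    by move=> a ap; rewrite comp_lfunE (weylK (par_weyl wp)) hu.
  have /lfunP/(_ (w x)) := h.
  by rewrite comp_lfunE id_lfunE (weylK (par_weyl wp)) => ->.
(* The wall can be taken simple: a root of the stabilizer orthogonal to [u x] is a nonnegative
   combination of simple ones, each pairing nonnegatively with [u x]. *)
suff [d [dD ld xd]] : exists d, [/\ d \in D, ip l0 d = 0 & ip (u x) d = 0].
  apply: (mulfI (x := eps u));
    last by rewrite mulr0 -orb_par // (orb_singular dD).
  by apply: contra_eqN (eps_sq K u) => /eqP ->; rewrite mulr0 eq_sym oner_eq0.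
case/allPn: nsu => a ap; rewrite -leNgt => ha.
have {ha} ha : ip (u x) a = 0 by apply/le_anti; rewrite ha hu.
move: (ap); rewrite mem_ppos => /andP[/eqP la apos].
have l0D d : d \in D -> 0 <= ip l0 d by move=> dD; rewrite l0_ge0 // D_pos.
have [c [c0 hac hc]] := cone_simple l0D apos la.
apply: contrapT => hno.
have cz d : d \in D -> c d = 0.
  move=> dD; have [/eqP ld|/hc->//] := boolP (ip l0 d == 0).
  have dp : d \in ppos by rewrite mem_ppos ld eqxx D_pos.
  have xd : 0 < ip (u x) d.
    rewrite lt_def hu // andbT; apply/eqP => xd; apply: hno.
    by exists d.
  move: ha; rewrite hac ip_sumr big_seq => /eqP; rewrite psumr_eq0.
    move=> /allP/(_ _ dD); rewrite dD /= ipZr mulf_eq0 (gt_eqF xd) orbF.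
    by move/eqP.
  move=> f fD; rewrite ipZr; have [/eqP lf|/hc->//] := boolP (ip l0 f == 0).
    by rewrite mulr_ge0 // hu // mem_ppos lf eqxx D_pos.
  by rewrite mul0r.
have := pos_neq0 apos; rewrite hac big_seq big1 ?eqxx // => d /cz ->.
by rewrite scale0r.
Qed.

End OrbitSums.

(** * Expanding a character times a product over roots *)

Section Expansion.
Context (I : finType) (a : I -> E) (a_ppos : forall i, a i \in ppos).
Context (a_inv : forall w, w \in par -> \sum_i pabs (w (a i)) = \sum_i a i).
Context (L : E).
Let lt := L - 2^-1 *: \sum_i a i.
Context (lt_dom : forall d, d \in D -> ip l0 d = 0 ->
  ip lt (coroot ip d) \is a Num.nat).

Let kap (A : {set I}) := L - \sum_(i in A) a i.

(** The contribution of [i] to L - w (kap A). It is 0 or a positive root, and it is 0 exactly when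
    membership of [i] in [A] means that w (a i) is negative. *)
Let term w (A : {set I}) i : E :=
  if w (a i) \in pos then (if i \in A then w (a i) else 0)
  else (if i \in A then 0 else - w (a i)).

Let term_Qp w A i : w \in par -> Qp (term w A i).
Proof.
move=> wp; rewrite /term; case: ifPn => h; case: ifP => _;
  rewrite ?oppr0; try exact: Qp0; apply: Qp_pos => //.
rewrite pos_opp // (weyl_root (par_weyl wp)) // pos_root //.
by move: (a_ppos i); rewrite mem_ppos => /andP[].
Qed.

(** Measure everything from the center [lt]: by [a_inv] the half-sum of the a_i is that of the |w
    a_i|, and combining it with w a_i leaves w a_i, - w a_i or 0 at each index. *)
Let diffE w A : w \in par ->
  L - w (kap A) = (lt - w lt) + \sum_i term w A i.
Proof.
move=> wp; have hL : L = lt + 2^-1 *: \sum_i a i by rewrite /lt subrK.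
have hwL : w L = w lt + 2^-1 *: \sum_i w (a i).
  by rewrite -linear_sum -linearZ -linearD /= -hL.
rewrite /kap linearB linear_sum /= hwL [in LHS]hL -(a_inv wp).
rewrite (big_mkcond (fun i => i \in A)) /=.
have -> x y (s t u : E) : x + s - (y + t - u) = (x - y) + (s - t + u).
  by rewrite !opprD opprK addrA addrACA -addrA.
congr (_ + _); rewrite !scaler_sumr -sumrB -big_split /=.
apply: eq_bigr => i _; rewrite /term /pabs; case: ifP => _; case: ifP => _;
  rewrite ?subrr ?add0r ?addr0 //.
all: rewrite scalerN -opprD -scalerDl (_ : 2^-1 + 2^-1 = 1) ?scale1r ?addNr //.
all: lra.
Qed.

Lemma kap_le w A : w \in par -> Qp (L - w (kap A)).
Proof.
move=> wp; rewrite diffE //; apply: QpD; first exact: par_le.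
by apply: Qp_sum => i _; apply: term_Qp.
Qed.

(** By [diffE] the difference is a sum of elements of Q+, so it vanishes only if lt - w lt and every
    term vanish. *)
Lemma kap_eq w A : w \in par ->
  (w (kap A) == L) = (w lt == lt) && (A == [set i | w (a i) \notin pos]).
Proof.
move=> wp; rewrite eq_sym -subr_eq0 diffE //.
have h1 : Qp (lt - w lt) by apply: par_le.
have h2 : Qp (\sum_i term w A i) by apply: Qp_sum => i _; apply: term_Qp.
apply/eqP/andP => [h|[/eqP-> /eqP->]]; last first.
  rewrite subrr add0r big1 // => i _; rewrite /term inE.
  by case: (w (a i) \in pos).
have vt : ip v (\sum_i term w A i) <= 0.
  rewrite -(addKr (lt - w lt) (\sum_i _)) h addr0 ipNr oppr_le0.
  exact: Qp_v.
have vl : ip v (lt - w lt) <= 0.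
  rewrite -[lt - w lt](addrK (\sum_i term w A i)) h sub0r ipNr oppr_le0.
  exact: Qp_v.
have e1 := Qp_eq0 pos_gt0 h1 vl.
split; first by rewrite eq_sym -subr_eq0 e1.
have tz i : term w A i = 0.
  apply: (Qp_eq0 pos_gt0 (term_Qp A i wp)); apply: le_trans vt.
  rewrite (bigD1 i) //= ipDr lerDl; apply: Qp_v.
  by apply: Qp_sum => j _; apply: term_Qp.
apply/eqP/setP => i; rewrite inE; have := tz i; rewrite /term.
have ar : w (a i) \in roots.
  rewrite (weyl_root (par_weyl wp)) // pos_root //.
  by move: (a_ppos i); rewrite mem_ppos => /andP[].
have := root_neq0 ar; case: (w (a i) \in pos); case: (i \in A) => //.
  by move=> /[swap] ->; rewrite eqxx.
by move=> /[swap] /eqP; rewrite oppr_eq0 => /eqP ->; rewrite eqxx.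
Qed.

Context (L_strict : strict L).

(* Grouping the terms of the expanded product by Weyl chamber: only the term
   with [A = {i | w (a i) < 0}] and [w] fixing [lt] reaches the extremal
   weight [L]. *)
Lemma expansion (K : numDomainType) (t : I -> K) :
  exists r : seq (K * E),
  (forall p, p \in r ->
    [/\ strict p.2, p.2 <> L, Qp (L - p.2) & ip l0 p.2 = ip l0 L]) /\
  forall e : E -> K, e 0 = 1 -> {morph e : x y / x + y >-> x * y} ->
  \sum_(w <- par) eps K w *
    (e (w L) * \prod_i (1 + t i * e (- w (a i)))) =
  (\sum_(w <- par | w lt == lt) eps K w *
     \prod_(i | w (a i) \notin pos) t i) * orb e L +
  \sum_(p <- r) p.1 * orb e p.2.
Proof.
pose cond A w := strict (w (kap A)) && (w (kap A) != L).
(* The list does not depend on [e], so it serves for all points of the torus at once. *)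
exists (allpairs_dep
  (fun (A : {set I}) (w : 'End(E)) =>
    ((\prod_(i in A) t i) * eps K w, w (kap A)))
  (index_enum {set I}) (fun A => [seq w : 'End(E) <- par | cond A w])).
split.
  move=> p /allpairsPdep[A [w [_ ]]]; rewrite mem_filter => /andP[].
  move=> /andP[s /eqP ne] wp -> /=; split=> //.
    exact: kap_le.
  rewrite par_ip // /kap ipBr ip_sumr big1 ?subr0 // => i _.
  by move: (a_ppos i); rewrite mem_ppos => /andP[/eqP ->].
move=> e e0 eD.
have esum (J : finType) (P : pred J) (F : J -> E) :
  e (\sum_(j | P j) F j) = \prod_(j | P j) e (F j).
  exact: (big_morph e eD e0).
rewrite big_allpairs_dep /=.
(* Distribute the product over subsets [A] and exchange the sums: the inner one is the alternating
   orbit sum of [kap A]. *)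
have -> : \sum_(w <- par) eps K w *
    (e (w L) * \prod_i (1 + t i * e (- w (a i)))) =
    \sum_(A : {set I}) (\prod_(i in A) t i) * orb e (kap A).
  rewrite /orb; under [RHS]eq_bigr do rewrite mulr_sumr.
  rewrite exchange_big /=; apply: eq_bigr => w _.
  under eq_bigr do rewrite addrC.
  rewrite bigA_distr mulr_sumr mulr_sumr; apply: eq_bigr => A _.
  rewrite -big_mkcond /= big_split /= /kap linearB eD linear_sum -sumrN esum.
  by rewrite /= [RHS]mulrCA; congr (_ * _); rewrite mulrCA.
(* Move each orbit sum into the open chamber by [orb_expand] and separate the representatives equal
   to [L]. *)
have -> : \sum_(A : {set I}) (\prod_(i in A) t i) * orb e (kap A) =
    \sum_(A : {set I}) \sum_(w <- par | (w (kap A) == L))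
      (\prod_(i in A) t i) * eps K w * orb e L +
    \sum_(A : {set I}) \sum_(w <- par | cond A w)
      (\prod_(i in A) t i) * eps K w * orb e (w (kap A)).
  rewrite -big_split /=; apply: eq_bigr => A _.
  rewrite orb_expand (bigID (fun w : 'End(E) => w (kap A) == L)) /= mulrDr.
  rewrite !mulr_sumr; congr (_ + _).
    apply: eq_big => [w|w /andP[_ /eqP ->]]; last by rewrite mulrA.
    by have [->|] := eqVneq (w (kap A)) L; rewrite ?L_strict ?andbF.
  by apply: eq_bigr => w _; rewrite mulrA.
congr (_ + _); last by apply: eq_bigr => A _; rewrite big_filter.
under [LHS]eq_bigr do rewrite big_mkcond.
rewrite exchange_big /= mulr_suml [RHS]big_mkcond big_seq [RHS]big_seq.
apply: eq_bigr => w wp; rewrite -big_mkcond /=.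
under eq_bigl do rewrite kap_eq //.
case: (w lt == lt) => /=; last by rewrite big_pred0_eq.
rewrite big_pred1_eq; congr (_ * _); rewrite mulrC; congr (_ * _).
by apply: eq_bigl => i; rewrite inE.
Qed.

End Expansion.

(** * The denominator formula and Macdonald's product formula *)

Section Macdonald.
Context (K : numFieldType) (e : E -> K) (e0 : e 0 = 1).
Context (eD : {morph e : x y / x + y >-> x * y}).

Local Notation eps := (eps K).

Lemma char_neq0 x : e x != 0.
Proof.
by apply: contra_eqN e0 => /eqP h;
  rewrite -(subrr x) eD h mul0r eq_sym oner_eq0.
Qed.

Lemma charN x : e (- x) = (e x)^-1.
Proof.
by apply: (mulfI (char_neq0 x)); rewrite -eD subrr e0 divff ?char_neq0.
Qed.

Lemma char_sum (I : Type) (r : seq I) (P : pred I) (F : I -> E) :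
  e (\sum_(i <- r | P i) F i) = \prod_(i <- r | P i) e (F i).
Proof. exact: (big_morph e eD e0). Qed.

Lemma neg_ppos w a : w \in par -> a \in pos -> w a \notin pos -> ip l0 a == 0.
Proof.
by move=> wp ap; apply: contraNT; apply: (par_pos wp).
Qed.

Lemma big_neg_ppos (T : Type) (idx : T) (op : Monoid.com_law idx) w
    (F : E -> T) : w \in par ->
  \big[op/idx]_(a <- ppos | w a \notin pos) F a =
  \big[op/idx]_(a <- pos | w a \notin pos) F a.
Proof.
move=> wp; rewrite /ppos big_filter_cond big_seq_cond [RHS]big_seq_cond.
apply: eq_bigl => a; case ap: (a \in pos) => //=.
by case wa: (w a \in pos); rewrite ?andbF // (neg_ppos wp) ?wa.
Qed.

Lemma eps_ppos w : w \in par ->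
  eps w = \prod_(a <- ppos | w a \notin pos) -1.
Proof.
move=> wp; rewrite big_neg_ppos // big_mkcond /=.
by apply: eq_bigr => a _; rewrite /psign; case: (w a \in pos).
Qed.

(** If w a < 0, then 1 - e(- w a) = - e(- w a) (1 - e(w a)). The factors e(- w a) multiply to e(rho
    - w rho) by [rho_weyl], and the signs to eps w. *)
Lemma denominator_par w : w \in par ->
  e (w rho) * \prod_(a <- ppos) (1 - e (- w a)) =
  eps w * (e rho * \prod_(a <- ppos) (1 - e (- a))).
Proof.
move=> wp; have ww := par_weyl wp.
have h : \prod_(a <- ppos) (1 - e (- pabs (w a))) =
    \prod_(a <- ppos) (1 - e (- a)).
  apply: (@big_pabs (fun a => ip l0 a == 0) _ _ _ _ w
    (fun a => 1 - e (- a)) ww).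
    by move=> a _; rewrite ipNr oppr_eq0.
  by move=> a _; rewrite par_ip.
have h2 : e (\sum_(a <- pos | w a \notin pos) - w a) =
    \prod_(a <- ppos | w a \notin pos) e (- w a).
  by rewrite char_sum big_neg_ppos.
rewrite -h -[in e rho](subrK (w rho) rho) addrC eD rho_weyl // h2.
rewrite mulrCA -!mulrA; congr (_ * _); rewrite eps_ppos // mulrA.
have hAB : \prod_(a <- ppos | w a \notin pos) e (- w a) *
    \prod_(a <- ppos | w a \notin pos) -1 =
    \prod_(a <- ppos) if w a \notin pos then e (- w a) * -1 else 1.
  by rewrite -big_mkcond; apply: esym; apply: big_split.
rewrite hAB; apply: etrans; last exact: big_split.
apply: eq_bigr => a _; rewrite /pabs; case: (w a \in pos) => /=.
  by rewrite mul1r.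
by rewrite opprK charN mulrN1 mulNr mulrBr mulr1 mulVf ?char_neq0 // opprB.
Qed.

Lemma par_neg_prod w (q : E -> K) : w \in par ->
  eps w * \prod_(a <- ppos | w a \notin pos) - q a =
  \prod_(a <- ppos | w a \notin pos) q a.
Proof.
move=> wp; rewrite eps_ppos // -big_split /=; apply: eq_bigr => a _.
by rewrite mulN1r opprK.
Qed.

Let I := 'I_(size ppos).
Let a_ (i : I) : E := nth 0 ppos i.

Let a_ppos i : a_ i \in ppos. Proof. exact: mem_nth. Qed.

Let big_I (T : Type) (idx : T) (op : Monoid.com_law idx) (P : pred E)
  (F : E -> T) :
  \big[op/idx]_(i | P (a_ i)) F (a_ i) = \big[op/idx]_(a <- ppos | P a) F a.
Proof. by rewrite (big_nth 0) big_mkord. Qed.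

Let a_inv w : w \in par -> \sum_i pabs (w (a_ i)) = \sum_i a_ i.
Proof.
move=> wp.
rewrite (big_I _ xpredT (fun a => pabs (w a))) (big_I _ xpredT id).
apply: (@big_pabs (fun a => ip l0 a == 0)
  _ _ _ _ w id (par_weyl wp)) => a _; first by rewrite ipNr oppr_eq0.
by rewrite par_ip.
Qed.

Let lt := rho - 2^-1 *: \sum_i a_ i.

(** Both rho and the half-sum of the positive roots orthogonal to [l0] pair to 1 with the coroot of
    [d]. *)
Let lt_simple d : d \in D -> ip l0 d = 0 -> ip lt (coroot ip d) = 0.
Proof.
move=> dD ld; rewrite /lt (big_I _ xpredT id) ipBl ip_rho //.
have /= := ip_half_sum
  (Q := fun a => ip l0 a == 0) dD.
rewrite /half_sum ld eqxx => -> => [|a ar|a ar]; first by rewrite subrr.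
  by rewrite ipNr oppr_eq0.
by rewrite -reflection_ipl reflection_fix ?D_neq0.
Qed.

Let lt_fix w : w \in par -> w lt = lt.
Proof.
elim/par_ind: w / => [|w d wp dD ld _ IH].
  by rewrite id_lfunE.
rewrite comp_lfunE lrflE reflection_fix ?D_neq0 //.
by apply/eqP; rewrite -(coroot_eq0 _ _ (D_neq0 dD)) lt_simple.
Qed.

(** Put y = rho - x. As <l0, y> = 0, only roots orthogonal to [l0] occur in [y]. For such simple
    [d], strictness and integrality give <x, d^vee> >= 1 = <rho, d^vee>, so [y] pairs nonpositively
    with these roots and <y, y> <= 0. *)
Let no_lower x : strict x -> x <> rho -> Qp (rho - x) -> ip l0 x = ip l0 rho ->
  False.
Proof.
move=> /allP sx xr qx lx; apply: xr; apply/eqP.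
rewrite eq_sym -subr_eq0 -(ip_eq0 ip); apply/eqP/le_anti.
rewrite ip_ge0 andbT; set y := rho - x.
have [k hk] := qx; rewrite -/y in qx hk.
have ly : ip l0 y = 0 by rewrite ipBr lx subrr.
have ysimple d : d \in D -> ip l0 d = 0 -> ip y d <= 0.
  move=> dD ld; rewrite -oppr_ge0 -ipNl -(coroot_ge0 _ _ (D_neq0 dD)) ipNl.
  rewrite oppr_ge0 ipBl ip_rho // subr_le0; apply: int_gt0_ge1.
    rewrite -[x](subKr rho) ipBl ip_rho // rpredB ?rpred1 //.
    exact/(Qp_int qx)/D_root.
  rewrite coroot_gt0 ?D_neq0 //; apply: sx.
  by rewrite mem_ppos ld eqxx D_pos.
have ypos a : a \in ppos -> ip y a <= 0.
  rewrite mem_ppos => /andP[/eqP la ap].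
  have [|c [c0 -> hc]] := cone_simple (x := l0) _ ap la.
    by move=> d dD; rewrite l0_ge0 // D_pos.
  rewrite ip_sumr big_seq sumr_le0 // => d dD; rewrite ipZr.
  have [/eqP ld|/hc->//] := boolP (ip l0 d == 0); last by rewrite mul0r.
  by rewrite mulr_ge0_le0 // ysimple.
rewrite {2}hk ip_sumr big_seq sumr_le0 // => a ap; rewrite ipMnr.
have [/eqP la|la] := boolP (ip l0 a == 0).
  by rewrite mulrn_wle0 // ypos // mem_ppos la eqxx.
suff -> : k a = 0%N by rewrite mulr0n.
move: ly; rewrite hk ip_sumr big_seq => /eqP; rewrite psumr_eq0; last first.
  by move=> b bp; rewrite ipMnr mulrn_wge0 // l0_ge0.
move=> /allP/(_ _ ap); rewrite ap /= ipMnr mulrn_eq0 (negbTE la) orbF.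
by move/eqP.
Qed.

Let rho_strict : strict rho.
Proof. by apply/allP => a; rewrite mem_ppos => /andP[_ /rho_gt0]. Qed.

(** In [expansion] the lower terms are excluded by [no_lower], and every element of the stabilizer
    fixes [lt]. *)
Lemma orb_rho (q : E -> K) :
  \sum_(w <- par) eps w *
    (e (w rho) * \prod_(a <- ppos) (1 - q a * e (- w a))) =
  (\sum_(w <- par) \prod_(a <- ppos | w a \notin pos) q a) * orb e rho.
Proof.
have lt_nat d : d \in D -> ip l0 d = 0 -> ip lt (coroot ip d) \is a Num.nat.
  by move=> dD ld; rewrite lt_simple.
have [r [hr /(_ e e0 eD)]] :=
  expansion a_ppos a_inv lt_nat rho_strict (fun i => - q (a_ i)).
rewrite -/lt [X in _ = _ + X -> _]big_seq [X in _ = _ + X -> _]big1 ?addr0.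
  move=> h; rewrite (_ : \sum_(w <- par) \prod_(a <- _ | _) _ =
    \sum_(w <- par | w lt == lt)
      eps w * \prod_(i | w (a_ i) \notin pos) - q (a_ i)).
    rewrite -h; apply: eq_bigr => w _; rewrite -(big_I _ xpredT);
      congr (_ * (_ * _)).
    by apply: eq_bigr => i _; rewrite mulNr.
  rewrite [RHS]big_mkcond big_seq [RHS]big_seq; apply: eq_bigr => w wp.
  rewrite lt_fix // eqxx (big_I _ (fun a => w a \notin pos) (fun a => - q a)).
  by rewrite par_neg_prod.
by move=> p /hr [h1 h2 h3 h4]; exfalso; apply: no_lower h4.
Qed.

Lemma par_size_gt0 : (0 < size par)%N.
Proof.
rewrite lt0n size_eq0; apply/eqP => h.
by have := par1; rewrite h.
Qed.

(** The denominator formula of the stabilizer is [orb_rho] at q = 1: by [denominator_par] all terms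
    on its left side are equal, and the coefficient on its right side is their number. *)
Lemma orb_rhoE : orb e rho = e rho * \prod_(a <- ppos) (1 - e (- a)).
Proof.
have sum_const (z : K) : \sum_(w <- par) z = (size par)%:R * z.
  by rewrite big_const_seq count_predT iter_addr_0 mulr_natl.
apply: (mulfI (x := (size par)%:R));
  first by rewrite pnatr_eq0 -lt0n par_size_gt0.
rewrite -[(size par)%:R in LHS]mulr1 -sum_const.
rewrite (_ : \sum_(w <- par) 1 =
  \sum_(w <- par) \prod_(a <- ppos | w a \notin pos) (1 : K)); last first.
  by apply: eq_bigr => w _; rewrite big1.
rewrite -(orb_rho (fun=> 1)) -sum_const big_seq [RHS]big_seq.
apply: eq_bigr => w wp.
rewrite (eq_bigr (fun a => 1 - e (- w a))) => [|a _]; last by rewrite mul1r.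
by rewrite denominator_par // mulrA eps_sq mul1r.
Qed.

(* Macdonald's product formula: at a character with [e (- d) = q d] for the
   simple roots [d], every term of [orb_rho] but the one of the identity
   vanishes. *)
Lemma poincare_product (q : E -> K) :
  (forall w a, w \in par -> a \in ppos -> q (pabs (w a)) = q a) ->
  (forall d, d \in D -> ip l0 d = 0 -> e (- d) = q d) ->
  (forall a, a \in ppos -> e (- a) != 1) ->
  \sum_(w <- par) \prod_(a <- ppos | w a \notin pos) q a =
  \prod_(a <- ppos) ((1 - q a * e (- a)) / (1 - e (- a))).
Proof.
move=> qw qe en; have := orb_rho q; rewrite (bigD1_seq \1%VF) /=; last 2 first.
- exact: par1.
- exact: par_uniq.
rewrite eps1 // mul1r id_lfunE; under eq_bigr do rewrite id_lfunE.
rewrite [X in _ + X = _ -> _]big_seq_cond [X in _ + X = _ -> _]big1 ?addr0.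
  rewrite orb_rhoE mulrCA => /(mulfI (char_neq0 _)) h.
  rewrite big_split /= prodfV h mulfK //.
  by rewrite prodf_seq_neq0; apply/allP => a ap /=; rewrite subr_eq0 eq_sym en.
move=> w /andP[wp /eqP w1]; have ww := par_weyl wp.
have [|d [dD ld wd]] := par_neg_simple (par_inv wp).
  move=> h; apply: w1; apply/lfunP => x.
  by have := weylVK ww x; rewrite h !id_lfunE.
(* As w a = - d, the factor at this root is 1 - q(a) e(d), and q(a) = q(d) = e(- d). *)
pose a := - (w^-1)%VF d.
have wi := weyl_inv ww.
have dp : d \in ppos by rewrite mem_ppos ld eqxx D_pos.
have ap : a \in ppos.
  rewrite mem_ppos ipNr par_ip ?par_inv // ld oppr0 eqxx /=.
  by rewrite pos_opp // weyl_root // D_root.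
have aE : a = pabs ((w^-1)%VF d) by rewrite /pabs (negbTE wd).
have waE : - w a = d by rewrite linearN /= opprK weylVK.
suff -> : \prod_(b <- ppos) (1 - q b * e (- w b)) = 0 by rewrite !mulr0.
apply/eqP; rewrite prodf_seq_eq0; apply/hasP; exists a => //=.
by rewrite waE {1}aE qw ?par_inv // -qe // charN mulVf ?char_neq0 // subrr.
Qed.

End Macdonald.

End Parabolic.

(** * Alternating sums over the Weyl group *)

Lemma par0E : par 0 = weyl_enum.
Proof.
by rewrite /par -[RHS]filter_predT; apply: eq_filter => w; rewrite linear0 eqxx.
Qed.

Lemma ppos0E : ppos 0 = pos.
Proof.
by rewrite /ppos -[RHS]filter_predT; apply: eq_filter => a; rewrite ip0l eqxx.
Qed.

Local Notation W := (par 0).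

Lemma mem_W w : w \in W <-> weyl w.
Proof. by rewrite par0E; apply: mem_weyl_enum. Qed.

Lemma ip00 a : a \in pos -> 0 <= ip 0 a.
Proof. by rewrite ip0l. Qed.

Definition chr x k : R[i] := expi (ip k x).

Lemma chr0 x : chr x 0 = 1.
Proof. by rewrite /chr ip0l expi0. Qed.

Lemma chrD x : {morph chr x : k l / k + l >-> k * l}.
Proof. by move=> k l; rewrite /chr ipDl expiD. Qed.

Lemma chr_weyl w x k : weyl w -> chr (w x) k = chr x ((w^-1)%VF k).
Proof.
by move=> ww; rewrite /chr ipC weyl_ipl // ipC.
Qed.

Lemma chrN x k : chr (- x) k = chr x (- k).
Proof. by rewrite /chr ipNr ipNl. Qed.

Lemma chr_conj x k : (chr x k)^* = chr x (- k).
Proof. by rewrite /chr ipNl expiN_conj. Qed.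

Definition stab_size x : nat := size (par x).

Lemma stab_sizeE x : #|` fset_set (weyl_stab ip roots x)| = stab_size x.
Proof.
have fin : finite_set (weyl_stab ip roots x).
  by apply: sub_finite_set weyl_finite => w [].
rewrite /stab_size; apply/eqP; rewrite eqn_leq.
apply/andP; split; apply: uniq_leq_size.
- exact: fset_uniq.
- move=> w; rewrite [w \in _]in_fset_set // inE => -[ww wx].
  by apply/mem_par.
- exact: (par_uniq).
- move=> w /mem_par ww; rewrite [_ \in _]in_fset_set // inE.
  exact: ww.
Qed.

Lemma stab_size_neq0 x : (stab_size x)%:R != 0 :> R[i].
Proof. by rewrite pnatr_eq0 -lt0n par_size_gt0. Qed.

Lemma weyl_orderE : weyl_order ip roots = size W.
Proof. by rewrite par0E /weyl_order. Qed.

Lemma monomial_symE x y : monomial_sym ip roots x y =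
  (stab_size x)%:R^-1 * \sum_(w <- W) expi (ip x (w y)).
Proof.
rewrite /monomial_sym stab_sizeE; congr (_ * _).
by rewrite fsbig_finite /= ?par0E //; apply: weyl_finite.
Qed.

Lemma monomialE x y : monomial_sym ip roots x y =
  (stab_size x)%:R^-1 * \sum_(w <- W) chr y (w x).
Proof.
rewrite monomial_symE -big_par_inv big_seq [in RHS]big_seq; congr (_ * _).
apply: eq_bigr => w /mem_W ww.
rewrite /chr ipC weyl_ipl; first by rewrite weyl_invK // ipC.
exact: weyl_inv.
Qed.

Lemma monomial_weyl w x y : weyl w ->
  monomial_sym ip roots x (w y) = monomial_sym ip roots x y.
Proof.
move=> ww; rewrite !monomial_symE; congr (_ * _).
have wi : w \in W by apply/mem_W.
rewrite -[RHS](big_par_mulr _ _ wi); apply: eq_bigr => u _.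
by rewrite comp_lfunE.
Qed.

Lemma deltaE x : delta ip pos x =
  chr x rho * \prod_(a <- pos) (1 - chr x (- a)).
Proof.
rewrite /delta /half_sum scaler_sumr (char_sum (chr0 x) (@chrD x)).
rewrite -big_split /=; apply: eq_bigr => a _.
rewrite mulrBr mulr1 -chrD /chr ipDl ipNl ipZl mulrC; congr (_ - expi _).
by lra.
Qed.

(** This is [denominator_par] for the full Weyl group, at the inverse of [w]. *)
Lemma delta_weyl w x : weyl w ->
  delta ip pos (w x) = eps R[i] w * delta ip pos x.
Proof.
move=> ww; have wi : (w^-1)%VF \in W by apply/mem_W/weyl_inv.
rewrite !deltaE chr_weyl //; under eq_bigr do rewrite chr_weyl // linearN /=.
have := @denominator_par 0 ip00 _ _
  (chr0 x) (@chrD x) _ wi.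
by rewrite ppos0E => ->; rewrite eps_inv.
Qed.

Local Notation monomial := (monomial_sym ip roots).
Local Notation delta := (delta ip pos).
Local Notation long := (long_root ip roots).
Local Notation pos_s := (pos_s ip roots pos).
Local Notation pos_l := (pos_l ip roots pos).
Local Notation P := (weight_lattice ip roots : E -> Prop).

Lemma long_weyl w a : weyl w -> long_root ip roots (w a) = long_root ip roots a.
Proof.
move=> ww; rewrite /long_root; apply: eq_in_has => c _.
by rewrite (weyl_ip _ _ ww).
Qed.

Lemma longN a : long_root ip roots (- a) = long_root ip roots a.
Proof. by rewrite /long_root; apply: eq_has => c; rewrite ipNl ipNr opprK. Qed.

Definition orbf k x : R[i] := orb 0 (chr x) k.

Lemma half_sum_split : rho = half_sum pos_s + half_sum pos_l.
Proof.
rewrite /half_sum -scalerDr /pos_s /pos_l !big_filter; congr (_ *: _).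
rewrite (bigID (fun a => ~~ long a)) /=; congr (_ + _).
by apply: eq_bigl => a; rewrite negbK.
Qed.

Lemma short_rfl d a : d \in D -> (~~ long (rfl d a)) = (~~ long a).
Proof.
move=> dD; rewrite -lrflE long_weyl //; exact/weyl_refl/D_root.
Qed.

Lemma ip_rho_s d : d \in D ->
  ip (half_sum pos_s) (coroot ip d) = (~~ long d)%:R.
Proof.
move=> dD; apply: (ip_half_sum
  (Q := fun a => ~~ long a)) => // a ar; first by rewrite longN.
exact: short_rfl.
Qed.

Lemma ip_rho_l d : d \in D -> ip (half_sum pos_l) (coroot ip d) = (long d)%:R.
Proof.
move=> dD; apply: (ip_half_sum
  (Q := long)) => // a ar; first by rewrite longN.
exact/negb_inj/short_rfl.
Qed.

(** * The alternating sum of C e^L *)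

Section Expand.
Context (Ms Ml : nat) (ts : 'I_Ms -> R) (tl : 'I_Ml -> R).

Definition cfac a (z : R[i]) : R[i] := if long a then cfun tl z else cfun ts z.

Definition troot a : R := if long a then tt_l tl else tt_s ts.

(** Each positive root is repeated once per parameter of its length, which writes C as a product of
    linear factors as in [expansion]. *)
Let I : finType := ('I_(size pos_s) * 'I_Ms + 'I_(size pos_l) * 'I_Ml)%type.
Let ia (i : I) : E :=
  match i with inl j => nth 0 pos_s j.1 | inr j => nth 0 pos_l j.1 end.
Let it (i : I) : R[i] :=
  match i with inl j => (ts j.2)%:C | inr j => (tl j.2)%:C end.

Let big_I (T : Type) (idx : T) (op : Monoid.com_law idx) (Q : pred E)
    (F : E -> R[i] -> T) :
  \big[op/idx]_(i | Q (ia i)) F (ia i) (it i) =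
  op (\big[op/idx]_(a <- pos_s | Q a) \big[op/idx]_(m < Ms) F a (ts m)%:C)
     (\big[op/idx]_(a <- pos_l | Q a) \big[op/idx]_(m < Ml) F a (tl m)%:C).
Proof.
rewrite big_sumType /=; congr (op _ _).
  rewrite (big_nth 0) big_mkord pair_big_dep /=.
  by apply: eq_bigl => -[i m] /=; rewrite andbT.
rewrite (big_nth 0) big_mkord pair_big_dep /=.
by apply: eq_bigl => -[i m] /=; rewrite andbT.
Qed.

Let ia_pos i : ia i \in ppos 0.
Proof.
rewrite ppos0E; case: i => -[i m] /=.
  by have := mem_nth 0 (ltn_ord i); rewrite mem_filter => /andP[].
by have := mem_nth 0 (ltn_ord i); rewrite mem_filter => /andP[].
Qed.

Let sum_ia (F : E -> E) : \sum_i F (ia i) =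
  (\sum_(a <- pos_s) F a) *+ Ms + (\sum_(a <- pos_l) F a) *+ Ml.
Proof.
have /= -> := @big_I _ 0 +%R xpredT (fun a _ => F a).
by rewrite -!sumrMnl; congr (_ + _); apply: eq_bigr => a _;
  rewrite sumr_const card_ord.
Qed.

Let ia_inv w : w \in W -> \sum_i pabs (w (ia i)) = \sum_i ia i.
Proof.
move=> /mem_W ww; rewrite (sum_ia (fun a => pabs (w a))) (sum_ia id).
congr (_ *+ _ + _ *+ _).
  apply: (@big_pabs (fun a => ~~ long a)
    _ _ _ _ w id ww) => a ar; first by rewrite longN.
  by rewrite long_weyl.
apply: (@big_pabs long
  _ _ _ _ w id ww) => a ar; first by rewrite longN.
by rewrite long_weyl.
Qed.

Let prod_I (F : E -> R[i]) :
  \prod_i (1 + it i * F (ia i)) = \prod_(a <- pos) cfac a (F a).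
Proof.
have /= -> := @big_I _ 1 *%R xpredT (fun a t => 1 + t * F a).
rewrite [RHS](bigID (fun a => ~~ long a)) /= /pos_s /pos_l !big_filter.
congr (_ * _).
  by apply: eq_bigr => a /negbTE la; rewrite /cfac la.
apply: eq_big => [a|a la]; first by rewrite negbK.
by rewrite /cfac la.
Qed.

(** The sign that eps contributes for each root made negative is the minus sign in the definitions
    of t_s and t_l. *)
Let prod_t w : weyl w ->
  eps R[i] w * \prod_(i | w (ia i) \notin pos) it i =
  \prod_(a <- pos | w a \notin pos) (troot a)%:C.
Proof.
move=> ww.
have /= -> := @big_I _ 1 *%R (fun a => w a \notin pos) (fun a t => t).
have -> : eps R[i] w = \prod_(a <- pos | w a \notin pos) (-1 : R[i]).
  rewrite (@eps_ppos 0 ip00) ?ppos0E //.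
  exact/mem_W.
have splitE (F : E -> R[i]) : \prod_(a <- pos | w a \notin pos) F a =
    (\prod_(a <- pos_s | w a \notin pos) F a) *
    (\prod_(a <- pos_l | w a \notin pos) F a).
  rewrite (bigID (fun a => ~~ long a)) /= /pos_s /pos_l !big_filter_cond.
  by congr (_ * _); apply: eq_bigl => a; rewrite ?negbK andbC.
rewrite !splitE mulrACA; congr (_ * _).
  apply: etrans; first exact/esym/big_split.
  rewrite big_seq_cond [RHS]big_seq_cond.
  apply: eq_bigr => a; rewrite mem_filter => /andP[/andP[/negbTE la _] _].
  by rewrite /troot la /tt_s rmorphN rmorph_prod /=; apply: mulN1r.
apply: etrans; first exact/esym/big_split.
rewrite big_seq_cond [RHS]big_seq_cond.
apply: eq_bigr => a; rewrite mem_filter => /andP[/andP[la _] _].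
by rewrite /troot la /tt_l rmorphN rmorph_prod /=; apply: mulN1r.
Qed.

Lemma C_expansion L : strict 0 L ->
  let lt := L - half_sum pos_s *+ Ms - half_sum pos_l *+ Ml in
  (forall d, d \in D -> ip lt (coroot ip d) \is a Num.nat) ->
  exists r : seq (R[i] * E),
  (forall q, q \in r -> [/\ strict 0 q.2, q.2 <> L & Qp (L - q.2)]) /\
  forall x, \sum_(w <- W) eps R[i] w *
      (chr x (w L) * \prod_(a <- pos) cfac a (chr x (- w a))) =
    (\sum_(w <- par lt) \prod_(a <- pos | w a \notin pos) (troot a)%:C) *
      orbf L x + \sum_(q <- r) q.1 * orbf q.2 x.
Proof.
move=> sL lt hlt.
have ltE : L - 2^-1 *: \sum_i ia i = lt.
  rewrite (sum_ia id) /lt /half_sum scalerDr opprD addrA.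
  by rewrite !scalerMnr.
have ltn d : d \in D -> ip 0 d = 0 ->
    ip (L - 2^-1 *: \sum_i ia i) (coroot ip d) \is a Num.nat.
  by move=> dD _; rewrite ltE hlt.
have [r [hr he]] := expansion
  ip00 ia_pos ia_inv ltn sL it.
exists r; split; first by move=> q /hr[].
move=> x; have := he (chr x) (chr0 x) (@chrD x).
rewrite ltE => hx.
under eq_bigr do rewrite -(prod_I (fun a => chr x (- _ a))).
rewrite hx; congr (_ * _ + _).
rewrite par0E [in RHS]/par big_filter big_seq_cond [RHS]big_seq_cond.
by apply: eq_bigr => w /andP[/mem_weyl_enum ww _]; apply: prod_t.
Qed.

End Expand.

Lemma dominant_strict mu : dominant ip roots pos mu -> strict 0 (mu + rho).
Proof.
move=> [_ dmu]; apply/allP => a; rewrite ppos0E => ap; rewrite ipDl ltr_wpDl //.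
  by rewrite -coroot_ge0 ?natr_ge0 ?dmu // pos_neq0.
exact: rho_gt0.
Qed.

(** [C_expansion] with the single parameter -1 for both lengths: C is then the Weyl denominator, the
    shifted weight is [mu] itself, and t_s = t_l = 1 makes the coefficient the order of the
    stabilizer. *)
Lemma monomial_delta mu : dominant ip roots pos mu ->
  exists r : seq (R[i] * E),
  (forall q, q \in r ->
    [/\ strict 0 q.2, q.2 <> mu + rho & Qp (mu + rho - q.2)]) /\
  forall x, (stab_size mu)%:R * (monomial mu x * delta x) =
    (stab_size mu)%:R * orbf (mu + rho) x +
    \sum_(q <- r) q.1 * orbf q.2 x.
Proof.
move=> [Pmu dmu].
have st := dominant_strict (conj Pmu dmu).
pose t1 (i : 'I_1) : R := -1.
have [|r [hr he]] := @C_expansion 1 1 t1 t1 _ st.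
  move=> d dD; rewrite !mulr1n -addrA -opprD -half_sum_split addrK.
  by apply: dmu; apply: D_pos.
exists r; split=> // x; move: (he x).
rewrite !mulr1n -addrA -opprD -half_sum_split addrK.
rewrite [X in _ = X * _ + _ -> _](_ : _ = (stab_size mu)%:R).
  move=> <-; rewrite monomialE mulrA mulVKf ?stab_size_neq0 //.
  rewrite mulr_suml big_seq [RHS]big_seq; apply: eq_bigr => w wW.
  have := @denominator_par 0 ip00 _ _ (chr0 x) (@chrD x) _ wW.
  rewrite ppos0E -deltaE => hd.
  rewrite linearD (chrD x) /= -mulrA.
  rewrite (eq_bigr (fun a => 1 - chr x (- w a))) => [|a _].
    by rewrite hd mulrCA [eps _ _ * (eps _ _ * _)]mulrA eps_sq mul1r.
  by rewrite /cfac /cfun; case: ifP => _;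
    rewrite big_ord1 rmorphN rmorph1 mulN1r.
rewrite /stab_size -sum1_size natr_sum; apply: eq_bigr => w _.
rewrite big1 // => a _; rewrite /troot /tt_s /tt_l.
by case: ifP => _; rewrite big_ord1 opprK.
Qed.

Definition hvec (s : seq E) : E := 2^-1 *: \sum_(c <- s) coroot ip c.

Lemma ip_hvec s a : ip a (hvec s) = ht ip s a.
Proof.
rewrite /hvec ipZr ip_sumr mulr_sumr; apply: eq_bigr => c _.
by rewrite mulrC.
Qed.

(** * Heights and weights *)

Section Height.
Context (Q : pred E) (QN : forall a, a \in roots -> Q (- a) = Q a).
Context (QS : forall d a, d \in D -> a \in roots -> Q (rfl d a) = Q a).
Local Notation h := (ht ip [seq a <- pos | Q a]).

Lemma ht_D d : d \in D -> h d = (Q d)%:R.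
Proof.
move=> dD; apply: ht_simple => // a ar.
exact: QS.
Qed.

(** A simple reflection in [d] changes the height by an integer multiple of the height of [d], which
    is 0 or 1; nonnegativity follows from the simple roots through the cone. *)
Lemma ht_nat a : a \in pos -> h a \is a Num.nat.
Proof.
move=> ap; rewrite natrEint; apply/andP; split; last first.
  rewrite -ip_hvec ipC; apply: cone_ge0 ap => d dD.
  by rewrite ipC ip_hvec ht_D.
elim/pos_ind: a / ap => [d dD|a d ap dD _ IH].
  by rewrite ht_D // intr_nat // natr_nat.
rewrite -[a](reflectionK ip (D_neq0 dD)) -ip_hvec {1}/reflection ipBl ipZl
  !ip_hvec.
rewrite rpredB // rpredM //.
  apply: (roots_crystallographic HR); first exact: D_root.
  by apply: (roots_reflection HR); [apply: D_root|apply: pos_root].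
by rewrite ht_D // intr_nat // natr_nat.
Qed.

Lemma ht_truncn a : a \in pos -> (Num.truncn (h a))%:R = h a.
Proof. by move=> /ht_nat/natrP[m ->]; rewrite natrK. Qed.

End Height.

Lemma P0 : P 0.
Proof. by move=> a _; rewrite ip0l rpred0. Qed.

Lemma PD k l : P k -> P l -> P (k + l).
Proof. by move=> hk hl a ar; rewrite ipDl rpredD ?hk ?hl. Qed.

Lemma PN k : P k -> P (- k).
Proof. by move=> hk a ar; rewrite ipNl rpredN hk. Qed.

Lemma P_weyl w k : weyl w -> P k -> P (w k).
Proof.
move=> ww hk a ar; rewrite weyl_ipl // -coroot_weyl ?hk //.
  by apply: weyl_root => //; apply: weyl_inv.
exact: weyl_inv.
Qed.

Lemma P_Qp k : Qp k -> P k.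
Proof. by move=> hk a ar; apply: Qp_int. Qed.

Lemma P_rho : P rho.
Proof.
apply: simple_int => d dD.
by rewrite ip_rho // rpred1.
Qed.

(* Pairing with [cr], twice the half-sum of the positive coroots, is twice the
   height: it is the measure for inductions along the dominance order. *)
Let cr : E := \sum_(c <- pos) coroot ip c.

Lemma cr_ge1 a : a \in pos -> 1 <= ip a cr.
Proof.
move=> ap; apply: int_gt0_ge1.
  rewrite ip_sumr big_seq rpred_sum // => c cp.
  by rewrite (roots_crystallographic HR) // pos_root.
rewrite ipC; apply: cone_gt0 ap => d dD.
have := @ip_inv_sum (fun c => 2 / ip c c) d dD.
rewrite -(coroot_gt0 _ _ (D_neq0 dD)) => ->.
- by rewrite mulr_gt0 // divr_gt0 // ip_gt0 // D_neq0.
- by move=> a0 _; rewrite ipNl ipNr opprK.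
- by move=> a0 _; rewrite reflection_isom // D_neq0.
Qed.

Lemma cr_int x : P x -> ip x cr \is a Num.int.
Proof.
move=> Px; rewrite ip_sumr big_seq rpred_sum // => c cp.
by apply/Px/pos_root.
Qed.

Lemma cr_dominant x : dominant ip roots pos x -> 0 <= ip x cr.
Proof.
move=> [_ dx]; rewrite ip_sumr big_seq sumr_ge0 // => c cp.
by rewrite natr_ge0 // dx.
Qed.

Lemma cr_gt0 x : Qp x -> x <> 0 -> 1 <= ip x cr.
Proof.
move=> qx x0; apply: int_gt0_ge1; first exact/cr_int/P_Qp.
rewrite ltNge; apply/negP => hx; apply: x0.
apply: (@Qp_eq0 cr x _ qx); last by rewrite ipC.
by move=> a ap; rewrite ipC (lt_le_trans ltr01) // cr_ge1.
Qed.

(** Positive roots pair to at least 1 with [cr] and dominant weights to at least 0, so each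
    coefficient of la - mu is at most <la, cr>. *)
Lemma dominant_finite la :
  finite_set [set mu | dominant ip roots pos mu /\
                       dominance_le pos mu la]%classic.
Proof.
pose N := (Num.truncn (ip la cr)).+1.
pose f (k : {ffun 'I_(size pos) -> 'I_N.+1}) : E :=
  la - \sum_(i < size pos) (nth 0 pos i) *+ k i.
apply: (@sub_finite_set _ _
  (f @` [set: {ffun 'I_(size pos) -> 'I_N.+1}])%classic).
  2: exact/finite_image/finite_finset.
move=> mu [dmu [k hk]]; exists [ffun i : 'I_(size pos) =>
  inord (k (nth 0 pos i))] => //.
have kN a : a \in pos -> (k a < N)%N.
  move=> ap; have h : (k a)%:R <= ip la cr.
    apply: (@le_trans _ _ (ip (la - mu) cr)); last first.
      by rewrite ipBl gerBl cr_dominant.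
    rewrite hk ip_suml (bigD1_seq a) //= ipMnl ler_wpDr //.
      rewrite big_seq_cond sumr_ge0 // => c /andP[cp _].
      by rewrite ipMnl mulrn_wge0 // (le_trans ler01) // cr_ge1.
    by rewrite -[ip a cr *+ _]mulr_natl ler_peMr // cr_ge1.
  rewrite -(ltr_nat R); apply: le_lt_trans h _.
  by apply: truncnS_gt.
apply/eqP; rewrite subr_eq addrC -subr_eq hk (big_nth 0) big_mkord.
apply/eqP; apply: eq_bigr => i _; rewrite ffunE inordK //.
by rewrite ltnS ltnW // kN // mem_nth.
Qed.

(** * Norms of Bernstein-Szego polynomials *)

Section BernsteinSzego.
Context (Ms Ml : nat) (ts : 'I_Ms -> R) (tl : 'I_Ml -> R).
Context (ts_range : forall m, -1 < ts m < 1).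
Context (tl_range : forall m, -1 < tl m < 1).
Context (n : nat) (b : n.-tuple E) (b_basis : coroot_lattice_basis ip roots b).

Local Notation C := (Cfun ip roots pos ts tl).
Local Notation cf := (cfac ts tl).
Local Notation tr := (troot ts tl).
Local Notation CT := (constant_term b).

Lemma CE x : C x = \prod_(a <- pos) cf a (chr x (- a)).
Proof.
rewrite [RHS](bigID (fun a => ~~ long a)) /= /Cfun /pos_s /pos_l !big_filter.
congr (_ * _).
  by apply: eq_bigr => a /negbTE la; rewrite /cfac la /chr ipNl.
apply: eq_big => [a|a la]; first by rewrite negbK.
by rewrite /cfac la /chr ipNl.
Qed.

Lemma cfac_conj a z : (cf a z)^* = cf a z^*.
Proof.
by rewrite /cfac /cfun; case: ifP => _; rewrite rmorph_prod;
  apply: eq_bigr => m _;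
  rewrite rmorphD rmorphM rmorph1; congr (1 + _ * _); apply: conjc_real.
Qed.

Lemma C_conj x : (C x)^* = C (- x).
Proof.
rewrite !CE rmorph_prod; apply: eq_bigr => a _ /=.
by rewrite cfac_conj chr_conj chrN.
Qed.

Lemma C_neq0 x : C x != 0.
Proof.
rewrite CE prodf_seq_neq0; apply/allP => a _ /=; rewrite /cfac /cfun.
by case: ifP => _; rewrite prodf_seq_neq0; apply/allP => m _ /=;
  apply: onePtexpi_neq0.
Qed.

Definition recip x : R[i] := (C x * C (- x))^-1.

(** C(x) C(-x) is a product over the positive roots of factors that are even in the root, so
    [big_pabs] applies. *)
Lemma recip_weyl w x : weyl w -> recip (w x) = recip x.
Proof.
move=> ww; have wi := weyl_inv ww; rewrite /recip !CE -!big_split /=;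
  congr (_^-1).
pose F a := cf a (chr x (- a)) * cf a (chr (- x) (- a)).
have FN a : F (- a) = F a.
  by rewrite /F /cfac longN !chrN !opprK mulrC.
have Fp a : F (pabs a) = F a by rewrite /pabs; case: ifP => // _; apply: FN.
have := @big_pabs predT (fun _ _ => erefl)
  _ _ _ _ F wi (fun _ _ => erefl).
rewrite filter_predT => <-; apply: eq_bigr => a _.
have hx : - w x = w (- x) by rewrite linearN.
by rewrite Fp /F hx !chr_weyl // /cfac long_weyl // !linearN.
Qed.

Lemma weightE x : weight ip roots pos ts tl x =
  delta x * (delta x)^* * recip x.
Proof. by rewrite /weight sqr_normc. Qed.

Lemma P_basis k : P k -> forall i, ip k (tnth b i) \is a Num.int.
Proof.
move=> Pk i; have [_ hb] := b_basis.
have /hb [m ->] : exists m : 'I_n -> int,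
    tnth b i = \sum_(j < n) tnth b j *~ m j.
  exists (fun j => (j == i)%:Z); rewrite (bigD1 i) //= eqxx big1 ?addr0 //.
  by move=> j /negbTE ->.
rewrite ip_sumr big_seq rpred_sum // => a ar.
have -> : coroot ip a *~ m a = (m a)%:~R *: coroot ip a by rewrite scaler_int.
by rewrite ipZr rpredM ?rpred_int // Pk.
Qed.

Definition below k : Prop := Qp (- k) /\ k <> 0.

Lemma belowD k l : below k -> below l -> below (k + l).
Proof.
move=> [hk k0] [hl _]; split; first by rewrite opprD; apply: QpD.
move=> kl; apply: k0; apply/eqP; rewrite -oppr_eq0; apply/eqP.
apply: Qp_anti => //; rewrite opprK -[k](addrK l) kl sub0r //.
Qed.

Lemma below_pos a : a \in pos -> below (- a).
Proof.
move=> ap; split; first by rewrite opprK; apply: Qp_pos.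
by apply/eqP; rewrite oppr_eq0; apply: pos_neq0.
Qed.

Lemma below_P k : below k -> P k.
Proof. by move=> [hk _]; rewrite -[k]opprK; apply/PN/P_Qp. Qed.

(* Constant term 1, all other frequencies strictly below 0. *)
Definition unital (f : E -> R[i]) : Prop := appr ip below (fun x => f x - 1).

Lemma unital_appr f : unital f -> appr ip P f.
Proof.
move=> h; apply: appr_ext (apprD (appr_sub below_P h) (appr_cst ip 1 P0)).
by move=> x; rewrite subrK.
Qed.

Lemma unital_ext f g : (forall x, f x = g x) -> unital f -> unital g.
Proof. by move=> /funext ->. Qed.

Lemma unitalM f g : unital f -> unital g -> unital (fun x => f x * g x).
Proof.
move=> hf hg; apply: appr_ext (apprD (apprD (apprM belowD hf hg) hf) hg) => x.
by ring.
Qed.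

Lemma unital1 : unital (fun=> 1).
Proof.
move=> e e0; exists (fun=> 0); split; last by rewrite !subrr normc0 ltW.
by exists [::]; split=> // x; rewrite big_nil.
Qed.

Lemma unital_prod (I : Type) (r : seq I) (Q : pred I) (F : I -> E -> R[i]) :
  (forall i, Q i -> unital (F i)) ->
  unital (fun x => \prod_(i <- r | Q i) F i x).
Proof.
move=> hF; elim: r => [|i r IH].
  by apply: unital_ext unital1 => x; rewrite big_nil.
have [Qi|nQ] := boolP (Q i).
  by apply: unital_ext (unitalM (hF i Qi) IH) => x; rewrite big_cons Qi.
by apply: unital_ext IH => x; rewrite big_cons (negbTE nQ).
Qed.

Lemma unital_subchr a : a \in pos -> unital (fun x => 1 - chr x (- a)).
Proof.
move=> ap.
have h := appr_expi ip (below_pos ap).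
have hc : appr ip (fun z => z = 0) (fun=> -1 : R[i]) by exact: appr_cst.
have hD k l : k = 0 -> below l -> below (k + l) by move=> -> ; rewrite add0r.
apply: appr_ext (apprM hD hc h) => x.
by rewrite mulN1r addrAC subrr add0r.
Qed.

(** In 1 / (1 + z) - 1 = - z / (1 + z), the factor z moves the frequencies of the geometric series,
    0 among them, strictly below 0. *)
Lemma unital_inv a (t : R) : a \in pos -> -1 < t < 1 ->
  unital (fun x => (1 + t%:C * chr x (- a))^-1).
Proof.
move=> ap ht; pose A k := exists m : nat, k = (- a) *+ m.
have hA : appr ip A (fun x => (1 + t%:C * chr x (- a))^-1).
  by apply: appr_geometric => // m; exists m.
have hc : appr ip (fun z => z = 0) (fun=> - t%:C) by exact: appr_cst.
have hD k l : k = 0 -> below l -> below (k + l) by move=> -> ; rewrite add0r.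
have h := apprM hD hc (appr_expi ip (below_pos ap)).
have hD2 k l : below k -> A l -> below (k + l).
  move=> bk [m ->]; elim: m => [|m IH]; first by rewrite mulr0n addr0.
  by rewrite mulrSr addrA; apply: belowD => //; apply: below_pos.
apply: appr_ext (apprM hD2 h hA) => x.
have n0 : 1 + t%:C * chr x (- a) != 0 by apply: onePtexpi_neq0.
rewrite mulNr -[X in _ = _ - X](divff n0) -[X in _ = X - _]div1r.
by rewrite -mulrBl opprD addNKr.
Qed.

Lemma cfacV a z : (cf a z)^-1 =
  if long a then \prod_(m < Ml) (1 + (tl m)%:C * z)^-1
  else \prod_(m < Ms) (1 + (ts m)%:C * z)^-1.
Proof. by rewrite /cfac /cfun; case: ifP => _; rewrite prodfV. Qed.

Lemma unital_cfacV a : a \in pos -> unital (fun x => (cf a (chr x (- a)))^-1).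
Proof.
move=> ap; apply: (@unital_ext (fun x =>
  if long a then \prod_(m < Ml) (1 + (tl m)%:C * chr x (- a))^-1
  else \prod_(m < Ms) (1 + (ts m)%:C * chr x (- a))^-1)) => [x|].
  by rewrite cfacV.
case: (long a); apply: unital_prod => m _; exact: unital_inv.
Qed.

Lemma unital_CV : unital (fun x => (C x)^-1).
Proof.
have h : unital (fun x => \prod_(a <- pos | a \in pos) (cf a (chr x (- a)))^-1).
  by apply: unital_prod => a; apply: unital_cfacV.
by apply: unital_ext h => x; rewrite -big_seq prodfV CE.
Qed.

Lemma unital_denominator : unital (fun x => \prod_(a <- pos) (1 - chr x (- a))).
Proof.
have h : unital (fun x => \prod_(a <- pos | a \in pos) (1 - chr x (- a))).
  by apply: unital_prod => a; apply: unital_subchr.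
by apply: unital_ext h => x; rewrite -big_seq.
Qed.

Lemma appr_recip : appr ip P recip.
Proof.
have h := unital_appr unital_CV.
apply: appr_ext (apprM PD h (appr_conj PN h)) => x.
by rewrite conjc_inv -invfM C_conj.
Qed.

Lemma appr_delta : appr ip P delta.
Proof.
have h := unital_appr unital_denominator.
apply: appr_ext (apprM PD (appr_expi ip P_rho) h) => x.
by rewrite deltaE.
Qed.

Lemma appr_monomial k : P k -> appr ip P (monomial k).
Proof.
move=> Pk.
have h : appr ip P (fun x =>
  \sum_(w <- W) (if w \in W then chr x (w k) else 0)).
  apply: appr_sum => [|w]; first exact: P0.
  have [/mem_W ww|_] := boolP (w \in W); first exact/appr_expi/P_weyl.
  exact/appr_cst/P0.
apply: appr_ext (apprM PD (appr_cst ip (stab_size k)%:R^-1 P0) h) => x.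
by rewrite monomialE -big_mkcond -big_seq.
Qed.

(** What remains of conj(C e^{lambda + rho}) delta / (C conj(C)) once e^{-lambda} is split off. *)
Definition kernel x : R[i] := \prod_(a <- pos) (1 - chr x (- a)) / C x.

Lemma unital_kernel : unital kernel.
Proof. exact: unitalM unital_denominator unital_CV. Qed.

Lemma dominant_P k : dominant ip roots pos k -> P k.
Proof. by case. Qed.

Lemma weyl_le w k : weyl w -> dominant ip roots pos k -> Qp (k - w k).
Proof.
move=> ww [_ dk].
apply: (par_le ip00) => [|d dD _].
  exact/mem_W.
exact/dk/D_pos.
Qed.

(* Frequencies of [monomial mu * chr (- la) * kernel] are [w mu - la - beta]
   with [beta] in Q+, and [w mu <= mu <= la] leaves only [w mu = mu = la]. *)
Lemma CT_term la mu : P la -> dominant ip roots pos mu -> Qp (la - mu) ->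
  CT (fun x => monomial mu x * chr x (- la) * kernel x) = (mu == la)%:R.
Proof.
move=> P_la dmu lemu; have Pmu := dominant_P dmu.
have bb := b_basis.1.
have le w : weyl w -> Qp (la - w mu).
  move=> ww; rewrite -[la](subrK mu) -addrA; apply: QpD => //.
  exact: weyl_le.
pose F w x : R[i] := (stab_size mu)%:R^-1 * chr x (w mu - la).
have aF w : w \in W -> appr ip P (F w).
  move=> /mem_W ww; apply: (apprM PD); first exact/appr_cst/P0.
  by apply/appr_expi/PD/PN => //; apply: P_weyl.
(* Split off the constant 1 of [kernel]: the first sum is a finite combination of characters, the
   second has only nonzero frequencies. *)
have splitE x : monomial mu x * chr x (- la) * kernel x =
    \sum_(w <- W) (if w \in W then F w x else 0) +
    \sum_(w <- W) (if w \in W then F w x * (kernel x - 1) else 0).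
  rewrite -!big_mkcond -!big_seq -big_split /= monomialE.
  rewrite -!mulrA mulr_suml mulr_sumr; apply: eq_bigr => w _.
  rewrite /F chrD; ring.
have a1 w : appr ip P (fun x => if w \in W then F w x else 0).
  by case wW: (w \in W); [apply: aF|apply/appr_cst/P0].
pose B k := P k /\ k <> 0.
have a2 w : appr ip B (fun x => if w \in W then F w x * (kernel x - 1) else 0).
  case wW: (w \in W); last first.
    move=> e e0; exists (fun=> 0); split; last by rewrite !subrr normc0 ltW.
    by exists [::]; split=> // x; rewrite big_nil.
  have ww := (mem_W w).1 wW.
  pose A k := k = w mu - la.
  have h1 : appr ip A (F w).
    apply: (apprM (A := fun z => z = 0) (B := A)) => [k l -> Al||].
    - by rewrite add0r.
    - exact: appr_cst.
    - exact: appr_expi.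
  apply: apprM h1 unital_kernel => k l -> bl; split.
    by apply: PD; [apply/PD/PN => //; apply: P_weyl|apply: below_P].
  move=> h0; case: bl => [ql]; apply.
  apply/eqP; rewrite -oppr_eq0; apply/eqP; apply: Qp_anti => //.
  rewrite opprK (_ : l = la - w mu); first exact: le.
  by apply/eqP; rewrite -subr_eq0 opprB addrC h0.
rewrite (CT_ext b splitE) CTD; last 2 first.
- apply: (@appr_good _ _ ip _ _ P).
  by apply: appr_sum a1; exact: P0.
- apply: (@appr_good _ _ ip _ _ P).
  apply: appr_sum => [|w]; first exact: P0.
  by apply: appr_sub (a2 w) => k [].
rewrite (CT_sum b _ a1) (CT_sum b _ a2).
rewrite [X in _ + X]big1 ?addr0; last first.
  by move=> w _; apply: (CT_eq0 bb P_basis (a2 w)).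
rewrite big_seq.
under eq_bigr => w wW.
  rewrite wW /F CTZ; last first.
    apply: (@appr_good _ _ ip _ _ P); apply: appr_expi; apply/PD/PN => //.
    by apply/P_weyl => //; apply/mem_W.
  rewrite (CT_expi bb P_basis); last first.
    by apply/PD/PN => //; apply/P_weyl => //; apply/mem_W.
  over.
rewrite -big_seq -mulr_sumr.
have [mula|mula] := eqVneq mu la.
  rewrite -mula (_ : \sum_(w <- W) _ = (stab_size mu)%:R).
    by rewrite mulVf // stab_size_neq0.
  rewrite par0E /stab_size /par size_filter -sum1_count natr_sum.
  rewrite [RHS]big_mkcond; apply: eq_bigr => w _; rewrite subr_eq0.
  by case: eqP.
rewrite big_seq big1 ?mulr0 // => w /mem_W ww.
have -> : (w mu - la == 0) = false; last by [].
apply: contraNF mula => /eqP h; rewrite -subr_eq0; apply/eqP.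
apply: Qp_anti; last by rewrite opprB.
have -> : la = w mu by apply/esym/eqP; rewrite -subr_eq0 h.
exact: weyl_le.
Qed.

(** * Pairings with the polynomial p *)

Context (ts_neq0 : forall m, ts m != 0) (tl_neq0 : forall m, tl m != 0).
Context (la : E) (la_dom : dominant ip roots pos la).
Context (la_deep : sufficiently_deep ip roots pos Ms Ml la).
Context (p : E -> R[i]) (p_BS : bernstein_szego ip roots pos b ts tl la p).

Local Notation lt := (lambda_tilde ip roots pos Ms Ml la).

Lemma ip_lt d : d \in D -> ip lt (coroot ip d) =
  ip la (coroot ip d) + 1 - (if long d then Ml else Ms)%:R.
Proof.
move=> dD; rewrite /lambda_tilde !ipBl ipDl !ipMnl.
rewrite ip_rho //.
rewrite ip_rho_s //.
rewrite ip_rho_l //.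
by case: (long d); rewrite /= ?mul0rn ?subr0.
Qed.

(** Each half-sum pairs to 0 or 1 with a simple coroot, so depth at least M - 1 is what makes
    <lambda, d^vee> + 1 - M nonnegative. *)
Lemma lt_nat d : d \in D -> ip lt (coroot ip d) \is a Num.nat.
Proof.
move=> dD; have dp := D_pos dD; have dr := D_root dD.
have [ds dl] := la_deep.
rewrite natrEint ip_lt //; apply/andP; split.
  by rewrite rpredB ?rpredD ?rpred1 ?rpred_nat //; apply: la_dom.1.
rewrite subr_ge0 -lerBlDr; case: ifP => hd.
  by apply: depth_le dl _ _; rewrite mem_filter hd.
by apply: depth_le ds _ _; rewrite mem_filter hd.
Qed.

Lemma lt_ge0 a : a \in pos -> 0 <= ip lt a.
Proof.
apply: cone_ge0 => d dD.
by rewrite -(coroot_ge0 _ _ (D_neq0 dD)) natr_ge0 // lt_nat.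
Qed.

Let P_la : P la := la_dom.1.
Let SD : seq E :=
  fset_set [set mu | dominant ip roots pos mu /\
                     dominance_le pos mu la]%classic.

Let mem_SD mu : mu \in SD <-> dominant ip roots pos mu /\ Qp (la - mu).
Proof.
rewrite [mu \in SD](@in_fset_set _ _ (dominant_finite la)).
by rewrite inE.
Qed.

Let pE : exists a : E -> R[i], a la = 1 /\
  forall x, p x = \sum_(mu <- SD) a mu * monomial mu x.
Proof.
have [[a [a1 ha]] _] := p_BS; exists a; split=> // x.
by rewrite ha fsbig_finite //; exact: dominant_finite.
Qed.

Let p_orth mu : dominant ip roots pos mu -> Qp (la - mu) -> mu <> la ->
  inner ip roots pos b ts tl p (monomial mu) = 0.
Proof. by move=> dm qm ml; apply: p_BS.2. Qed.

Let la_SD : la \in SD.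
Proof. by apply/mem_SD; rewrite subrr; split=> //; apply: Qp0. Qed.

Let appr_p : appr ip P p.
Proof.
have [a [_ ha]] := pE.
have h : appr ip P (fun x => \sum_(mu <- SD)
    if mu \in SD then a mu * monomial mu x else 0).
  apply: appr_sum => [|mu]; first exact: P0.
  case: (boolP (mu \in SD)) => [/mem_SD[[Pmu _] _]|_]; last exact/appr_cst/P0.
  apply: (apprM PD); first exact/appr_cst/P0.
  exact: appr_monomial.
by apply: appr_ext h => x; rewrite ha -big_mkcond -big_seq.
Qed.

Let p_weyl w x : weyl w -> p (w x) = p x.
Proof.
move=> ww; have [a [_ ha]] := pE; rewrite !ha; apply: eq_bigr => mu _.
by rewrite monomial_weyl.
Qed.

(** |W| times the inner product of p with g / delta, where conj(delta) is cancelled from the weight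
    beforehand to avoid dividing by a function with zeros. *)
Definition pairing (g : E -> R[i]) : R[i] :=
  CT (fun x => p x * conjc (g x) * (delta x * recip x)).

Let appr_dr : appr ip P (fun x => delta x * recip x).
Proof.
apply: (apprM PD); first exact: appr_delta.
exact: appr_recip.
Qed.

Let appr_pairing g : appr ip P g ->
  appr ip P (fun x => p x * conjc (g x) * (delta x * recip x)).
Proof.
move=> hg; apply: (apprM PD) appr_dr; apply: (apprM PD appr_p).
by apply: appr_conj hg => k; apply: PN.
Qed.

Lemma pairingD f g : appr ip P f -> appr ip P g ->
  pairing (fun x => f x + g x) = pairing f + pairing g.
Proof.
move=> /appr_pairing hf /appr_pairing hg.
rewrite /pairing -CTD; [|exact: appr_good hf|exact: appr_good hg].
by apply: CT_ext => x; rewrite rmorphD mulrDr mulrDl.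
Qed.

Lemma pairingZ c f : appr ip P f ->
  pairing (fun x => c * f x) = conjc c * pairing f.
Proof.
move=> /appr_pairing hf; rewrite /pairing -CTZ; last exact: appr_good hf.
apply: CT_ext => x; rewrite (rmorphM _ c (f x)) -!mulrA; exact: mulrCA.
Qed.

Lemma pairing_sum (r : seq (R[i] * E)) (F : E -> E -> R[i]) :
  (forall q, q \in r -> appr ip P (F q.2)) ->
  appr ip P (fun x => \sum_(q <- r) q.1 * F q.2 x) /\
  pairing (fun x => \sum_(q <- r) q.1 * F q.2 x) =
    \sum_(q <- r) conjc q.1 * pairing (F q.2).
Proof.
elim: r => [|q r IH] hr.
  split; first by apply: appr_ext (appr_cst ip 0 P0) => x; rewrite big_nil.
  rewrite big_nil -[RHS](CT_cst0 b); apply: CT_ext => x.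
  by rewrite big_nil rmorph0 mulr0 mul0r.
have [|h1 h2] := IH; first by move=> s sr; apply: hr; rewrite inE sr orbT.
have hq : appr ip P (F q.2) by apply: hr; rewrite mem_head.
have hcq : appr ip P (fun x => q.1 * F q.2 x).
  by apply: (apprM PD) hq; apply/appr_cst/P0.
have -> : (fun x => \sum_(s <- q :: r) s.1 * F s.2 x) =
    (fun x => q.1 * F q.2 x + \sum_(s <- r) s.1 * F s.2 x).
  by apply/funext => x; rewrite big_cons.
split; first exact: apprD.
by rewrite pairingD // pairingZ // h2 big_cons.
Qed.

Lemma pairing_ext f g : (forall x, f x = g x) -> pairing f = pairing g.
Proof. by move=> /funext ->. Qed.

Lemma appr_orbf k : P k -> appr ip P (orbf k).
Proof.
move=> Pk.
have h : appr ip P (fun x => \sum_(w <- W)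
    if w \in W then eps R[i] w * chr x (w k) else 0).
  apply: appr_sum => [|w]; first exact: P0.
  case: (boolP (w \in W)) => [/mem_W ww|_]; last exact/appr_cst/P0.
  apply: (apprM PD); first exact/appr_cst/P0.
  exact/appr_expi/P_weyl.
by apply: appr_ext h => x; rewrite -big_mkcond -big_seq.
Qed.

Lemma inner_pairing g : inner ip roots pos b ts tl p g =
  (size W)%:R^-1 * pairing (fun x => g x * delta x).
Proof.
rewrite (innerE ip roots pos ts tl p g b_basis.1).
rewrite weyl_orderE; congr (_ * _).
apply: CT_ext => x; rewrite weightE.
have -> : conjc (g x * delta x) = conjc (g x) * conjc (delta x).
  exact: rmorphM.
rewrite -!mulrA; congr (_ * (_ * _)); exact: mulrCA.
Qed.

Let sizeW_neq0 : (size W)%:R != 0 :> R[i].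
Proof. by rewrite pnatr_eq0 -lt0n par_size_gt0. Qed.

Lemma pairing_monomial_delta mu : dominant ip roots pos mu ->
  exists r : seq (R[i] * E),
  (forall q, q \in r ->
    [/\ strict 0 q.2, q.2 <> mu + rho & Qp (mu + rho - q.2)]) /\
  pairing (fun x => monomial mu x * delta x) = pairing (orbf (mu + rho)) +
    \sum_(q <- r) ((stab_size mu)%:R^-1 * conjc q.1) * pairing (orbf q.2).
Proof.
move=> dmu; have Pmu := dmu.1.
have [r [hr he]] := monomial_delta dmu.
exists r; split=> //; set s := (stab_size mu)%:R.
have s0 : s != 0 by apply: stab_size_neq0.
have Pr := P_rho.
have hq q : q \in r -> appr ip P (orbf q.2).
  move=> /hr[_ _ qq]; apply: appr_orbf; rewrite -[q.2](subKr (mu + rho)).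
  by apply/PD/PN/P_Qp => //; apply: PD.
have [ar Lr] := pairing_sum hq.
have am : appr ip P (fun x => monomial mu x * delta x).
  apply: (apprM PD); first exact: appr_monomial.
  exact: appr_delta.
have ao : appr ip P (orbf (mu + rho)) by apply/appr_orbf/PD.
have aso : appr ip P (fun x => s * orbf (mu + rho) x).
  by apply: (apprM PD) ao; apply/appr_cst/P0.
have sc : s^* = s by apply: conjc_nat.
apply: (mulfI s0); rewrite mulrDr -{1}sc -pairingZ // (pairing_ext he).
rewrite pairingD // pairingZ // sc.
rewrite Lr mulr_sumr; congr (_ + _); apply: eq_bigr => q _.
by rewrite !mulrA mulfV // mul1r.
Qed.

Lemma strict_dominant k : P k -> strict 0 k -> dominant ip roots pos (k - rho).
Proof.
move=> Pk /allP sk.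
have Pr := P_rho.
apply: simple_dominant => d dD.
have kd : ip k (coroot ip d) \is a Num.int by apply/Pk/D_root.
rewrite ipBl ip_rho //.
rewrite natrEint rpredB ?rpred1 //= subr_ge0 int_gt0_ge1 //.
by rewrite coroot_gt0 ?D_neq0 // sk // ppos0E D_pos.
Qed.

(** Induction on <k - rho, cr>. With mu = k - rho, the product m_mu delta is the alternating sum at
    k plus lower ones, which pair to 0 by induction, while <p, m_mu> = 0 because mu < lambda. *)
Lemma pairing_lower k : strict 0 k -> k <> la + rho -> Qp (la + rho - k) ->
  pairing (orbf k) = 0.
Proof.
have Pr := P_rho.
have Pbelow l : Qp (la + rho - l) -> P l.
  move=> ql; rewrite -[l](subKr (la + rho)).
  by apply/PD/PN/P_Qp => //; apply: PD.
have [m] : exists m : nat, ip (k - rho) cr < m%:R.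
  by exists (Num.truncn (ip (k - rho) cr)).+1; apply: truncnS_gt.
elim: m k => [|m IH] k hm sk kl qk.
  have := cr_dominant (strict_dominant (Pbelow _ qk) sk).
  by rewrite leNgt hm.
have Pk := Pbelow _ qk.
have dk := strict_dominant Pk sk.
have [r [hr]] := pairing_monomial_delta dk.
rewrite subrK => he.
have rest q : q \in r -> pairing (orbf q.2) = 0.
  move=> /hr; rewrite subrK => -[sq qk' qq].
  have qlq : Qp (la + rho - q.2).
    by rewrite -[la + rho](subrK k) -addrA; apply: QpD.
  apply: IH => //; last first.
    move=> ql; apply: kl; apply/eqP; rewrite -subr_eq0; apply/eqP.
    by apply: Qp_anti; rewrite ?opprB // -ql.
  have h1 : 1 <= ip (k - q.2) cr.
    by apply: cr_gt0 => // /eqP; rewrite subr_eq0 => /eqP /esym.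
  rewrite -(ltrD2r 1) natr1; apply: le_lt_trans hm.
  by move: h1; rewrite !ipBl; lra.
have {he} he : pairing (fun x => monomial (k - rho) x * delta x) =
  pairing (orbf k).
  rewrite he [X in _ + X]big_seq [X in _ + X]big1 ?addr0 //.
  by move=> q /rest ->; rewrite mulr0.
have o := @p_orth (k - rho) dk.
rewrite opprB addrA in o.
have /eqP : inner ip roots pos b ts tl p (monomial (k - rho)) = 0.
  by apply: o => // kr; apply: kl; rewrite -kr subrK.
rewrite inner_pairing he mulf_eq0 invr_eq0 (negbTE sizeW_neq0) orFb.
by move/eqP.
Qed.

Lemma pairing_top :
  pairing (orbf (la + rho)) = pairing (fun x => monomial la x * delta x).
Proof.
have [r [hr ->]] := pairing_monomial_delta la_dom.
rewrite [X in _ = _ + X]big_seq [X in _ = _ + X]big1 ?addr0 //.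
by move=> q /hr[h1 h2 h3]; rewrite pairing_lower ?mulr0.
Qed.

Let top x : R[i] := chr x (la + rho) * C x.
Let A x : R[i] := \sum_(w <- W) eps R[i] w *
  (chr x (w (la + rho)) * \prod_(a <- pos) cf a (chr x (- w a))).

Let AE x : A x = \sum_(w <- W) eps R[i] w * top (w^-1%VF x).
Proof.
rewrite /A big_seq [RHS]big_seq; apply: eq_bigr => w /mem_W ww.
have wi := weyl_inv ww.
rewrite /top chr_weyl // weyl_invK // (CE); congr (_ * (_ * _)).
by apply: eq_bigr => a _; rewrite chr_weyl // weyl_invK // linearN.
Qed.

Let appr_C : appr ip P C.
Proof.
have cf a : appr ip P (fun x => if a \in pos then cf a (chr x (- a)) else 1).
  case: (boolP (a \in pos)) => [ap|_]; last exact/appr_cst/P0.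
  have Pa : P (- a) by apply/PN/P_Qp/Qp_pos.
  have fa (t : R) : appr ip P (fun x => 1 + t%:C * chr x (- a)).
    apply: apprD; first exact/appr_cst/P0.
    apply: (apprM PD); first exact/appr_cst/P0.
    exact: appr_expi.
  rewrite /cfac /cfun; case: (long a).
    by apply: appr_prod => //; [apply: P0|apply: PD].
  by apply: appr_prod => //; [apply: P0|apply: PD].
have h := appr_prod pos P0 PD cf.
apply: appr_ext h => x; rewrite (CE).
by rewrite big_seq [RHS]big_seq; apply: eq_bigr => a ->.
Qed.

Let appr_top : appr ip P top.
Proof.
apply: (apprM PD) appr_C; apply: appr_expi; apply: PD => //.
exact: P_rho.
Qed.

Let CT_top : CT (fun x => p x * conjc (top x) * (delta x * recip x)) = 1.
Proof.
have [a [a1 ha]] := pE.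
pose T mu x := monomial mu x * chr x (- la) * kernel x.
have appr_T mu : mu \in SD -> appr ip P (T mu).
  move=> /mem_SD[[Pmu _] _]; apply: (apprM PD); last first.
    exact: (unital_appr unital_kernel).
  apply: (apprM PD); first exact: appr_monomial.
  exact/appr_expi/PN.
(* conj(C) cancels against [recip] and e^{-rho} against the leading factor of delta; [CT_term]
   computes what is left. *)
have key x : conjc (top x) * (delta x * recip x) =
    chr x (- la) * kernel x.
  have -> : conjc (top x) = chr x (- (la + rho)) * C (- x).
    by rewrite -(chr_conj) -(C_conj); exact: rmorphM.
  rewrite deltaE opprD (chrD x) /kernel /recip.
  have c0 : C (- x) != 0 by apply: C_neq0.
  have c1 : C x != 0 by apply: C_neq0.
  have r0 : chr x rho != 0 by apply: expi_neq0.
  have -> : chr x (- rho) = (chr x rho)^-1 by rewrite /chr ipNl expiN.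
  by field; rewrite c0 c1 r0.
have eqx x : p x * conjc (top x) * (delta x * recip x) =
    \sum_(mu <- SD) (if mu \in SD then a mu * T mu x else 0).
  rewrite -big_mkcond -big_seq -mulrA key ha mulr_suml.
  by apply: eq_bigr => mu _; rewrite /T !mulrA.
have aT mu : appr ip P (fun x => if mu \in SD then a mu * T mu x else 0).
  case: (boolP (mu \in SD)) => [muS|_]; last exact/appr_cst/P0.
  by apply: (apprM PD); [apply/appr_cst/P0|apply: appr_T].
rewrite (CT_ext b eqx) (CT_sum b _ aT) big_seq.
under eq_bigr => mu muS.
  rewrite muS CTZ; last by apply: appr_good; apply: appr_T.
  have [dmu qmu] := (mem_SD mu).1 muS.
  rewrite (CT_term P_la dmu qmu).
  over.
rewrite -big_seq (bigD1_seq la) //=; last exact: fset_uniq.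
rewrite eqxx mulr1 a1 big1 ?addr0 // => mu /negbTE ->.
by rewrite mulr0.
Qed.

Let appr_weyl f w : appr ip P f -> weyl w -> appr ip P (fun x => f (w x)).
Proof.
move=> hf ww e e0; have [g [[l [hl hg]] hfg]] := hf e e0.
exists (fun x => g (w x)); split; last by move=> x; apply: hfg.
exists [seq (q.1, (w^-1)%VF q.2) | q <- l]; split.
  by move=> _ /mapP[q /hl Pq ->]; apply: P_weyl => //; apply: weyl_inv.
move=> x; rewrite big_map hg; apply: eq_bigr => q _.
by rewrite /= -[expi (ip q.2 _)]/(chr (w x) q.2) chr_weyl.
Qed.

Let conj_eps w : conjc (eps R[i] w) = eps R[i] w.
Proof.
apply: etrans; first exact: rmorph_prod.
apply: eq_bigr => a _; rewrite /psign; case: ifP => _; first exact: rmorph1.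
exact: rmorphN1.
Qed.

(** p and [recip] are invariant and delta is alternating, so each [w] contributes the integrand of
    [top] composed with the inverse of [w]; by [CT_comp] its constant term is that of [top], namely
    1. *)
Lemma pairing_antisym : pairing A = (size W)%:R.
Proof.
pose H x := p x * conjc (top x) * (delta x * recip x).
have aH : appr ip P H by apply: appr_pairing appr_top.
have eqx x : p x * conjc (A x) * (delta x * recip x) =
    \sum_(w <- W) (if w \in W then H (w^-1%VF x) else 0).
  rewrite AE.
  have -> : conjc (\sum_(w <- W) eps R[i] w * top (w^-1%VF x)) =
      \sum_(w <- W) eps R[i] w * conjc (top (w^-1%VF x)).
    apply: etrans; first exact: rmorph_sum.
    apply: eq_bigr => w _; rewrite -[in RHS]conj_eps; exact: rmorphM.
  rewrite mulr_sumr mulr_suml big_seq [RHS]big_seq.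
  apply: eq_bigr => w wW; rewrite wW; have ww := (mem_W w).1 wW.
  have wi := weyl_inv ww; rewrite /H p_weyl // recip_weyl //.
  rewrite delta_weyl //.
  by rewrite eps_inv //; ring.
have aHw w : appr ip P (fun x => if w \in W then H (w^-1%VF x) else 0).
  case: (boolP (w \in W)) => [/mem_W ww|_]; last exact/appr_cst/P0.
  by apply: appr_weyl => //; apply: weyl_inv.
rewrite /pairing (CT_ext b eqx) (CT_sum b _ aHw) big_seq.
under eq_bigr => w wW.
  rewrite wW.
  have ww := (mem_W w).1 wW; have wi := weyl_inv ww.
  rewrite (@CT_comp _ _ ip n b b_basis.1 P P_basis P H _ w aH) => //;
    last 3 first.
  - by move=> k x; rewrite [in RHS]weyl_ipl.
  - by move=> k Pk; apply: P_weyl.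
  - by move=> k; rewrite -[X in _ == X](linear0 w) (inj_eq (weyl_inj ww)).
  over.
rewrite -big_seq CT_top.
by rewrite -sum1_size natr_sum.
Qed.

Local Notation Nc :=
  (\sum_(w <- par (lambda_tilde ip roots pos Ms Ml la))
     \prod_(a <- pos | w a \notin pos) (tr a)%:C).

(** The conjugate comes from [pairing] being semilinear; that the sum is real follows from
    [poincare_norm_const]. *)
Lemma inner_monomial :
  conjc Nc * inner ip roots pos b ts tl p (monomial la) = 1.
Proof.
have Pr := P_rho.
have sL := dominant_strict la_dom.
have [r [hr hA]] := C_expansion
  ts tl sL lt_nat.
have hq q : q \in r -> appr ip P (orbf q.2).
  move=> /hr[_ _ qq]; apply: appr_orbf; rewrite -[q.2](subKr (la + rho)).
  by apply/PD/PN/P_Qp => //; apply: PD.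
have [ar Lr] := pairing_sum hq.
have ao : appr ip P (orbf (la + rho)) by apply/appr_orbf/PD.
have aNo : appr ip P (fun x => Nc * orbf (la + rho) x).
  by apply: (apprM PD) ao; apply/appr_cst/P0.
have := pairing_antisym; rewrite (pairing_ext hA) pairingD // pairingZ // Lr.
rewrite [X in _ + X = _ -> _]big_seq [X in _ + X = _ -> _]big1 ?addr0;
  last first.
  by move=> q /hr[h1 h2 h3]; rewrite pairing_lower ?mulr0.
rewrite pairing_top => h; rewrite inner_pairing mulrCA h mulVf //.
Qed.

Lemma norm_poincare : inner ip roots pos b ts tl p p = (conjc Nc)^-1.
Proof.
have [a [a1 ha]] := pE.
have hp x : p x * delta x =
    \sum_(q <- [seq (a mu, mu) | mu <- SD]) q.1 * (monomial q.2 x * delta x).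
  by rewrite big_map ha mulr_suml; apply: eq_bigr => mu _; rewrite mulrA.
have hq q : q \in [seq (a mu, mu) | mu <- SD] ->
    appr ip P (fun x => monomial q.2 x * delta x).
  move=> /mapP[mu /mem_SD[[Pmu _] _] -> /=].
  apply: (apprM PD); first exact: appr_monomial.
  exact: appr_delta.
have [_ Lp] := pairing_sum (F := fun mu x => monomial mu x * delta x) hq.
rewrite inner_pairing (pairing_ext hp) Lp big_map mulr_sumr (bigD1_seq la) //=;
  last first.
  exact: fset_uniq.
rewrite big_seq_cond big1 ?addr0 => [|mu /andP[/mem_SD[dmu qmu] /eqP mul]].
  rewrite a1 (_ : conjc 1 = 1) ?mul1r; last exact: rmorph1.
  rewrite -inner_pairing; have := inner_monomial => h.
  have N0 : conjc Nc != 0.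
    by apply/eqP => N0; move: h; rewrite N0 mul0r => /eqP;
      rewrite eq_sym oner_eq0.
  by apply: (mulfI N0); rewrite h mulfV.
by rewrite mulrCA -inner_pairing p_orth // mulr0.
Qed.

(** * Evaluation of N by the product formula *)

Let tts0 : tt_s ts != 0.
Proof. by rewrite oppr_eq0; apply/prodf_neq0 => m _. Qed.

Let ttl0 : tt_l tl != 0.
Proof. by rewrite oppr_eq0; apply/prodf_neq0 => m _. Qed.

Lemma troot_neq0 a : tr a != 0.
Proof. by rewrite /troot; case: ifP. Qed.

(** Without parameters t_d would be -1. But <lambda~, d> = 0 means <lambda, d^vee> + 1 = M, which
    forces M > 0. *)
Lemma troot_lt1 d : d \in D -> ip lt d = 0 -> `|tr d| < 1.
Proof.
move=> dD /eqP; rewrite -(coroot_eq0 _ _ (D_neq0 dD)) ip_lt // subr_eq0 =>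
  /eqP h.
have la0 : 0 <= ip la (coroot ip d) by rewrite natr_ge0 // la_dom.2 // D_pos.
have : (0 < if long d then Ml else Ms)%N.
  by rewrite -(ltr_nat R) -h ltr_wpDl.
by rewrite /troot /tt_s /tt_l; case: ifP => _; rewrite normrN => ?;
  apply: norm_prod_lt1.
Qed.

(** The character e^{-k} = t_s^{ht_s(k)} t_l^{ht_l(k)}. The heights are linear in k through [hvec],
    but real for general k, while t_s and t_l may be negative; hence the complex powers. *)
Let e (k : E) : R[i] :=
  cpow (tt_s ts) (ip k (hvec pos_s)) * cpow (tt_l tl) (ip k (hvec pos_l)).

Let e0 : e 0 = 1.
Proof. by rewrite /e !ip0l !cpow0 mulr1. Qed.

Let eD : {morph e : x y / x + y >-> x * y}.
Proof. by move=> x y; rewrite /e !ipDl !cpowD mulrACA. Qed.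

Let short_S d a : d \in D -> a \in roots -> (~~ long (rfl d a)) = (~~ long a).
Proof. by move=> dD _; apply: short_rfl. Qed.

Let long_S d a : d \in D -> a \in roots -> long (rfl d a) = long a.
Proof. by move=> dD ar; apply/negb_inj/short_S. Qed.

Let short_N a : a \in roots -> (~~ long (- a)) = (~~ long a).
Proof. by rewrite longN. Qed.

Let long_N a : a \in roots -> long (- a) = long a.
Proof. by rewrite longN. Qed.

Let e_pos a : a \in pos -> e (- a) =
  (tt_s ts ^+ ht_s ip roots pos a * tt_l tl ^+ ht_l ip roots pos a)%:C.
Proof.
move=> ap; rewrite /e !ipNl !ip_hvec.
have -> : ht ip pos_s a = (ht_s ip roots pos a)%:R.
  exact/esym/(ht_truncn short_N short_S ap).
have -> : ht ip pos_l a = (ht_l ip roots pos a)%:R.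
  exact/esym/(ht_truncn long_N long_S ap).
by rewrite !cpowNn // -rmorphM.
Qed.

Let e_D d : d \in D -> e (- d) = (tr d)%:C.
Proof.
move=> dD; rewrite /e !ipNl !ip_hvec (ht_D short_N short_S dD).
rewrite (ht_D long_N long_S dD).
rewrite /troot; case: (long d) => /=;
  rewrite oppr0 cpow0 ?mul1r ?mulr1 cpowN1 //.
Qed.

(** In fact |e(-a)| < 1: - ln |e(-a)| is <a, u>, which is linear in [a] and positive at the simple
    roots orthogonal to lambda~, and [a] is a nontrivial nonnegative combination of these. *)
Let e_neq1 a : a \in ppos lt -> e (- a) != 1.
Proof.
rewrite mem_ppos => /andP[/eqP la0 ap].
have ltD d : d \in D -> 0 <= ip lt d by move=> dD; rewrite lt_ge0 // D_pos.
have [c [c0 hac hc]] := cone_simple ltD ap la0.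
pose u : E := (- ln `|tt_s ts|) *: hvec pos_s + (- ln `|tt_l tl|) *: hvec pos_l.
have ud d : d \in D -> ip d u = - ln `|tr d|.
  move=> dD; rewrite ipDr (ipZr _ _ _ (hvec pos_s)) (ipZr _ _ _ (hvec pos_l)).
  rewrite !ip_hvec (ht_D short_N short_S dD).
  rewrite (ht_D long_N long_S dD) /troot.
  by case: (long d); rewrite /= ?mulr0 ?mulr1 ?add0r ?addr0.
have ua : 0 < ip a u.
  have hge d : d \in D -> 0 <= c d * ip d u.
    move=> dD; have [/eqP ld|/hc->//] := boolP (ip lt d == 0);
      last by rewrite mul0r.
    rewrite mulr_ge0 // ud // oppr_ge0 ln_le0 //.
    by rewrite ltW // troot_lt1.
  have -> : ip a u = \sum_(d <- D) c d * ip d u.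
    by rewrite {1}hac ip_suml; apply: eq_bigr => d _; rewrite ipZl.
  rewrite lt_def big_seq sumr_ge0 // andbT psumr_eq0 //; apply/negP => /allP hz.
  have := pos_neq0 ap; rewrite hac big_seq big1 ?eqxx // => d dD.
  suff -> : c d = 0 by rewrite scale0r.
  have [/eqP ld|/hc->//] := boolP (ip lt d == 0).
  have := hz d dD; rewrite dD /= mulf_eq0 => /orP[/eqP//|].
  rewrite gt_eqF // ud // oppr_gt0 ln_lt0 // normr_gt0 troot_neq0 /=.
  exact: troot_lt1.
apply/eqP => h; have : ComplexField.Normc.normc (e (- a)) < 1.
  rewrite normcM !normc_cpow -expRD expR_lt1.
  move: ua; rewrite ipDr (ipZr _ _ _ (hvec pos_s)) (ipZr _ _ _ (hvec pos_l)).
  rewrite !ipNl; lra.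
by rewrite h normc1 ltxx.
Qed.

Lemma poincare_norm_const :
  \sum_(w <- par lt) \prod_(a <- pos | w a \notin pos) (tr a)%:C =
  (norm_const ip roots pos ts tl la)%:C.
Proof.
have qw w a : w \in par lt -> a \in ppos lt ->
    (tr (pabs (w a)))%:C = (tr a)%:C :> R[i].
  move=> /mem_par[ww _]; rewrite mem_ppos => /andP[_ ap].
  suff hl : long (pabs (w a)) = long a by rewrite /troot hl.
  by rewrite /pabs; case: (w a \in pos); rewrite ?longN long_weyl.
have qe d : d \in D -> ip lt d = 0 -> e (- d) = (tr d)%:C.
  by move=> dD _; exact: e_D.
have := poincare_product lt_ge0 e0 eD
  qw qe e_neq1.
(* An element of the stabilizer makes only roots orthogonal to lambda~ negative, so the inner
   products may run over all positive roots. *)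
rewrite big_seq; under eq_bigr => w wp.
  rewrite (big_neg_ppos lt_ge0) //.
  over.
rewrite -big_seq => ->.
have fE a : a \in pos -> (1 - (tr a)%:C * e (- a)) / (1 - e (- a)) =
    let hs := ht_s ip roots pos a in let hl := ht_l ip roots pos a in
    (if long a then (1 - tt_s ts ^+ hs * tt_l tl ^+ (1 + hl)) /
        (1 - tt_s ts ^+ hs * tt_l tl ^+ hl)
     else (1 - tt_s ts ^+ (1 + hs) * tt_l tl ^+ hl) /
        (1 - tt_s ts ^+ hs * tt_l tl ^+ hl))%:C.
  move=> ap /=; rewrite e_pos // -rmorphM -{1 2}(rmorph1 (real_complex R))
    -!rmorphB -fmorph_div.
  congr (_%:C); rewrite /troot; case: (long a); rewrite add1n exprS.
    by rewrite mulrCA.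
  by rewrite mulrA.
rewrite /norm_const rmorphM !rmorph_prod /= /ppos.
have cE a : a \in pos -> (ip lt (coroot ip a) == 0) = (ip lt a == 0).
  by move=> ap; apply/coroot_eq0/pos_neq0.
rewrite big_filter (bigID (fun a => ~~ long a)) /=; congr (_ * _).
  rewrite [RHS]big_filter_cond big_seq_cond [RHS]big_seq_cond.
  apply: eq_big => [a|a /andP[ap /andP[_ /negbTE la']]];
    last by rewrite fE // la'.
  by case ap: (a \in pos); rewrite //= cE // andbC.
rewrite [RHS]big_filter_cond big_seq_cond [RHS]big_seq_cond.
apply: eq_big => [a|a /andP[ap /andP[_]]].
  by case ap: (a \in pos); rewrite //= cE // negbK andbC.
by rewrite negbK => la'; rewrite fE // la'.
Qed.

Lemma inner_bernstein_szego :
  inner ip roots pos b ts tl p p =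
    ((norm_const ip roots pos ts tl la)^-1)%:C.
Proof.
by rewrite norm_poincare poincare_norm_const fmorphV; congr (_^-1);
  apply: conjc_real.
Qed.

End BernsteinSzego.

End RootSystem.

Theorem theorem2p3 (R : realType) (E : vectType R) (ip : {dot E for idfun})
  (roots pos : seq E)
  (roots_system : root_system ip roots)
  (roots_irreducible : irreducible ip roots)
  (pos_system : positive_system ip roots pos)
  (n : nat) (b : n.-tuple E)
  (b_basis : coroot_lattice_basis ip roots b)
  (Ms Ml : nat) (ts : 'I_Ms -> R) (tl : 'I_Ml -> R)
  (ts_range : forall m, -1 < ts m < 1 /\ ts m != 0)
  (tl_range : forall m, -1 < tl m < 1 /\ tl m != 0)
  (lambda : E) (lambda_dominant : dominant ip roots pos lambda)
  (lambda_deep : sufficiently_deep ip roots pos Ms Ml lambda)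
  (p : E -> R[i])
  (p_BS : bernstein_szego ip roots pos b ts tl lambda p) :
  inner ip roots pos b ts tl p p =
    ((norm_const ip roots pos ts tl lambda)^-1)%:C.
Proof.
have [pos_uniq [v v_root posE]] := pos_system.
have [D [D_pos D_gen D_refl]] := base_exists roots_system v_root posE pos_uniq.
exact: (inner_bernstein_szego roots_system v_root posE pos_uniq
  D_pos D_gen D_refl
  (fun m => (ts_range m).1) (fun m => (tl_range m).1) b_basis
  (fun m => (ts_range m).2) (fun m => (tl_range m).2)
  lambda_dominant lambda_deep p_BS).
Qed.
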